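(* Let $\mathcal G$ be a $\Gamma$-periodic graph in $\mathbb R^d$ with fundamental graph $G_*=(\mathcal V_*,\mathcal E_* )$, let $\alpha$ be a $\Gamma$-periodic magnetic potential and $Q$ a real $\Gamma$-periodic potential, and let $\mathfrak m\in\mathscr F(\kappa)$ and $\phi\in\mathscr F(\alpha)$ be minimal forms on $G_*$, where $\kappa$ and $\alpha$ are the coordinate form and the magnetic form on $G_*$. Then: (i) The image of $\mathfrak m$ generates the group $\mathbb Z^d$. The flux function of $\mathfrak m$ satisfies $\Phi_{\mathfrak m}(\mathcal C)=\mathbb Z^d$, where $\mathcal C$ is the cycle space of $G_*$. (ii) The magnetic Schrödinger operator $H_\alpha=\Delta_\alpha+Q$ on $\ell^2(\mathcal V)$ decomposes into the constant fiber direct integral $$\mathscr U_{\mathfrak m,\phi}\,H_\alpha\,\mathscr U_{\mathfrak m,\phi}^{-1}=\int_{\mathbb T^d}^{\oplus}H_{\mathfrak m,\phi}(\vartheta)\,\frac{d\vartheta}{(2\pi)^d},$$ where $\mathscr U_{\mathfrak m,\phi}=W_{\mathfrak m,\phi}U:\ell^2(\mathcal V)\to\mathscr H$ is the unitary product of the Gelfand transformation $U$ and the gauge transformation $W_{\mathfrak m,\phi}$, and for all $\vartheta\in\mathbb T^d$ $$H_{\mathfrak m,\phi}(\vartheta)=\Delta_{\mathfrak m,\phi}(\vartheta)+Q,$$ $$\big(\Delta_{\mathfrak m,\phi}(\vartheta)f\big)(v)=\varkappa_vf(v)-\sum_{\mathbf e=(v,u)\in\mathcal A_*}e^{i(\phi(\mathbf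 e)+\langle\mathfrak m(\mathbf e),\vartheta\rangle)}f(u),\qquad f\in\ell^2(\mathcal V_* ),\ v\in\mathcal V_*.$$ (iii) If $(\mathfrak m',\phi')\in\mathscr F(\kappa)\times\mathscr F(\alpha)$ are two other minimal forms on $G_*$, then for each $\vartheta\in\mathbb T^d$ the operators $\Delta_{\mathfrak m,\phi}(\vartheta)$ and $\Delta_{\mathfrak m',\phi'}(\vartheta)$ are unitarily equivalent. (iv) In the formula $\big(\Delta_{\mathfrak m,\phi}(\vartheta)f\big)(v)=\varkappa_vf(v)-\sum_{\mathbf e=(v,u)\in\mathcal A_*}e^{i(\phi(\mathbf e)+\langle\mathfrak m(\mathbf e),\vartheta\rangle)}f(u)$ for $\Delta_{\mathfrak m,\phi}(\cdot)$: the number of $\mathbf e\in\mathcal A_*$ for which the function $e^{i\langle\mathfrak m(\mathbf e),\,\cdot\,\rangle}$ is not identically $1$ equals $2\mathcal I$; the number of $\mathbf e\in\mathcal A_*$ with $e^{i\phi(\mathbf e)}\ne1$ equals $2\mathcal I_\alpha$; the number of $\mathbf e\in\mathcal A_*$ for which the function $e^{i(\phi(\mathbf e)+\langle\mathfrak m(\mathbf e),\,\cdot\,\rangle)}$ is not identically $1$ equals $2\mathcal I_{\mathfrak m,\phi}$, where $$\mathcal I=\tfrac12\#\operatorname{supp}\mathfrak m,\qquad \mathcal I_\alpha=\tfrac12\#\operatorname{supp}\phi,\qquad \mathcal I_{\mathfrak m,\phi}=\tfrac12\#(\operatorname{supp}\mathfrak m\cup\operatorname{supp}\phi).$$ (v)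 The number $\mathcal I$ does not depend on the choice of the minimal form $\mathfrak m\in\mathscr F(\kappa)$, on the choice of the embedding of $\mathcal G$ into $\mathbb R^d$, or on the choice of the basis $a_1,\ldots,a_d$ of the lattice $\Gamma$.
   Context: Periodic graphs. $\Gamma\subset\mathbb R^d$ is a lattice of rank $d$ with basis $a_1,\ldots,a_d$ and fundamental cell $\Omega=\{\sum_s t_sa_s:0\le t_s<1\}$. For $x=\sum_s t_sa_s\in\mathbb R^d$ write $x_{\mathbb A}=(t_1,\ldots,t_d)$. $\mathcal G=(\mathcal V,\mathcal E)$ is a connected infinite locally finite graph (loops and multiple edges allowed) embedded in $\mathbb R^d$, with $\mathcal G+a=\mathcal G$ for all $a\in\Gamma$ and finite quotient graph $G_*=\mathcal G/\Gamma=(\mathcal V_*,\mathcal E_* )$, the fundamental graph. $\mathcal A$ and $\mathcal A_*$ are the sets of oriented edges of $\mathcal G$ and $G_*$ (each unoriented edge has two orientations); $\underline{\mathbf e}$ is the inverse of $\mathbf e$; $(v,u)$ denotes an oriented edge from $v$ to $u$. The degree $\varkappa_v$ is the number of oriented edges starting at $v$ (a loop contributes 2). $\mathcal V_*$ is identified with $\mathcal V\cap\Omega$. Operators. A magnetic potential is $\alpha:\mathcal A\to\mathbb R$ with $\alpha(\underline{\mathbf e})=-\alpha(\mathbf e)$, $\alpha(\mathbf e+a)=\alpha(\mathbf e)$ for $a\in\Gamma$; $Q:\mathcal V\to\mathbb R$ is $\Gamma$-periodic and acts by multiplication. On $\ell^2(\mathcal V)$, $(\Delta_\alpha f)(v)=\sum_{\mathbf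 e=(v,u)\in\mathcal A}(f(v)-e^{i\alpha(\mathbf e)}f(u))$ and $H_\alpha=\Delta_\alpha+Q$. Forms. A 1-form on a finite connected graph with oriented edge set $A$ is $\mathfrak b:A\to\mathbb R^n$ with $\mathfrak b(\underline{\mathbf e})=-\mathfrak b(\mathbf e)$. $\mathcal C$ is the (integral) cycle space, generated by closed edge paths. The flux is $\Phi_{\mathfrak b}(\mathbf c)=\sum_{\mathbf e\in\mathbf c}\mathfrak b(\mathbf e)$, $\mathbf c\in\mathcal C$. $\mathscr F(\mathbf x)$ is the set of 1-forms $\mathfrak b$ with $\Phi_{\mathfrak b}=\Phi_{\mathbf x}$. A form $\mathfrak m\in\mathscr F(\mathbf x)$ is minimal if $\#\operatorname{supp}\mathfrak m\le\#\operatorname{supp}\mathfrak b$ for all $\mathfrak b\in\mathscr F(\mathbf x)$. On $G_*$: the coordinate form $\kappa:\mathcal A_*\to\mathbb R^d$ is induced by $\kappa(\mathbf e)=v_{\mathbb A}-u_{\mathbb A}$ for $\mathbf e=(u,v)\in\mathcal A$; the magnetic form $\alpha:\mathcal A_*\to\mathbb R$ is induced by the potential $\alpha$. For the magnetic form fluxes are taken modulo $2\pi$: $\mathscr F(\alpha)$ is the set of real 1-forms on $G_*$ with the same fluxes as $\alpha$ modulo $2\pi$. The index form $\tau:\mathcal A_*\to\mathbb Z^d$ is induced by $\tau(\mathbf e)=[v]_{\mathbb A}-[u]_{\mathbb A}$ for $\mathbf e=(u,v)\in\mathcal A$, where each $v\in\mathcal V$ is uniquely $v=\{v\}+[v]$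 with $\{v\}\in\Omega$, $[v]\in\Gamma$. Transformations. $\mathbb T^d=\mathbb R^d/(2\pi\mathbb Z)^d$, $\mathscr H=L^2(\mathbb T^d,\frac{d\vartheta}{(2\pi)^d},\ell^2(\mathcal V_* ))=\int^\oplus_{\mathbb T^d}\ell^2(\mathcal V_* )\frac{d\vartheta}{(2\pi)^d}$. $U:\ell^2(\mathcal V)\to\mathscr H$, $(Uf)(\vartheta,v)=\sum_{n\in\mathbb Z^d}e^{-i\langle n,\vartheta\rangle}f(v+n_1a_1+\dots+n_da_d)$. For $(\mathfrak b,\mathfrak a)\in\mathscr F(\kappa)\times\mathscr F(\alpha)$ and a fixed $v_0\in\mathcal V_*$, $(W_{\mathfrak b,\mathfrak a}g)(\vartheta,v)=e^{i(w_{\mathfrak a}(v)+\langle w_{\mathfrak b}(v),\vartheta\rangle)}g(\vartheta,v)$, where, for any oriented path $(\mathbf e_1,\ldots,\mathbf e_n)$ in $G_*$ from $v_0$ to $v$, $w_{\mathfrak b}(v)=\sum_s(\tau(\mathbf e_s)-\mathfrak b(\mathbf e_s))$ and $w_{\mathfrak a}(v)=\sum_s(\alpha(\mathbf e_s)-\mathfrak a(\mathbf e_s))$ (the latter defined modulo $2\pi$). $\langle\cdot,\cdot\rangle$ is the standard inner product in $\mathbb R^d$. *)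

(* Defs.v *)
From HB Require Import structures.
From mathcomp Require Import all_boot all_order all_algebra finmap.
From mathcomp Require Import generic_quotient archimedean.
From mathcomp Require Import all_classical all_reals all_analysis.
From mathcomp Require Import complex.

Set Implicit Arguments.
Unset Strict Implicit.
Unset Printing Implicit Defensive.

Import Order.TTheory GRing.Theory Num.Theory.
Import numFieldNormedType.Exports.

Local Open Scope classical_set_scope.
Local Open Scope ring_scope.
Local Open Scope complex_scope.
Local Open Scope quotient_scope.

(* [A] is the type of oriented edges: every unoriented edge, loops included,
   gives two distinct elements of [A], exchanged by [inv]. *)
Record mgraph (V A : Type) := MGraph {
  src : A -> V;
  tgt : A -> V;
  inv : A -> A;
  invK : involutive inv;
  inv_neq : forall e, inv e <> e;
  src_inv : forall e, src (inv e) = tgt e }.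

Fixpoint walk (V A : Type) (G : mgraph V A) (u : V) (p : seq A) (v : V) : Prop :=
  if p is e :: p' then src G e = u /\ walk G (tgt G e) p' v else u = v.

Definition connected_graph (V A : Type) (G : mgraph V A) :=
  forall u v, exists p, walk G u p v.

Definition gen_subgroup (M : zmodType) (S : set M) : set M :=
  [set x | forall H : set M, S `<=` H -> H 0 ->
     (forall y z, H y -> H z -> H (y - z)) -> H x].

Section Forms.
Variables (V A : finType) (G : mgraph V A).

Definition degree (v : V) : nat := #|[set e | src G e == v]%SET|.

(* An integral 1-chain is a function [c] on oriented edges such that
   c (inv e) = - c e; the inverse of an edge is thus its opposite. *)
Definition chain (p : seq A) : {ffun A -> int} :=
  [ffun e => (count_mem e p)%:Z - (count_mem (inv G e) p)%:Z].

Definition cycle_space : set {ffun A -> int} :=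
  gen_subgroup [set c | exists v p, walk G v p v /\ c = chain p].

Section Values.
Variable M : zmodType.
Implicit Types (b x : A -> M).

Definition is_form b := forall e, b (inv G e) = - b e.

(* The sum over the edges of [c]: each unoriented edge of the support of [c]
   contributes once, through the orientation on which [c] is positive. *)
Definition flux b (c : {ffun A -> int}) : M :=
  \sum_(e | 0 < c e) b e *~ c e.

Definition same_flux x : set (A -> M) :=
  [set b | is_form b /\ forall c, cycle_space c -> flux b c = flux x c].

Definition supp b : {set A} := [set e | b e != 0]%SET.

Definition minimal_form (F : set (A -> M)) m :=
  F m /\ forall b, F b -> (#|supp m| <= #|supp b|)%N.
End Values.

Definition same_flux_mod2pi (R : realType) (x : A -> R) : set (A -> R) :=
  [set b | is_form b /\ forall c, cycle_space c ->
     exists k : int, flux b c = flux x c + (2 * pi) *~ k].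

Definition half_card (S : {set A}) : rat := #|S|%:R / 2.

End Forms.

Section FluxSanity.
Variables (R : realType) (V A : finType) (G : mgraph V A) (M : lmodType R).

Lemma flux_chain (b : A -> M) (p : seq A) :
  is_form G b -> flux b (chain G p) = \sum_(e <- p) b e.
Proof.
move=> bF; set c := chain G p; set n := fun e => (count_mem e p)%:Z.
have cE e : c e = n e - n (inv G e) by rewrite ffunE.
have -> : \sum_(e <- p) b e = \sum_e b e *~ n e.
  rewrite [LHS](eq_bigr (fun x => \sum_e if x == e then b e else 0)); last first.
    move=> x _; rewrite (bigD1 x)//= eqxx big1 ?addr0// => e ne.
    by rewrite eq_sym (negbTE ne).
  rewrite exchange_big/=; apply: eq_bigr => e _.
  rewrite -big_mkcond/= big_const_seq iter_addr_0 /n -pmulrn.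
  by congr (_ *+ _); apply: eq_count.
suff [S1 S2] : \sum_e b e *~ n e = flux b c + \sum_(e | c e == 0) b e *~ n e
    /\ \sum_(e | c e == 0) b e *~ n e = 0.
  by rewrite S1 S2 addr0.
have ci e : c (inv G e) = - c e by rewrite !cE invK opprB.
split.
  rewrite (bigID (fun e => c e == 0))/= addrC; congr (_ + _).
  rewrite (bigID (fun e => 0 < c e))/=.
  rewrite (eq_bigl (fun e => 0 < c e)); last first.
    by move=> e; case: (ltgtP 0 (c e)).
  rewrite [X in _ + X](eq_bigl (fun e => c e < 0)); last first.
    by move=> e; case: (ltgtP 0 (c e)).
  rewrite [X in _ + X](reindex_inj (inv_inj (invK G)))/=.
  rewrite [X in _ + X](eq_bigl (fun e => 0 < c e)); last first.
    by move=> e; rewrite ci oppr_lt0.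
  rewrite -big_split/=; apply: eq_bigr => e _.
  by rewrite bF cE mulrzBr mulNrz.
set S := LHS.
have SN : S = - S.
  rewrite -sumrN {1}/S (reindex_inj (inv_inj (invK G)))/=.
  apply: eq_big => [e|e]; first by rewrite ci oppr_eq0.
  by rewrite ci oppr_eq0 cE subr_eq0 => /eqP nE; rewrite bF mulNrz -nE.
have SS : S + S = 0 by rewrite {1}SN addNr.
have /eqP : (2%:R : R) *: S = 0 by rewrite scaler_nat mulr2n.
by rewrite scaler_eq0 pnatr_eq0/= => /eqP.
Qed.

End FluxSanity.

Section Lattices.
Variables (R : realType) (d : nat).

Definition zvec (n : 'rV[int]_d) : 'rV[R]_d := map_mx intr n.

(* The rows of the matrix [B] are the vectors of the basis. *)
Definition zspan (B : 'M[R]_d) : set 'rV[R]_d := range (fun n => zvec n *m B).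

Record lattice := Lattice {
  lattice_set :> 'rV[R]_d -> Prop;
  lattice_ex_basis :
    exists B : 'M[R]_d, B \in unitmx /\ lattice_set = zspan B :> set _ }.

Record lattice_basis (Gam : lattice) := LatticeBasis {
  basis_mx :> 'M[R]_d;
  basis_unit : basis_mx \in unitmx;
  basis_span : lattice_set Gam = zspan basis_mx :> set _ }.

Implicit Types (B : 'M[R]_d) (x : 'rV[R]_d).

Definition cell B : set 'rV[R]_d :=
  [set t *m B | t in [set t : 'rV[R]_d | forall s, 0 <= t 0 s < 1]].

Definition lattice_coord B x : 'rV[R]_d := x *m invmx B.

Definition ipart B x : 'rV[int]_d := map_mx Num.floor (lattice_coord B x).

Definition fpart B x : 'rV[R]_d := x - zvec (ipart B x) *m B.

Lemma zvecD n1 n2 : zvec (n1 + n2) = zvec n1 + zvec n2.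
Proof. exact: map_mxD. Qed.

Lemma zvecN n : zvec (- n) = - zvec n.
Proof. exact: map_mxN. Qed.

Lemma zvec_inj : injective zvec.
Proof.
by move=> n k /matrixP E; apply/matrixP => i j; have := E i j; rewrite !mxE => /intr_inj.
Qed.

Lemma cell_fpart B x : B \in unitmx -> cell B (fpart B x).
Proof.
move=> uB; exists (lattice_coord B x - zvec (ipart B x)); last first.
  by rewrite mulmxBl mulmxKV.
move=> s; rewrite !mxE; set y := \sum_j _.
have /andP[y0 y1] := floor_itv y.
by rewrite subr_ge0 y0/= ltrBlDr addrC -[1]/(1%:~R) -intrD.
Qed.

Lemma fpart_unique B x y n : B \in unitmx ->
  cell B y -> x = y + zvec n *m B -> n = ipart B x /\ y = fpart B x.
Proof.
move=> uB [t t01 <-] ->.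
suff nE : n = ipart B (t *m B + zvec n *m B) by rewrite /fpart -nE addrK.
apply/rowP => s; rewrite /ipart /lattice_coord mulmxDl !mulmxK// !mxE.
apply/esym/Num.Theory.floor_def; rewrite intrD.
by have /andP[t0 t1] := t01 s; rewrite lerDr t0 addrC ltrD2l.
Qed.

Lemma part_transl B x n : B \in unitmx ->
  ipart B (x + zvec n *m B) = ipart B x + n /\
  fpart B (x + zvec n *m B) = fpart B x.
Proof.
move=> uB; have xE : x + zvec n *m B = fpart B x + zvec (ipart B x + n) *m B.
  by rewrite zvecD mulmxDl addrA subrK.
by have [<- <-] := fpart_unique uB (cell_fpart x uB) xE.
Qed.

Lemma lattice0 (Gam : lattice) : Gam 0.
Proof.
by have [B [_ ->]] := lattice_ex_basis Gam; exists 0; rewrite // /zvec map_mx0 mul0mx.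
Qed.

Lemma latticeD (Gam : lattice) a b : Gam a -> Gam b -> Gam (a + b).
Proof.
have [B [_ ->]] := lattice_ex_basis Gam => -[n _ <-] [k _ <-].
by exists (n + k); rewrite // zvecD mulmxDl.
Qed.

Lemma latticeN (Gam : lattice) a : Gam a -> Gam (- a).
Proof.
have [B [_ ->]] := lattice_ex_basis Gam => -[n _ <-].
by exists (- n); rewrite // zvecN mulNmx.
Qed.

Lemma basis_lattice (Gam : lattice) (B : lattice_basis Gam) n :
  Gam (zvec n *m B).
Proof. by rewrite (basis_span B); exists n. Qed.

End Lattices.

(* The embedding of the graph is recorded by the positions of the vertices and
   by the action of the lattice by translations on vertices and on edges.
   [vtr] and [dtr] are only meaningful for translation vectors in [Gam]. *)
Record periodic_graph (R : realType) (d : nat) (Gam : lattice R d) :=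
  PeriodicGraph {
  pvert : choiceType;
  pdart : choiceType;
  pgraph : mgraph pvert pdart;
  ppos : pvert -> 'rV[R]_d;
  vtr : pvert -> 'rV[R]_d -> pvert;
  dtr : pdart -> 'rV[R]_d -> pdart;
  ppos_inj : injective ppos;
  ppos_vtr : forall v a, Gam a -> ppos (vtr v a) = ppos v + a;
  dtr0 : forall e, dtr e 0 = e;
  dtrD : forall e a b, Gam a -> Gam b -> dtr e (a + b) = dtr (dtr e a) b;
  src_dtr : forall e a, Gam a -> src pgraph (dtr e a) = vtr (src pgraph e) a;
  tgt_dtr : forall e a, Gam a -> tgt pgraph (dtr e a) = vtr (tgt pgraph e) a;
  inv_dtr : forall e a, Gam a -> inv pgraph (dtr e a) = dtr (inv pgraph e) a;
  pg_connected : connected_graph pgraph;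
  pg_infinite : infinite_set [set: pvert];
  pg_locally_finite : forall v, finite_set [set e | src pgraph e = v];
  pg_finite_vert :
    finite_set (range (fun v => [set vtr v a | a in [set a | Gam a]]));
  pg_finite_dart :
    finite_set (range (fun e => [set dtr e a | a in [set a | Gam a]])) }.

Section Potentials.
Variables (R : realType) (d : nat) (Gam : lattice R d) (G : periodic_graph Gam).

Definition magnetic_potential (alpha : pdart G -> R) :=
  (forall e, alpha (inv (pgraph G) e) = - alpha e) /\
  (forall e a, Gam a -> alpha (dtr e a) = alpha e).

Definition periodic_potential (Q : pvert G -> R) :=
  forall v a, Gam a -> Q (vtr v a) = Q v.

End Potentials.

(* The same abstract graph with the same lattice action, embedded in two
   (possibly different) ways: [fV], [fA] is a graph isomorphism which
   intertwines the translations through a group isomorphism [sg]. *)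
Definition same_periodic_graph (R : realType) (d : nat) (Gam Gam' : lattice R d)
    (G : periodic_graph Gam) (G' : periodic_graph Gam') : Prop :=
  exists (fV : pvert G -> pvert G') (fA : pdart G -> pdart G')
         (sg : 'rV[R]_d -> 'rV[R]_d),
  [/\ bijective fV, bijective fA,
      (forall e, [/\ src (pgraph G') (fA e) = fV (src (pgraph G) e),
                     tgt (pgraph G') (fA e) = fV (tgt (pgraph G) e)
                   & inv (pgraph G') (fA e) = fA (inv (pgraph G) e)]),
      (set_bij [set a | Gam a] [set a | Gam' a] sg /\
       forall a b, Gam a -> Gam b -> sg (a + b) = sg a + sg b)
    & (forall v a, Gam a -> fV (vtr v a) = vtr (fV v) (sg a)) /\
      (forall e a, Gam a -> fA (dtr e a) = dtr (fA e) (sg a))].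

Section FiniteInstance.
Variables (T : choiceType) (Tfin : finite_set [set: T]).

Let enum_T : seq T := enum_fset (fset_set [set: T]).

Let mem_enum_T x : x \in enum_T.
Proof. by rewrite /enum_T in_fset_set// in_setT. Qed.

Let index_enumK : pcancel (index^~ enum_T) (onth enum_T).
Proof.
move=> x; rewrite onthE (nth_map x) ?index_mem ?mem_enum_T//.
by rewrite nth_index ?mem_enum_T.
Qed.

Definition finite_set_countable := PCanIsCountable index_enumK.

Lemma finite_set_enum : exists s : seq T, forall x, count_mem x s = 1%N.
Proof.
by exists enum_T => x; rewrite count_uniq_mem ?fset_uniq// mem_enum_T.
Qed.

Lemma finite_set_axiom : Finite.axiom (projT1 (cid finite_set_enum)).
Proof. exact: (projT2 (cid finite_set_enum)). Qed.

End FiniteInstance.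

Section FundamentalDarts.
Variables (R : realType) (d : nat) (Gam : lattice R d) (G : periodic_graph Gam).

Definition dart_equiv : rel (pdart G) :=
  fun e e' => `[< exists2 a, Gam a & e' = dtr e a >].

Lemma dart_equiv_equiv : equiv_class_of dart_equiv.
Proof.
split=> [e|e e'|e2 e1 e3].
- by apply/asboolP; exists 0; [exact: lattice0|rewrite dtr0].
- apply/asboolP/asboolP => -[a Ga ->]; exists (- a); try exact: latticeN;
    by rewrite -dtrD ?subrr ?dtr0//; exact: latticeN.
- move=> /asboolP[a Ga ->] /asboolP[b Gb ->]; apply/asboolP.
  by exists (a + b); [exact: latticeD|rewrite dtrD].
Qed.

Canonical dart_equivRel := EquivRelPack dart_equiv_equiv.

Definition fdart := {eq_quot dart_equiv}.

HB.instance Definition _ := Choice.on fdart.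
HB.instance Definition _ := EqQuotient.on fdart.

Lemma pi_dtr e a : Gam a -> \pi_fdart (dtr e a) = \pi_fdart e.
Proof.
by move=> Ga; apply/esym/eqmodP/asboolP; exists a.
Qed.

Lemma repr_pi_dtr e : exists2 a, Gam a & repr (\pi_fdart e) = dtr e a.
Proof.
have /eqmodP/asboolP[a Ga ->] : e = repr (\pi_fdart e) %[mod fdart].
  by rewrite reprK.
by exists a.
Qed.

Lemma fdart_finite : finite_set [set: fdart].
Proof.
pose f (E : fdart) := [set dtr (repr E) a | a in [set a | Gam a]].
have f_inj : {in [set: fdart] &, injective f}.
  move=> E E' _ _ fE; have : f E' (repr E').
    by exists 0; [exact: lattice0|rewrite dtr0].
  by rewrite -fE => -[a Ga aE]; rewrite -[E]reprK -[E']reprK -aE pi_dtr.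
rewrite -(eq_finite_set (inj_card_eq f_inj)).
by apply: sub_finite_set (pg_finite_dart G) => _ [E _ <-]; exists (repr E).
Qed.

HB.instance Definition _ : isCountable fdart := finite_set_countable fdart_finite.
HB.instance Definition _ :=
  fintype.isFinite.Build fdart (finite_set_axiom fdart_finite).

End FundamentalDarts.

Section FundamentalGraph.
Variables (R : realType) (d : nat) (Gam : lattice R d) (G : periodic_graph Gam).
Variable B : lattice_basis Gam.

(* The vertices of the fundamental graph are those of the graph in the
   fundamental cell; its oriented edges are the orbits [fdart G]. *)
Definition fvert : Type := {v : pvert G | `[< cell B (ppos v) >]}.

HB.instance Definition _ := Choice.on fvert.
HB.instance Definition _ := SubType.on fvert.

Lemma fvert_finite : finite_set [set: fvert].
Proof.
pose f (v : fvert) := [set vtr (val v) a | a in [set a | Gam a]].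
have f_inj : {in [set: fvert] &, injective f}.
  move=> u v _ _ fE; have : f v (val v).
    exists 0; first exact: lattice0.
    by apply: (@ppos_inj _ _ _ G); rewrite ppos_vtr ?addr0//; exact: lattice0.
  rewrite -fE => -[a Ga aE]; apply/val_inj/(@ppos_inj _ _ _ G).
  have := congr1 (@ppos _ _ _ G) aE; rewrite ppos_vtr// => {}aE.
  move: (Ga); rewrite /= (basis_span B) => -[n _ nE].
  have [cu cv] := (asboolW (valP u), asboolW (valP v)).
  have [_ ->] := fpart_unique (basis_unit B) cu (esym (etrans (congr1 _ nE) aE)).
  have vE : ppos (val v) = ppos (val v) + zvec R 0 *m B.
    by rewrite /zvec map_mx0 mul0mx addr0.
  by have [_ <-] := fpart_unique (basis_unit B) cv vE.
rewrite -(eq_finite_set (inj_card_eq f_inj)).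
by apply: sub_finite_set (pg_finite_vert G) => _ [v _ <-]; exists (val v).
Qed.

HB.instance Definition _ : isCountable fvert := finite_set_countable fvert_finite.
HB.instance Definition _ :=
  fintype.isFinite.Build fvert (finite_set_axiom fvert_finite).

Definition vshift (v : pvert G) (n : 'rV[int]_d) : pvert G :=
  vtr v (zvec R n *m B).

Lemma fred_subproof v : `[< cell B (ppos (vshift v (- ipart B (ppos v)))) >].
Proof.
apply/asboolP; rewrite ppos_vtr; last exact: basis_lattice.
by rewrite zvecN mulNmx; exact/cell_fpart/basis_unit.
Qed.

(* {v}, as a vertex of the fundamental graph *)
Definition fred (v : pvert G) : fvert :=
  exist _ (vshift v (- ipart B (ppos v))) (fred_subproof v).

Lemma fred_vtr v a : Gam a -> fred (vtr v a) = fred v.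
Proof.
move=> Ga; apply/val_inj/(@ppos_inj _ _ _ G) => /=.
move: (Ga); rewrite (basis_span B) => -[n _ nE].
rewrite !ppos_vtr//; try exact: basis_lattice.
rewrite !zvecN !mulNmx -/(fpart B (ppos v)) -/(fpart B (ppos v + a)).
by rewrite -nE; have [_ ->] := part_transl (ppos v) n (basis_unit B).
Qed.

Definition fsrc (E : fdart G) : fvert := fred (src (pgraph G) (repr E)).
Definition ftgt (E : fdart G) : fvert := fred (tgt (pgraph G) (repr E)).
Definition fdinv (E : fdart G) : fdart G := \pi_(fdart G) (inv (pgraph G) (repr E)).

Lemma fsrc_pi e : fsrc (\pi_(fdart G) e) = fred (src (pgraph G) e).
Proof. by rewrite /fsrc; have [a Ga ->] := repr_pi_dtr e; rewrite src_dtr ?fred_vtr. Qed.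

Lemma ftgt_pi e : ftgt (\pi_(fdart G) e) = fred (tgt (pgraph G) e).
Proof. by rewrite /ftgt; have [a Ga ->] := repr_pi_dtr e; rewrite tgt_dtr ?fred_vtr. Qed.

Lemma fdinv_pi e : fdinv (\pi_(fdart G) e) = \pi_(fdart G) (inv (pgraph G) e).
Proof. by rewrite /fdinv; have [a Ga ->] := repr_pi_dtr e; rewrite inv_dtr ?pi_dtr. Qed.

Lemma fdinvK : involutive fdinv.
Proof. by move=> E; rewrite {2}/fdinv fdinv_pi invK reprK. Qed.

Lemma fdinv_neq E : fdinv E <> E.
Proof.
rewrite -[E]reprK fdinv_pi => /esym/eqmodP/asboolP[a Ga]; move: (repr E) => e eE.
have := congr1 (src (pgraph G)) eE; rewrite src_inv src_dtr// => tE.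
have := congr1 (tgt (pgraph G)) eE.
rewrite -src_inv invK tgt_dtr// tE => /(congr1 (@ppos _ _ _ G)).
rewrite !ppos_vtr// -addrA -[X in X = _]addr0 => /addrI/esym/eqP.
rewrite -mulr2n -scaler_nat scaler_eq0 pnatr_eq0/= => /eqP a0.
by move: eE; rewrite a0 dtr0; exact: inv_neq.
Qed.

Lemma fsrc_inv E : fsrc (fdinv E) = ftgt E.
Proof. by rewrite -[E]reprK fdinv_pi fsrc_pi ftgt_pi src_inv. Qed.

Definition fundamental_graph : mgraph fvert (fdart G) := MGraph fdinvK fdinv_neq fsrc_inv.

(* A periodic function of the oriented edges of the graph induces a function
   on [fdart G]; any representative of the orbit may be used. *)
Definition coordinate_form (E : fdart G) : 'rV[R]_d :=
  let e := repr E in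
  lattice_coord B (ppos (tgt (pgraph G) e)) - lattice_coord B (ppos (src (pgraph G) e)).

Definition index_form (E : fdart G) : 'rV[int]_d :=
  let e := repr E in
  ipart B (ppos (tgt (pgraph G) e)) - ipart B (ppos (src (pgraph G) e)).

Definition magnetic_form (alpha : pdart G -> R) (E : fdart G) : R :=
  alpha (repr E).

Lemma coordinate_form_pi e : coordinate_form (\pi_(fdart G) e) =
  lattice_coord B (ppos (tgt (pgraph G) e)) - lattice_coord B (ppos (src (pgraph G) e)).
Proof.
rewrite /coordinate_form; have [a Ga ->] := repr_pi_dtr e.
by rewrite src_dtr// tgt_dtr// !ppos_vtr// /lattice_coord !mulmxDl opprD addrACA subrr addr0.
Qed.

Lemma ipart_vtr (v : pvert G) a : Gam a ->
  zvec R (ipart B (ppos (vtr v a))) *m B = zvec R (ipart B (ppos v)) *m B + a.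
Proof.
move=> Ga; rewrite ppos_vtr//; move: (Ga); rewrite (basis_span B) => -[n _ nE].
have [nE' _] := part_transl (ppos v) n (basis_unit B).
by rewrite -nE nE' zvecD mulmxDl.
Qed.

Lemma index_form_pi e : index_form (\pi_(fdart G) e) =
  ipart B (ppos (tgt (pgraph G) e)) - ipart B (ppos (src (pgraph G) e)).
Proof.
rewrite /index_form; have [a Ga ->] := repr_pi_dtr e.
apply: (@zvec_inj R); rewrite !zvecD !zvecN.
apply: (can_inj (mulmxK (basis_unit B))).
rewrite src_dtr// tgt_dtr// !mulmxDl !mulNmx !ipart_vtr//.
by rewrite opprD addrACA subrr addr0.
Qed.

Lemma magnetic_form_pi (alpha : pdart G -> R) e : magnetic_potential alpha ->
  magnetic_form alpha (\pi_(fdart G) e) = alpha e.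
Proof.
by move=> [_ aP]; rewrite /magnetic_form; have [a Ga ->] := repr_pi_dtr e; rewrite aP.
Qed.

End FundamentalGraph.

Section Torus.
Variable R : realType.

(* Square-integrable functions on the torus are given by their values on
   R^n, and are identified when they agree almost everywhere on [0, 2 pi]^n;
   [torus_prob] is the normalized Lebesgue measure of that cube. *)
Definition torus (n : nat) := n.-tuple (measurableTypeR R).

Lemma twopi_gt0 : 0 < 2 * pi :> R.
Proof. by rewrite mulr_gt0// pi_gt0. Qed.

Definition torus_cons (n : nat) (x : measurableTypeR R * torus n) : torus n.+1 :=
  [tuple of x.1 :: x.2].

Lemma measurable_torus_cons n : measurable_fun setT (@torus_cons n).
Proof. exact: measurable_cons. Qed.

HB.instance Definition _ n :=
  isMeasurableFun.Build _ _ _ _ (@torus_cons n) (@measurable_torus_cons n).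

Fixpoint torus_prob (n : nat) : probability (torus n) R :=
  if n is n'.+1 then
    distribution (uniform_prob twopi_gt0 \x torus_prob n')%E (@torus_cons n')
  else dirac ([tuple of [::]] : torus 0).

Definition dot (n : nat) (x : 'rV[R]_n) (t : torus n) : R :=
  \sum_i x 0 i * (tnth t i : R).

Definition expi (x : R) : R[i] := cos x +i* sin x.

End Torus.

Section HilbertSpaces.
Variable R : realType.

Definition sqmod (z : R[i]) : \bar R := ((Normc.normc z) ^+ 2)%:E.

Definition l2norm2 (V : choiceType) (f : V -> R[i]) : \bar R :=
  (\esum_(v in [set: V]) sqmod (f v))%E.

Definition l2 (V : choiceType) : set (V -> R[i]) :=
  [set f | (l2norm2 f < +oo)%E].

Variables (n : nat) (V : finType).
Implicit Types g h : torus R n -> V -> R[i].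

Definition fiber_space : set (torus R n -> V -> R[i]) :=
  [set g | forall v,
    [/\ measurable_fun [set: torus R n]
          (fun t => complex.Re (g t v) : measurableTypeR R),
        measurable_fun [set: torus R n]
          (fun t => complex.Im (g t v) : measurableTypeR R)
      & (\int[torus_prob R n]_t sqmod (g t v) < +oo)%E]].

Definition fiber_norm2 g : \bar R :=
  (\sum_v \int[torus_prob R n]_t sqmod (g t v))%E.

Definition ae_eq_fiber g h := {ae torus_prob R n, forall t, g t = h t}.

Definition unitary_to_fiber_space (W : choiceType)
    (U : (W -> R[i]) -> torus R n -> V -> R[i]) :=
  [/\ forall f, l2 f -> fiber_space (U f),
      forall (a : R[i]) f f', l2 f -> l2 f' ->
        ae_eq_fiber (U (fun w => a * f w + f' w))
                    (fun t v => a * U f t v + U f' t v),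
      forall f, l2 f -> fiber_norm2 (U f) = l2norm2 f
    & forall g, fiber_space g -> exists2 f, l2 f & ae_eq_fiber (U f) g].

Definition direct_integral (K : torus R n -> (V -> R[i]) -> V -> R[i]) g :
    torus R n -> V -> R[i] :=
  fun t => K t (g t).

Definition unitary_operator (S : (V -> R[i]) -> V -> R[i]) :=
  [/\ forall (a : R[i]) f f',
        S (fun v => a * f v + f' v) = fun v => a * S f v + S f' v,
      forall f f', \sum_v S f v * (S f' v)^* = \sum_v f v * (f' v)^*
    & forall f, exists f', S f' = f].

Definition unitarily_equivalent (D D' : (V -> R[i]) -> V -> R[i]) :=
  exists S, unitary_operator S /\ forall f, S (D f) = D' (S f).

End HilbertSpaces.

Section Operators.
Variable R : realType.

(* The sum over the edges starting at [v] is finite in a locally finite graph. *)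
Definition magnetic_laplacian (V A : choiceType) (G : mgraph V A)
    (alpha : A -> R) (f : V -> R[i]) (v : V) : R[i] :=
  \sum_(e \in [set e | src G e = v]) (f v - expi (alpha e) * f (tgt G e)).

Definition schroedinger (V A : choiceType) (G : mgraph V A)
    (alpha : A -> R) (Q : V -> R) (f : V -> R[i]) (v : V) : R[i] :=
  magnetic_laplacian G alpha f v + (Q v)%:C * f v.

Definition fiber_laplacian (V A : finType) (G : mgraph V A) (n : nat)
    (m : A -> 'rV[R]_n) (phi : A -> R) (t : torus R n)
    (f : V -> R[i]) (v : V) : R[i] :=
  (degree G v)%:R * f v -
  \sum_(e | src G e == v) expi (phi e + dot (m e) t) * f (tgt G e).

Definition fiber_schroedinger (V A : finType) (G : mgraph V A) (n : nat)
    (m : A -> 'rV[R]_n) (phi : A -> R) (Q : V -> R) (t : torus R n)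
    (f : V -> R[i]) (v : V) : R[i] :=
  fiber_laplacian G m phi t f v + (Q v)%:C * f v.

End Operators.

Section Transformations.
Variables (R : realType) (d : nat) (Gam : lattice R d) (G : periodic_graph Gam).
Variable B : lattice_basis Gam.

Definition gelfand_sum (S : {fset 'rV[int]_d}) (f : pvert G -> R[i])
    (t : torus R d) (v : fvert G B) : R[i] :=
  \sum_(k <- S) expi (- dot (zvec R k) t) * f (vshift B (val v) k).

(* [g] is the sum of the Gelfand series of [f], which for a general [f] in l2
   converges unconditionally in L2 of the torus. *)
Definition is_gelfand (f : pvert G -> R[i]) : set (torus R d -> fvert G B -> R[i]) :=
  [set g : torus R d -> fvert G B -> R[i] | fiber_space g /\
    forall (v : fvert G B) (eps : R), 0 < eps ->
    exists S0 : {fset 'rV[int]_d}, forall S, (S0 `<=` S)%fset ->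
    (\int[torus_prob R d]_t sqmod (g t v - gelfand_sum S f t v)%R <= eps%:E)%E].

Definition gelfand (f : pvert G -> R[i]) : torus R d -> fvert G B -> R[i] :=
  xget (fun _ _ => 0) (is_gelfand f).

Variable v0 : fvert G B.

Definition path_to (v : fvert G B) : seq (fdart G) :=
  xget [::] [set p | walk (fundamental_graph G B) v0 p v].

Definition path_sum (M : zmodType) (b : fdart G -> M) (p : seq (fdart G)) : M :=
  \sum_(e <- p) b e.

Definition gauge_potential (b : fdart G -> 'rV[R]_d) (v : fvert G B) : 'rV[R]_d :=
  path_sum (fun e => zvec R (index_form B e) - b e) (path_to v).

Definition gauge_phase (alpha : pdart G -> R) (a : fdart G -> R)
    (v : fvert G B) : R :=
  path_sum (fun e => magnetic_form alpha e - a e) (path_to v).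

Definition gauge_transform (alpha : pdart G -> R) (b : fdart G -> 'rV[R]_d)
    (a : fdart G -> R) (g : torus R d -> fvert G B -> R[i]) :
    torus R d -> fvert G B -> R[i] :=
  fun t v => expi (gauge_phase alpha a v + dot (gauge_potential b v) t) * g t v.

End Transformations.

(* Main.v *)
Require Import Defs.
From mathcomp Require Import all_boot all_order all_algebra finmap.
From mathcomp Require Import generic_quotient.
From mathcomp Require Import all_classical all_reals all_analysis.
From mathcomp Require Import measurable_realfun complex.
From mathcomp Require Import ring lra.

Set Implicit Arguments.
Unset Strict Implicit.
Unset Printing Implicit Defensive.

Import Order.TTheory GRing.Theory Num.Theory.
Import numFieldNormedType.Exports.

Local Open Scope classical_set_scope.
Local Open Scope ring_scope.
Local Open Scope complex_scope.
Local Open Scope quotient_scope.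

(** The theorem has a combinatorial part, about 1-forms on the fundamental
    graph, and an analytic part, about Fourier series on the torus.

    A 1-form whose fluxes lie in a subgroup [K] is a coboundary modulo [K]: sum
    it along walks from a base point.  Two forms therefore have the same fluxes
    modulo [K] exactly when they are gauge equivalent modulo [K]
    ([flux_classP]).  Both classes of the theorem are of this kind, with [K]
    trivial for the coordinate form and [K] generated by 2 pi for the magnetic
    form.  The edges where a minimal form [m] vanishes connect all vertices,
    since otherwise a cut of the graph would allow a gauge transformation that
    diminishes the support ([minimal_zero_walk]).  Closing an edge by a walk
    along which [m] vanishes shows that each value of [m] is a flux of [m].
    Fluxes of the coordinate form are exactly the integral vectors, because the
    graph is connected and invariant under the lattice
    ([flux_coordinate_range]); this gives (i).  A value of a minimal form that
    lies in [K] must be zero, as otherwise it could be replaced by zero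
    ([minimal_value_eq0]); together with integrality, an exponential of a
    minimal form is trivial only where the form vanishes, which gives (iv).

    A gauge transformation of the forms conjugates the fiber Laplacian by a
    diagonal unitary matrix ([fiber_laplacian_gauge]).  This gives (iii) and
    reduces (ii) to the index form, that is, to the Gelfand transformation
    alone.  There, the vertices of the graph are the pairs of a vertex of the
    fundamental graph and an integral vector, and the Gelfand transform of [f]
    has the values of [f] as Fourier coefficients.  Exponentials are orthonormal
    (one coordinate at a time, [torus_mean]), so series with square summable
    coefficients converge ([riesz_fischer]), and they are complete
    ([wave_complete]), so a square integrable function is determined by its
    coefficients.  Hence an identity on the fibers can be checked on
    coefficients, where multiplication by the exponential of the index of an
    edge is the shift by that index ([gelfand_fiber_coef]).

    For (v), forms with the fluxes of the coordinate form are the differences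
    of equivariant positions of the vertices ([same_flux_coordinateP]), a
    description that mentions the embedding and the basis only through the
    linear coordinates of translations.  Such positions can be carried along an
    isomorphism of periodic graphs without enlarging the support
    ([transport_same_flux]), in both directions. *)

(** * Walks and fluxes of 1-forms *)

Section Walks.
Variables (V A : Type) (G : mgraph V A).

Lemma tgt_inv e : tgt G (Defs.inv G e) = src G e.
Proof. by rewrite -src_inv Defs.invK. Qed.

Lemma walk_cat u p q w :
  walk G u (p ++ q) w <-> exists2 v, walk G u p v & walk G v q w.
Proof.
elim: p u => [|e p IH] u /=.
  by split=> [|[v <-]//]; exists u.
split=> [[-> /IH[v pv qv]]|[v [-> pv] qv]]; first by exists v.
by split=> //; apply/IH; exists v.
Qed.

Lemma walk_rev u p v : walk G u p v -> walk G v (rev (map (Defs.inv G) p)) u.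
Proof.
elim: p u => [|e p IH] u /=; first by move=> ->.
move=> [<- /IH pv]; rewrite rev_cons -cats1; apply/walk_cat.
by exists (tgt G e) => //=; rewrite src_inv tgt_inv.
Qed.

Lemma walk_telescope (M : zmodType) (h : V -> M) u p v : walk G u p v ->
  \sum_(e <- p) (h (tgt G e) - h (src G e)) = h v - h u.
Proof.
elim: p u => [|e p IH] u /=; first by move=> ->; rewrite big_nil subrr.
by move=> [<- /IH pv]; rewrite big_cons pv addrC addrA subrK.
Qed.

Lemma walk_exit (S : set V) u p v : walk G u p v -> S u -> ~ S v ->
  exists e, S (src G e) /\ ~ S (tgt G e).
Proof.
elim: p u => [|e p IH] u /=; first by move=> ->.
move=> [<- pv] Su Sv; have [St|St] := pselect (S (tgt G e)); last by exists e.
exact: IH pv St Sv.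
Qed.

End Walks.

Definition is_subgroup (M : zmodType) (K : set M) :=
  K 0 /\ forall x y, K x -> K y -> K (x - y).

Section Subgroups.
Variables (M : zmodType) (K : set M).
Hypothesis KK : is_subgroup K.

Lemma subgroupN x : K x -> K (- x).
Proof. by move: KK => [K0 KB] Kx; rewrite -[- x]add0r; exact: KB. Qed.

Lemma subgroupD x y : K x -> K y -> K (x + y).
Proof. by move=> Kx Ky; rewrite -[y]opprK; apply: KK.2 => //; exact: subgroupN. Qed.

Lemma subgroup_sum I (r : seq I) (P : pred I) (F : I -> M) :
  (forall i, P i -> K (F i)) -> K (\sum_(i <- r | P i) F i).
Proof.
by move=> KF; elim/big_ind : _ => //; [exact: KK.1|exact: subgroupD].
Qed.

Lemma subgroupMz x n : K x -> K (x *~ n).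
Proof.
move=> Kx; have Kn k : K (x *+ k).
  by elim: k => [|k IH]; [exact: KK.1|rewrite mulrS; exact: subgroupD].
by case: n => n; [exact: Kn|rewrite NegzE mulrNz; exact/subgroupN/Kn].
Qed.

End Subgroups.

Lemma gen_subgroup_is_subgroup (M : zmodType) (S : set M) :
  is_subgroup (gen_subgroup S).
Proof.
by split=> [H _ //|x y Sx Sy H SH H0 HB]; exact: HB (Sx H SH H0 HB) (Sy H SH H0 HB).
Qed.

Lemma sub_gen_subgroup (M : zmodType) (S : set M) : S `<=` gen_subgroup S.
Proof. by move=> x Sx H SH _ _; exact: SH. Qed.

Lemma gen_subgroup_sub (M : zmodType) (S K : set M) :
  is_subgroup K -> S `<=` K -> gen_subgroup S `<=` K.
Proof. by move=> [K0 KB] SK x; apply. Qed.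

Lemma is_subgroup0 (M : zmodType) : is_subgroup [set 0 : M].
Proof. by split=> // x y -> ->; rewrite subrr. Qed.

Lemma is_subgroup_mulz (M : zmodType) (x : M) : is_subgroup (range (fun k : int => x *~ k)).
Proof.
split; first by exists 0; rewrite ?mulr0z //.
by move=> _ _ [k _ <-] [l _ <-]; exists (k - l); rewrite ?mulrzBr //.
Qed.

Section FluxClass.
Variables (R : realType) (V A : finType) (G : mgraph V A) (M : lmodType R).
Implicit Types (b x : A -> M) (c : {ffun A -> int}) (K : set M).

Definition antisymmetric_chain c := forall e, c (Defs.inv G e) = - c e.

Lemma chain_antisymmetric p : antisymmetric_chain (chain G p).
Proof. by move=> e; rewrite !ffunE Defs.invK opprB. Qed.

(** [flux] uses one orientation of each edge, chosen by the sign of the chain,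
    so it is not visibly additive in the chain.  Its double is: both
    orientations contribute equally. *)
Lemma flux_double b c : is_form G b -> antisymmetric_chain c ->
  flux b c *+ 2 = \sum_e b e *~ c e.
Proof.
move=> bF cF; rewrite [RHS](bigID (fun e => 0 < c e))/= mulr2n; congr (_ + _).
rewrite (bigID (fun e => c e == 0))/= big1 ?add0r; last first.
  by move=> e /andP[_ /eqP ->].
rewrite /flux (reindex_inj (inv_inj (Defs.invK G)))/=.
apply: eq_big => [e|e _]; last by rewrite bF cF mulrNz mulNrz opprK.
by rewrite cF oppr_gt0; case: ltgtP.
Qed.

Lemma double_inj : injective (fun y : M => y *+ 2).
Proof.
move=> y z /eqP; rewrite -subr_eq0 -mulrnBl -scaler_nat scaler_eq0 pnatr_eq0/=.
by rewrite subr_eq0 => /eqP.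
Qed.

Lemma flux_chainB b c c' : is_form G b -> antisymmetric_chain c ->
  antisymmetric_chain c' -> flux b (c - c') = flux b c - flux b c'.
Proof.
move=> bF cF cF'; apply: double_inj; rewrite mulrnBl !flux_double//.
  by rewrite -sumrB; apply: eq_bigr => e _; rewrite !ffunE mulrzBr.
by move=> e; rewrite !ffunE cF cF' opprB opprK addrC.
Qed.

Lemma flux_formB b x c : flux (fun e => b e - x e) c = flux b c - flux x c.
Proof. by rewrite /flux -sumrB; apply: eq_bigr => e _; rewrite mulrzBl. Qed.

Lemma cycle_space_chain v p : walk G v p v -> cycle_space G (chain G p).
Proof. by move=> vp; apply: sub_gen_subgroup; exists v, p. Qed.

(** Chains of closed walks generate the cycle space, and the flux is additive
    on antisymmetric chains, in particular on cycles. *)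
Lemma flux_in_subgroup K b : is_subgroup K -> is_form G b ->
  (forall v p, walk G v p v -> K (\sum_(e <- p) b e)) ->
  forall c, cycle_space G c -> K (flux b c).
Proof.
move=> KK bF Kb c cc.
suff [] : antisymmetric_chain c /\ K (flux b c) by [].
move: c cc; apply: gen_subgroup_sub; last first.
  move=> _ [v [p [vp ->]]]; split; first exact: chain_antisymmetric.
  by rewrite flux_chain//; exact: Kb vp.
split=> [|c c' [cF Kc] [cF' Kc']].
  split; first by move=> e; rewrite !ffunE.
  rewrite /flux big1; first exact: KK.1.
  by move=> e _; rewrite ffunE mulr0z.
split; last by rewrite flux_chainB//; apply: KK.2.
by move=> e; rewrite !ffunE cF cF' opprB opprK addrC.
Qed.

(** Trivial [K] gives equality of fluxes and [K] generated by 2 pi gives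
    equality modulo 2 pi, so that the minimal coordinate form and the minimal
    magnetic form are instances of the same theory. *)
Definition flux_class K x : set (A -> M) :=
  [set b | is_form G b /\ forall c, cycle_space G c -> K (flux b c - flux x c)].

Lemma same_fluxE x : same_flux G x = flux_class [set 0] x.
Proof.
apply/seteqP; split=> b [bF bx]; split=> // c /bx.
  by move=> ->; rewrite subrr.
by move=> /eqP; rewrite subr_eq0 => /eqP.
Qed.

Hypothesis conG : connected_graph G.

Lemma sum_rev_walk b p : is_form G b ->
  \sum_(e <- rev (map (Defs.inv G) p)) b e = - \sum_(e <- p) b e.
Proof.
move=> bF; rewrite big_rev/= big_map -sumrN.
by apply: eq_bigr => e _; rewrite bF.
Qed.

(** A form whose sums along closed walks lie in [K] has a primitive modulo
    [K], namely its sums along walks from a base point; so two forms have the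
    same fluxes modulo [K] exactly when they differ by a gauge modulo [K]. *)
Lemma flux_classP K x b : is_subgroup K -> is_form G x ->
  flux_class K x b <-> is_form G b /\
    exists h : V -> M, forall e, K (b e - x e - (h (tgt G e) - h (src G e))).
Proof.
move=> KK xF; split=> [[bF bx]|[bF [h bh]]]; split=> //.
  have bxF : is_form G (fun e => b e - x e).
    by move=> e; rewrite bF xF opprB opprK addrC.
  have closedK v p : walk G v p v -> K (\sum_(e <- p) (b e - x e)).
    move=> vp; rewrite -(flux_chain p bxF) flux_formB.
    by apply: bx; exact: cycle_space_chain vp.
  have [[v0]|V0] := pselect (inhabited V); last first.
    by exists (fun=> 0) => e; case: V0; exists; exact: src G e.
  have [P wP] : exists P : V -> seq A, forall v, walk G v0 (P v) v.
    by exists (fun v => projT1 (cid (conG v0 v))) => v; case: cid.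
  pose h v := \sum_(e <- P v) (b e - x e); exists h => e.
  have := @closedK v0 (P (src G e) ++ e :: rev (map (Defs.inv G) (P (tgt G e)))).
  rewrite big_cat big_cons/= sum_rev_walk// -/(h _) -/(h _).
  rewrite opprB addrCA; apply.
  apply/walk_cat; exists (src G e) => //=; split=> //; exact: walk_rev.
move=> c cc; rewrite -flux_formB; apply: flux_in_subgroup c cc => //.
  by move=> e; rewrite bF xF opprB opprK addrC.
move=> v p vp.
rewrite (eq_bigr (fun e => (b e - x e - (h (tgt G e) - h (src G e)))
                           + (h (tgt G e) - h (src G e)))); last first.
  by move=> e _; rewrite subrK.
by rewrite big_split/= (walk_telescope h vp) subrr addr0; exact: subgroup_sum.
Qed.

(** * Minimal forms *)
Section Minimal.
Variables (K : set M) (x m : A -> M).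
Hypotheses (KK : is_subgroup K) (xF : is_form G x).
Hypothesis mmin : minimal_form (flux_class K x) m.

Let mF : is_form G m. Proof. by have [[]] := mmin. Qed.

Lemma minimal_not_proper b :
  flux_class K x b -> supp b \proper supp m -> False.
Proof.
by move=> bK /proper_card; rewrite ltnNge (mmin.2 _ bK).
Qed.

(** Otherwise the part [S] reachable from [u] along edges where [m] vanishes
    is cut off by edges where it does not, and adding a multiple of the
    coboundary of [S] kills one of them without creating any other. *)
Lemma minimal_zero_walk u v :
  exists p, walk G u p v /\ forall e, e \in p -> m e = 0.
Proof.
pose S := [set v | exists p, walk G u p v /\ forall e, e \in p -> m e = 0].
apply: contrapT => nSv; have [p up] := conG u v.
have Su : S u by exists [::].
have [e0 [Ss St]] := walk_exit (S := S) up Su nSv.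
have Sext e : m e = 0 -> S (src G e) -> S (tgt G e).
  move=> me [q [uq q0]]; exists (rcons q e); split.
    by rewrite -cats1; apply/walk_cat; exists (src G e).
  by move=> e'; rewrite mem_rcons inE => /orP[/eqP ->//|/q0].
pose h v : M := if `[< S v >] then m e0 else 0.
pose b e := m e + (h (tgt G e) - h (src G e)).
have [[_ mK] _] := mmin.
have bK : flux_class K x b.
  apply/flux_classP => //; split.
    by move=> e; rewrite /b mF src_inv tgt_inv opprD opprB.
  have /(flux_classP _ KK xF)[_ [h' mh]] : flux_class K x m by [].
  exists (fun v => h' v + h v) => e; rewrite /b.
  have -> : h' (tgt G e) + h (tgt G e) - (h' (src G e) + h (src G e)) =
      h' (tgt G e) - h' (src G e) + (h (tgt G e) - h (src G e)).
    by rewrite opprD addrACA.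
  move: (mh e) (h (tgt G e) - h (src G e)) => + y.
  move: (h' _ - h' _) => z Kz.
  by rewrite opprD (addrAC (m e)) addrACA subrr addr0.
apply: (minimal_not_proper bK); apply/properP; split.
  apply/fintype.subsetP => e; rewrite !inE; apply: contra_neq => me.
  rewrite /b me add0r /h.
  have -> : `[< S (tgt G e) >] = `[< S (src G e) >]; last by rewrite subrr.
  apply/asbool_equiv_eq; split; last exact: Sext.
  by rewrite -src_inv -(tgt_inv G e); apply: Sext; rewrite mF me oppr0.
exists e0; rewrite !inE.
  by apply/eqP => me; exact/St/Sext.
by rewrite negbK /b /h asboolF// asboolT// sub0r subrr.
Qed.

(** Closing the edge [e] by a walk along which [m] vanishes turns the value
    [m e] into the sum of [m] along a closed walk. *)
Lemma minimal_value_subgroup (K' : set M) :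
  (forall v p, walk G v p v -> K' (\sum_(e <- p) m e)) -> forall e, K' (m e).
Proof.
move=> Kp e; have [p [wp p0]] := minimal_zero_walk (tgt G e) (src G e).
have /Kp : walk G (src G e) (e :: p) (src G e) by [].
by rewrite big_cons big_seq big1 ?addr0// => e' /p0.
Qed.

(** Otherwise the value could be replaced by [0] on [e] and its inverse, which
    leaves the fluxes unchanged modulo [K] and diminishes the support. *)
Lemma minimal_value_eq0 e : K (m e) -> m e = 0.
Proof.
move=> Ke; apply: contrapT => /eqP me0.
pose b e' : M := if (e' == e) || (e' == Defs.inv G e) then 0 else m e'.
have inv_eq e1 e2 : (Defs.inv G e1 == e2) = (e1 == Defs.inv G e2).
  by rewrite -(inj_eq (inv_inj (Defs.invK G))) Defs.invK.
apply: (@minimal_not_proper b); last first.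
  apply/properP; split.
    apply/fintype.subsetP => e'; rewrite !inE /b; case: ifP => //.
    by rewrite eqxx.
  by exists e; rewrite !inE// /b eqxx/= eqxx.
have [mK _] := mmin; move: (mK) => /(flux_classP _ KK xF)[_ [h mh]].
apply/flux_classP => //; split.
  move=> e'; rewrite /b inv_eq (inj_eq (inv_inj (Defs.invK G))) orbC.
  by case: ifP; rewrite ?oppr0.
exists h => e'; rewrite /b; case: ifP => // /orP e'e.
have := mh e'; move: (h _ - h _) => y Ky.
have -> : 0 - x e' - y = m e' - x e' - y - m e'.
  by rewrite [RHS]addrAC (addrAC (m e')) subrr.
by apply: KK.2 => //; case: e'e => /eqP -> //; rewrite mF; exact: subgroupN.
Qed.

End Minimal.

End FluxClass.

Lemma same_flux_mod2piE (R : realType) (V A : finType) (G : mgraph V A)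
    (x : A -> R) :
  same_flux_mod2pi G x =
  flux_class (M := R^o) G (range (fun k : int => (2 * pi : R^o) *~ k)) x.
Proof.
apply/seteqP; split=> b [bF bx]; split=> // c /bx [k].
  by move=> ->; exists k => //; rewrite addrC addKr.
by move=> _ kE; exists k; rewrite kE addrC subrK.
Qed.

(** * Forms on the fundamental graph *)
Section Quotient.
Variables (R : realType) (d : nat) (Gam : lattice R d) (G : periodic_graph Gam).
Variable B : lattice_basis Gam.
Let Gs := fundamental_graph G B.

Lemma zvec0 : zvec R (0 : 'rV[int]_d) = 0.
Proof. exact: map_mx0. Qed.

Lemma zvecB (n k : 'rV[int]_d) : zvec R (n - k) = zvec R n - zvec R k.
Proof. by rewrite zvecD zvecN. Qed.

Lemma vtrD (v : pvert G) a b : Gam a -> Gam b -> vtr v (a + b) = vtr (vtr v a) b.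
Proof.
move=> Ga Gb; apply: (@ppos_inj _ _ _ G).
by rewrite !ppos_vtr// ?addrA//; exact: latticeD.
Qed.

Lemma vtr0 (v : pvert G) : vtr v 0 = v.
Proof. by apply: (@ppos_inj _ _ _ G); rewrite ppos_vtr ?addr0//; exact: lattice0. Qed.

Lemma vtr_inj (v : pvert G) a b : Gam a -> Gam b -> vtr v a = vtr v b -> a = b.
Proof.
by move=> Ga Gb /(congr1 (@ppos _ _ _ G)); rewrite !ppos_vtr// => /addrI.
Qed.

Lemma fred_val (v : fvert G B) : fred B (val v) = v.
Proof.
apply/val_inj => /=; rewrite /vshift -[RHS]vtr0; congr vtr.
have cv := asboolW (valP v).
have vE : ppos (val v) = ppos (val v) + zvec R 0 *m B by rewrite zvec0 mul0mx addr0.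
have [<- _] := fpart_unique (basis_unit B) cv vE.
by rewrite oppr0 zvec0 mul0mx.
Qed.

Lemma val_fredE (v : pvert G) : exists2 a, Gam a & val (fred B v) = vtr v a.
Proof. by exists (zvec R (- ipart B (ppos v)) *m B) => //; exact: basis_lattice. Qed.

Lemma periodic_fred (T : Type) (g : pvert G -> T) :
  (forall v a, Gam a -> g (vtr v a) = g v) -> forall v, g (val (fred B v)) = g v.
Proof. by move=> gP v; have [a Ga ->] := val_fredE v; rewrite gP. Qed.

Lemma fundamental_walk u p v : walk (pgraph G) u p v ->
  walk Gs (fred B u) (map \pi_(fdart G) p) (fred B v).
Proof.
elim: p u => [|e p IH] u /=; first by move=> ->.
by move=> [<- /IH]; rewrite fsrc_pi ftgt_pi.
Qed.

Lemma fundamental_connected : connected_graph Gs.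
Proof.
move=> u v; have [p /fundamental_walk] := pg_connected (val u) (val v).
by rewrite !fred_val => uv; exists (map \pi_(fdart G) p).
Qed.

Lemma coordinate_form_is_form : is_form Gs (coordinate_form B).
Proof.
move=> E; rewrite -[E]reprK /= fdinv_pi !coordinate_form_pi.
by rewrite src_inv tgt_inv opprB.
Qed.

Lemma magnetic_form_is_form (alpha : pdart G -> R) : magnetic_potential alpha ->
  is_form Gs (magnetic_form alpha).
Proof.
move=> ap E; rewrite -[E]reprK /= fdinv_pi !(magnetic_form_pi _ ap).
exact: ap.1.
Qed.

Lemma lattice_coord_vtr (v : pvert G) a : Gam a ->
  lattice_coord B (ppos (vtr v a)) = lattice_coord B (ppos v) + lattice_coord B a.
Proof. by move=> Ga; rewrite ppos_vtr// /lattice_coord mulmxDl. Qed.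

Lemma lattice_coord_zspan n : lattice_coord B (zvec R n *m B) = zvec R n.
Proof. by rewrite /lattice_coord mulmxK//; exact: basis_unit. Qed.

Lemma ipart_coord_vtr (v : pvert G) a : Gam a ->
  zvec R (ipart B (ppos (vtr v a))) = zvec R (ipart B (ppos v)) + lattice_coord B a.
Proof.
by move=> Ga; rewrite -[LHS](mulmxK (basis_unit B)) ipart_vtr// mulmxDl
  (mulmxK (basis_unit B)).
Qed.

(** Two assignments of equivariant positions to the vertices differ by a
    periodic function, which is a gauge transformation on the quotient; and any
    gauge transformation moves the given positions to other equivariant ones.
    This is the form in which the class is compared between embeddings. *)
Lemma same_flux_coordinateP (b : fdart G -> 'rV[R]_d) :
  same_flux Gs (coordinate_form B) b <->
  exists p : pvert G -> 'rV[R]_d,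
    (forall v a, Gam a -> p (vtr v a) = p v + lattice_coord B a) /\
    forall e, b (\pi_(fdart G) e) = p (tgt (pgraph G) e) - p (src (pgraph G) e).
Proof.
rewrite same_fluxE.
rewrite (flux_classP fundamental_connected _ (@is_subgroup0 _) coordinate_form_is_form).
split=> [[bF [h bh]]|[p [pa bp]]].
  exists (fun v => lattice_coord B (ppos v) + h (fred B v)); split.
    by move=> v a Ga; rewrite lattice_coord_vtr// fred_vtr// addrAC.
  move=> e; have /eqP := bh (\pi_(fdart G) e).
  rewrite subr_eq0 subr_eq /= ftgt_pi fsrc_pi coordinate_form_pi => /eqP ->.
  by rewrite opprD [RHS]addrACA addrC.
split.
  move=> E; rewrite -[E]reprK /= fdinv_pi !bp.
  by rewrite src_inv tgt_inv opprB.
exists (fun v => p (val v) - lattice_coord B (ppos (val v))) => E.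
rewrite -[E]reprK -[tgt _ _]/(ftgt B _) -[src _ _]/(fsrc B _) ftgt_pi fsrc_pi bp coordinate_form_pi.
set g := fun v => p v - lattice_coord B (ppos v).
have gP v a : Gam a -> g (vtr v a) = g v.
  by move=> Ga; rewrite /g pa// lattice_coord_vtr// opprD addrACA subrr addr0.
rewrite -!/(g _) !(periodic_fred gP) /g /=; apply/eqP; rewrite subr_eq0 !opprB.
by rewrite addrACA [X in _ == X]addrACA [- p _ - _]addrC.
Qed.

(** The integer parts of the positions are themselves equivariant positions. *)
Lemma index_same_flux : same_flux Gs (coordinate_form B) (@zvec R d \o index_form B).
Proof.
apply/same_flux_coordinateP; exists (fun v => zvec R (ipart B (ppos v))).
by split=> [v a /ipart_coord_vtr //|e]; rewrite /= index_form_pi zvecB.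
Qed.

Lemma is_subgroup_zvec : is_subgroup (range (@zvec R d)).
Proof.
split; first by exists 0 => //; exact: zvec0.
by move=> _ _ [n _ <-] [k _ <-]; exists (n - k) => //; exact: zvecB.
Qed.

(** Fluxes of the coordinate form are those of the integral index form, and a
    walk of the graph from [v] to a translate of [v] projects to a closed walk
    whose flux is the translation, so that every integral vector occurs. *)
Lemma flux_coordinate_range :
  [set flux (coordinate_form B) c | c in cycle_space Gs] = range (@zvec R d).
Proof.
apply/seteqP; split=> [_ [c cc <-]|_ [n _ <-]].
  rewrite -(index_same_flux.2 _ cc).
  apply: flux_in_subgroup c cc; first exact: is_subgroup_zvec.
    exact: index_same_flux.1.
  move=> v p _; apply: subgroup_sum; first exact: is_subgroup_zvec.
  by move=> E _; exists (index_form B E).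
have [v _] := infinite_setN0 (@pg_infinite _ _ _ G).
have Gn : Gam (zvec R n *m B) by exact: basis_lattice.
have [p vp] := pg_connected v (vtr v (zvec R n *m B)).
have := fundamental_walk vp; rewrite fred_vtr// => wp.
exists (chain Gs (map \pi_(fdart G) p)); first exact: cycle_space_chain wp.
rewrite flux_chain; last exact: coordinate_form_is_form.
rewrite big_map; under eq_bigr do rewrite coordinate_form_pi.
rewrite (walk_telescope (fun v => lattice_coord B (ppos v)) vp).
by rewrite lattice_coord_vtr// lattice_coord_zspan addrC addKr.
Qed.

Lemma flux_minimal_range m : same_flux Gs (coordinate_form B) m ->
  [set flux m c | c in cycle_space Gs] = range (@zvec R d).
Proof.
move=> [_ mE]; rewrite -flux_coordinate_range.
by apply/seteqP; split=> _ [c cc <-]; exists c => //; rewrite mE.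
Qed.

Lemma minimal_integral m :
  minimal_form (same_flux Gs (coordinate_form B)) m -> range m `<=` range (@zvec R d).
Proof.
rewrite same_fluxE => mmin _ [E _ <-].
apply: (minimal_value_subgroup fundamental_connected _ _ mmin).
- exact: is_subgroup0.
- exact: coordinate_form_is_form.
move=> v p vp; have mF : is_form Gs m by case: mmin => -[].
rewrite -(flux_chain p mF) -(@flux_minimal_range m).
  by exists (chain Gs p) => //; exact: cycle_space_chain vp.
by rewrite same_fluxE; case: mmin.
Qed.

Lemma minimal_generates m :
  minimal_form (same_flux Gs (coordinate_form B)) m ->
  gen_subgroup (range m) = range (@zvec R d).
Proof.
move=> mmin; apply/seteqP; split.
  apply: gen_subgroup_sub; first exact: is_subgroup_zvec.
  exact: minimal_integral.
rewrite -(flux_minimal_range mmin.1) => _ [c _ <-].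
have KK := gen_subgroup_is_subgroup (range m).
by apply: (subgroup_sum KK) => E _; apply: (subgroupMz KK); apply: sub_gen_subgroup; exists E.
Qed.

End Quotient.

(** * Transport along isomorphisms of periodic graphs *)
Section TransportPrelim.
Variables (R : realType) (d : nat) (Gam : lattice R d) (B : lattice_basis Gam).

Lemma same_periodic_graph_refl (G : periodic_graph Gam) : same_periodic_graph G G.
Proof.
exists id, id, id; split=> //; [by exists id|by exists id|split=> //; split=> //].
by move=> a Ga; exists a.
Qed.

(** An additive map is determined by its values on a basis of the lattice, so
    on the lattice it agrees with a linear map of the whole space. *)
Lemma lattice_additive_matrix (sg : 'rV[R]_d -> 'rV[R]_d) :
  (forall a b, Gam a -> Gam b -> sg (a + b) = sg a + sg b) ->
  exists S : 'M[R]_d, forall a, Gam a -> sg a = lattice_coord B a *m S.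
Proof.
move=> sgD.
have GB n : Gam (zvec R n *m B) by exact: basis_lattice.
pose s n := sg (zvec R n *m B).
have sD n k : s (n + k) = s n + s k by rewrite /s zvecD mulmxDl sgD.
have s0 : s 0 = 0 by apply: (@addrI _ (s 0)); rewrite -sD !addr0.
have sN n : s (- n) = - s n by apply: (@addrI _ (s n)); rewrite -sD !subrr.
have sMn n k : s (n *+ k) = s n *+ k.
  by elim: k => [|k IH]; rewrite ?mulr0n// !mulrS sD IH.
have sMz n k : s (n *~ k) = s n *~ k.
  by case: k => k; [exact: sMn|rewrite !NegzE !mulrNz sN; congr (- _); exact: sMn].
have sS I (r : seq I) (F : I -> 'rV[int]_d) : s (\sum_(i <- r) F i) = \sum_(i <- r) s (F i).
  by elim: r => [|i r IH]; rewrite ?big_nil// !big_cons sD IH.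
exists (\matrix_i s (delta_mx 0 i)) => a.
rewrite (basis_span B) => -[n _ <-]; rewrite lattice_coord_zspan -/(s n).
rewrite {1}(row_sum_delta n) sS mulmx_sum_row; apply: eq_bigr => i _.
rewrite rowK mxE scaler_int -sMz; congr s.
by rewrite -scaler_int intz.
Qed.

End TransportPrelim.

Section Transport.
Variables (R : realType) (d : nat) (Gam Gam' : lattice R d).
Variables (G : periodic_graph Gam) (G' : periodic_graph Gam').
Variables (B : lattice_basis Gam) (B' : lattice_basis Gam').

Lemma lattice_iso_inverse (sg : 'rV[R]_d -> 'rV[R]_d) :
  set_bij [set a | Gam a] [set a | Gam' a] sg ->
  (forall a b, Gam a -> Gam b -> sg (a + b) = sg a + sg b) ->
  exists tg : 'rV[R]_d -> 'rV[R]_d,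
    [/\ forall a, Gam' a -> Gam (tg a), forall a, Gam a -> tg (sg a) = a,
        forall a, Gam' a -> sg (tg a) = a
      & forall a b, Gam' a -> Gam' b -> tg (a + b) = tg a + tg b].
Proof.
move=> [sgf sgi sgs] sgD.
have ex a : exists b, Gam' a -> Gam b /\ sg b = a.
  have [/sgs [b Gb <-]|nG] := pselect (Gam' a); last by exists 0.
  by exists b.
have {ex}[tg tgP] := choice ex.
have tgf a : Gam' a -> Gam (tg a) by move=> /tgP[].
have sgK a : Gam' a -> sg (tg a) = a by move=> /tgP[].
exists tg; split=> // [a Ga|a b Ga Gb].
  by apply: sgi; rewrite ?inE; [exact/tgf/sgf| |exact/sgK/sgf].
apply: sgi; rewrite ?inE; first exact/tgf/latticeD.
  by apply: latticeD; exact: tgf.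
by rewrite sgD ?sgK//; [exact: latticeD|exact: tgf|exact: tgf].
Qed.

Lemma same_periodic_graph_sym : same_periodic_graph G G' -> same_periodic_graph G' G.
Proof.
move=> [fV [fA [sg [[gV fVK gVK] [gA fAK gAK] fE [sgb sgD] [fVt fAt]]]]].
have [sgf _ _] := sgb.
have [tg [tgf sgK tgK tgD]] := lattice_iso_inverse sgb sgD.
exists gV, gA, tg; split.
- by exists fV.
- by exists fA.
- move=> e; have [sE tE iE] := fE (gA e); rewrite gAK in sE tE iE.
  by rewrite sE tE iE fVK fVK fAK.
- split=> //; split.
  + by move=> a /tgf.
  + by move=> a b; rewrite !inE => Ga Gb /(congr1 sg); rewrite !tgK.
  + by move=> a Ga; exists (sg a); [exact: sgf|exact: sgK].
- split=> x a Ga.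
    by rewrite -{1}(gVK x) -{1}(tgK a)// -fVt ?fVK//; exact: tgf.
  by rewrite -{1}(gAK x) -{1}(tgK a)// -fAt ?fAK//; exact: tgf.
Qed.

(** The equivariant positions that define a form on one graph, carried along
    the isomorphism and corrected by the matrix of the lattice isomorphism,
    define a form on the other one; its support is not larger. *)
Lemma transport_same_flux : same_periodic_graph G G' ->
  forall b', same_flux (fundamental_graph G' B') (coordinate_form B') b' ->
  exists2 b, same_flux (fundamental_graph G B) (coordinate_form B) b &
    (#|supp b| <= #|supp b'|)%N.
Proof.
move=> [fV [fA [sg [fVb [gA fAK gAK] fE [sgb sgD] [fVt fAt]]]]] b'.
move=> /same_flux_coordinateP[p' [p'a b'p']].
have [sgf _ _] := sgb.
have [tg [tgf sgK tgK tgD]] := lattice_iso_inverse sgb sgD.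
have [S tgS] := lattice_additive_matrix B' tgD.
pose M := S *m invmx B.
pose psi (E : fdart G) : fdart G' := \pi_(fdart G') (fA (repr E)).
have psi_pi e : psi (\pi_(fdart G) e) = \pi_(fdart G') (fA e).
  rewrite /psi; have [a Ga ->] := repr_pi_dtr e.
  by rewrite fAt// pi_dtr//; exact: sgf.
have psi_inj : injective psi.
  move=> E F; rewrite -[E]reprK -[F]reprK !psi_pi => /eqmodP/asboolP[a Ga aE].
  have : repr F = dtr (repr E) (tg a).
    by apply: (can_inj fAK); rewrite fAt ?tgK//; exact: tgf.
  by move=> ->; rewrite pi_dtr//; exact: tgf.
exists (fun E => b' (psi E) *m M).
  apply/same_flux_coordinateP; exists (fun v => p' (fV v) *m M); split.
    move=> v a Ga; rewrite fVt// p'a; last exact: sgf.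
    rewrite mulmxDl; congr (_ + _).
    by rewrite /M mulmxA -tgS; [rewrite sgK|exact: sgf].
  move=> e; rewrite psi_pi b'p'; have [-> -> _] := fE e.
  by rewrite mulmxBl.
rewrite -(card_imset _ psi_inj); apply/subset_leq_card/fintype.subsetP.
move=> _ /imsetP[E Eb ->]; move: Eb; rewrite !inE; apply: contra_neq => ->.
by rewrite mul0mx.
Qed.

End Transport.

(** Forms can be transported both ways, so the minima agree. *)
Lemma minimal_card_invariant (R : realType) (d : nat) (Gam Gam' : lattice R d)
    (G : periodic_graph Gam) (G' : periodic_graph Gam')
    (B : lattice_basis Gam) (B' : lattice_basis Gam') m m' :
  same_periodic_graph G G' ->
  minimal_form (same_flux (fundamental_graph G B) (coordinate_form B)) m ->
  minimal_form (same_flux (fundamental_graph G' B') (coordinate_form B')) m' ->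
  #|supp m'| = #|supp m|.
Proof.
move=> iso [mF mmin] [m'F m'min]; apply/eqP; rewrite eqn_leq; apply/andP; split.
  have [b bF bm] := transport_same_flux B' (same_periodic_graph_sym iso) mF.
  exact: leq_trans (m'min _ bF) bm.
have [b bF bm] := transport_same_flux B iso m'F.
exact: leq_trans (mmin _ bF) bm.
Qed.

(** * Square integrable complex functions *)
Section ComplexFacts.
Variable R : realType.
Implicit Types z w : R[i].

Lemma ReD z w : complex.Re (z + w) = complex.Re z + complex.Re w.
Proof. by case: z; case: w. Qed.
Lemma ImD z w : complex.Im (z + w) = complex.Im z + complex.Im w.
Proof. by case: z; case: w. Qed.
Lemma ReM z w :
  complex.Re (z * w) = complex.Re z * complex.Re w - complex.Im z * complex.Im w.
Proof. by case: z; case: w. Qed.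
Lemma ImM z w :
  complex.Im (z * w) = complex.Re z * complex.Im w + complex.Im z * complex.Re w.
Proof. by case: z; case: w. Qed.

Definition sqnorm z : R := complex.Re z ^+ 2 + complex.Im z ^+ 2.

Lemma sqmodE z : sqmod z = (sqnorm z)%:E.
Proof. by case: z => a b; rewrite /sqmod /= sqr_sqrtr ?addr_ge0 ?sqr_ge0. Qed.

Lemma sqnorm_ge0 z : 0 <= sqnorm z.
Proof. by rewrite addr_ge0 ?sqr_ge0. Qed.

Lemma sqmod_ge0 z : (0 <= sqmod z)%E.
Proof. by rewrite sqmodE lee_fin sqnorm_ge0. Qed.

Lemma sqnormM z w : sqnorm (z * w) = sqnorm z * sqnorm w.
Proof. by case: z => a b; case: w => c d; rewrite /sqnorm /=; ring. Qed.

Lemma sqnorm0 : sqnorm 0 = 0.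
Proof. by rewrite /sqnorm /= expr0n addr0. Qed.

Lemma sqnorm_eq0 z : sqnorm z = 0 -> z = 0.
Proof.
case: z => a b /eqP; rewrite paddr_eq0 ?sqr_ge0// !sqrf_eq0 /=.
by move=> /andP[/eqP -> /eqP ->].
Qed.

Lemma sqnormJ z : sqnorm z^* = sqnorm z.
Proof. by case: z => a b; rewrite /sqnorm /= sqrrN. Qed.

Lemma sqnormD_le z w : sqnorm (z + w) <= 2 * sqnorm z + 2 * sqnorm w.
Proof.
case: z => a b; case: w => c d; rewrite /sqnorm /=.
by have := sqr_ge0 (a - c); have := sqr_ge0 (b - d); nra.
Qed.

Lemma sqnormD z w :
  sqnorm (z + w) = sqnorm z + sqnorm w + 2 * complex.Re (z * w^*).
Proof. by case: z => a b; case: w => c d; rewrite /sqnorm /=; ring. Qed.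

Lemma ReM_le z w : `|complex.Re (z * w)| <= sqnorm z + sqnorm w.
Proof.
case: z => a b; case: w => c d; rewrite /sqnorm /= ler_norml.
have := sqr_ge0 (a - c); have := sqr_ge0 (b - d).
have := sqr_ge0 (a + c); have := sqr_ge0 (b + d).
by move=> *; apply/andP; split; nra.
Qed.

Lemma ImM_le z w : `|complex.Im (z * w)| <= sqnorm z + sqnorm w.
Proof.
case: z => a b; case: w => c d; rewrite /sqnorm /= ler_norml.
have := sqr_ge0 (a - d); have := sqr_ge0 (b - c).
have := sqr_ge0 (a + d); have := sqr_ge0 (b + c).
by move=> *; apply/andP; split; nra.
Qed.

Lemma mulcconj z : z * z^* = (sqnorm z)%:C.
Proof.
case: z => a b; rewrite /sqnorm /=; apply/eqP; rewrite eq_complex /=.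
by apply/andP; split; apply/eqP; ring.
Qed.

End ComplexFacts.

Section AlmostEverywhere.
Context d (T : measurableType d) (R : realType) (P : probability T R).
Implicit Types A B C : T -> Prop.

Lemma ae_imp A B : (forall t, A t -> B t) ->
  {ae P, forall t, A t} -> {ae P, forall t, B t}.
Proof. by move=> AB; apply: filterS. Qed.

Lemma ae_imp2 A B C : (forall t, A t -> B t -> C t) ->
  {ae P, forall t, A t} -> {ae P, forall t, B t} -> {ae P, forall t, C t}.
Proof. by move=> ABC; apply: filterS2. Qed.

Lemma ae_all A : (forall t, A t) -> {ae P, forall t, A t}.
Proof. exact: aeW. Qed.

Lemma ae_forall (I : finType) (A : I -> T -> Prop) :
  (forall i, {ae P, forall t, A i t}) -> {ae P, forall t, forall i, A i t}.
Proof. exact: filter_forall. Qed.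

End AlmostEverywhere.

Section L2.
Context d (T : measurableType d) (R : realType) (P : probability T R).
Implicit Types f g h : T -> R[i].

Definition cmeasurable f :=
  measurable_fun setT (fun t => complex.Re (f t)) /\
  measurable_fun setT (fun t => complex.Im (f t)).

Definition cintegrable f :=
  P.-integrable setT (fun t => (complex.Re (f t))%:E) /\
  P.-integrable setT (fun t => (complex.Im (f t))%:E).

Definition cint f : R[i] :=
  (\int[P]_t complex.Re (f t)) +i* (\int[P]_t complex.Im (f t)).

Definition sqint f : \bar R := (\int[P]_t sqmod (f t))%E.

Definition sqintegrable f := cmeasurable f /\ (sqint f < +oo)%E.

Definition ip f g : R[i] := cint (fun t => f t * (g t)^*).

Lemma cmeasurableD f g : cmeasurable f -> cmeasurable g ->
  cmeasurable (fun t => f t + g t).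
Proof.
move=> [f1 f2] [g1 g2]; split.
  by under eq_fun do rewrite ReD; exact: measurable_funD.
by under eq_fun do rewrite ImD; exact: measurable_funD.
Qed.

Lemma cmeasurableM f g : cmeasurable f -> cmeasurable g ->
  cmeasurable (fun t => f t * g t).
Proof.
move=> [f1 f2] [g1 g2]; split.
  by under eq_fun do rewrite ReM; apply: measurable_funB; exact: measurable_funM.
by under eq_fun do rewrite ImM; apply: measurable_funD; exact: measurable_funM.
Qed.

Lemma cmeasurable_cst c : cmeasurable (fun=> c).
Proof. by split; exact: measurable_cst. Qed.

Lemma cmeasurableB f g : cmeasurable f -> cmeasurable g ->
  cmeasurable (fun t => f t - g t).
Proof.
move=> mf mg; under eq_fun do rewrite -mulN1r.
apply: cmeasurableD => //; apply: cmeasurableM => //; exact: cmeasurable_cst.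
Qed.

Lemma cmeasurable_conj f : cmeasurable f -> cmeasurable (fun t => (f t)^*).
Proof.
move=> [f1 f2]; split.
  by rewrite (_ : (fun t => _) = fun t => complex.Re (f t))//; apply/funext => t; case: (f t).
rewrite (_ : (fun t => _) = fun t => - complex.Im (f t)).
  exact: measurableT_comp.
by apply/funext => t; case: (f t).
Qed.

Lemma cmeasurable_sum I (r : seq I) (F : I -> T -> R[i]) :
  (forall i, cmeasurable (F i)) -> cmeasurable (fun t => \sum_(i <- r) F i t).
Proof.
move=> mF; elim: r => [|i r IH].
  by under eq_fun do rewrite big_nil; exact: cmeasurable_cst.
by under eq_fun do rewrite big_cons; exact: cmeasurableD.
Qed.

Lemma measurable_sqnorm f : cmeasurable f -> measurable_fun setT (fun t => sqnorm (f t)).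
Proof.
move=> [f1 f2]; apply: measurable_funD; exact: measurable_funX.
Qed.

Lemma measurable_sqmod f : cmeasurable f -> measurable_fun setT (fun t => sqmod (f t)).
Proof.
move=> mf; under eq_fun do rewrite sqmodE.
by apply/measurable_EFinP; exact: measurable_sqnorm.
Qed.

Lemma sqint_ge0 f : (0 <= sqint f)%E.
Proof. by apply: integral_ge0 => t _; exact: sqmod_ge0. Qed.

Lemma sqintegrableP f : sqintegrable f <->
  cmeasurable f /\ P.-integrable setT (fun t => (sqnorm (f t))%:E).
Proof.
split=> -[mf fi]; split=> //.
  apply/integrableP; split; first exact/measurable_EFinP/measurable_sqnorm.
  apply: le_lt_trans fi; apply: ge0_le_integral => //.
  - apply/measurableT_comp => //; exact/measurable_EFinP/measurable_sqnorm.
  - exact: measurable_sqmod.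
  - by move=> t _; rewrite sqmodE /= ger0_norm// sqnorm_ge0.
rewrite /sqint; under eq_integral do rewrite sqmodE.
exact: integrable_lty.
Qed.

Lemma sqintE f : sqintegrable f -> sqint f = (\int[P]_t sqnorm (f t))%:E.
Proof.
move=> /sqintegrableP[mf fi]; rewrite /sqint /Rintegral fineK.
  by apply: eq_integral => t _; rewrite sqmodE.
exact: integrable_fin_num.
Qed.

Lemma le_sqintegrable f g (C : R) : cmeasurable f -> sqintegrable g ->
  (forall t, sqnorm (f t) <= C * sqnorm (g t)) -> sqintegrable f.
Proof.
move=> mf /sqintegrableP[mg gi] fg; apply/sqintegrableP; split=> //.
apply: le_integrable (integrableZl _ C gi) => //.
  exact/measurable_EFinP/measurable_sqnorm.
move=> t _; rewrite -EFinM !abse_EFin lee_fin ger0_norm ?sqnorm_ge0//.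
by rewrite (le_trans (fg t))// ler_norm.
Qed.

Lemma sqintegrableD f g : sqintegrable f -> sqintegrable g ->
  sqintegrable (fun t => f t + g t).
Proof.
move=> /sqintegrableP[mf fi] /sqintegrableP[mg gi]; apply/sqintegrableP.
split; first exact: cmeasurableD.
apply: le_integrable (integrableD _ (integrableZl _ 2 fi) (integrableZl _ 2 gi)) => //.
  by apply/measurable_EFinP/measurable_sqnorm; exact: cmeasurableD.
move=> t _; rewrite -!EFinM -EFinD !abse_EFin lee_fin ger0_norm ?sqnorm_ge0//.
by rewrite (le_trans (sqnormD_le _ _))// ler_norm.
Qed.

Lemma sqintegrable_mull u f (C : R) : cmeasurable u -> (forall t, sqnorm (u t) <= C) ->
  sqintegrable f -> sqintegrable (fun t => u t * f t).
Proof.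
move=> mu uC fi; apply: (@le_sqintegrable _ f C) => //.
  by apply: cmeasurableM => //; case: fi.
by move=> t; rewrite sqnormM ler_wpM2r// sqnorm_ge0.
Qed.

Lemma sqintegrableZ c f : sqintegrable f -> sqintegrable (fun t => c * f t).
Proof.
by apply: (@sqintegrable_mull _ _ (sqnorm c)) => //; exact: cmeasurable_cst.
Qed.

Lemma sqintegrable_bounded f (C : R) : cmeasurable f -> (forall t, sqnorm (f t) <= C) ->
  sqintegrable f.
Proof.
move=> mf fC; apply: (@le_sqintegrable _ (fun=> 1) C) => //.
  apply/sqintegrableP; split; first exact: cmeasurable_cst.
  by apply: finite_measure_integrable_cst.
by move=> t; rewrite {2}/sqnorm /= expr1n expr0n addr0 mulr1.
Qed.

Lemma sqintegrable_sum I (r : seq I) (F : I -> T -> R[i]) :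
  (forall i, sqintegrable (F i)) -> sqintegrable (fun t => \sum_(i <- r) F i t).
Proof.
move=> mF; elim: r => [|i r IH].
  under eq_fun do rewrite big_nil.
  apply: (@sqintegrable_bounded _ 0); first exact: cmeasurable_cst.
  by move=> t; rewrite sqnorm0.
by under eq_fun do rewrite big_cons; exact: sqintegrableD.
Qed.

Lemma sqintegrable_conj f : sqintegrable f -> sqintegrable (fun t => (f t)^*).
Proof.
move=> fi; apply: (@le_sqintegrable _ f 1) => //.
  by apply: cmeasurable_conj; case: fi.
by move=> t; rewrite sqnormJ mul1r.
Qed.

Lemma sqintegrableB f g : sqintegrable f -> sqintegrable g ->
  sqintegrable (fun t => f t - g t).
Proof.
move=> fi gi; under eq_fun do rewrite -mulN1r.
by apply: sqintegrableD => //; exact: sqintegrableZ.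
Qed.

Lemma cintegrableM f g : sqintegrable f -> sqintegrable g ->
  cintegrable (fun t => f t * g t).
Proof.
move=> /sqintegrableP[mf fi] /sqintegrableP[mg gi].
have [mr mi] := cmeasurableM mf mg.
split; apply: le_integrable (integrableD _ fi gi) => //; try exact/measurable_EFinP.
  move=> t _; rewrite -EFinD !abse_EFin lee_fin.
  by rewrite (le_trans (ReM_le _ _))// ler_norm.
move=> t _; rewrite -EFinD !abse_EFin lee_fin.
by rewrite (le_trans (ImM_le _ _))// ler_norm.
Qed.

Lemma sqintegrable_cintegrable f : sqintegrable f -> cintegrable f.
Proof.
move=> fi; under [f]eq_fun do rewrite -[f _]mulr1.
apply: cintegrableM => //; apply: (@sqintegrable_bounded _ 1).
  exact: cmeasurable_cst.
by move=> t; rewrite /sqnorm /= expr1n expr0n addr0.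
Qed.

Lemma cintD f g : cintegrable f -> cintegrable g ->
  cint (fun t => f t + g t) = cint f + cint g.
Proof.
move=> [f1 f2] [g1 g2]; rewrite /cint.
under [X in X +i* _]eq_Rintegral do rewrite ReD.
under [X in _ +i* X]eq_Rintegral do rewrite ImD.
by rewrite !RintegralD.
Qed.

Lemma cintegrableD f g : cintegrable f -> cintegrable g ->
  cintegrable (fun t => f t + g t).
Proof.
move=> [f1 f2] [g1 g2]; split.
  by under eq_fun do rewrite ReD EFinD; exact: integrableD.
by under eq_fun do rewrite ImD EFinD; exact: integrableD.
Qed.

Lemma cintZ c f : cintegrable f -> cint (fun t => c * f t) = c * cint f.
Proof.
move=> [f1 f2]; case: c => a b; rewrite /cint.
under [X in X +i* _]eq_Rintegral do rewrite ReM.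
under [X in _ +i* X]eq_Rintegral do rewrite ImM.
have iZ (r : R) (F : T -> R) : P.-integrable setT (EFin \o F) ->
    P.-integrable setT (EFin \o (fun t => r * F t)).
  by move=> Fi; rewrite [X in integrable _ _ X](_ : _ = (fun t => r%:E * (F t)%:E)%E)//; exact: integrableZl.
rewrite RintegralB//; try exact: iZ.
rewrite RintegralD//; try exact: iZ.
by rewrite !RintegralZl.
Qed.

Lemma cint0 : cint (fun=> 0) = 0.
Proof. by rewrite /cint /= !Rintegral_cst// mul0r. Qed.

Lemma cintegrable0 : cintegrable (fun=> 0).
Proof. by split; exact: integrable0. Qed.

Lemma cint_sum I (r : seq I) (F : I -> T -> R[i]) :
  (forall i, cintegrable (F i)) ->
  cintegrable (fun t => \sum_(i <- r) F i t) /\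
  cint (fun t => \sum_(i <- r) F i t) = \sum_(i <- r) cint (F i).
Proof.
move=> mF; elim: r => [|i r [IH1 IH2]].
  under eq_fun do rewrite big_nil; rewrite big_nil cint0.
  by split=> //; exact: cintegrable0.
under eq_fun do rewrite big_cons; rewrite big_cons cintD// IH2; split=> //.
exact: cintegrableD.
Qed.

Lemma eq_cint f g : f =1 g -> cint f = cint g.
Proof. by move=> /funext ->. Qed.

End L2.

Section InnerProduct.
Context d (T : measurableType d) (R : realType) (P : probability T R).
Implicit Types f g h : T -> R[i].
Local Notation L2 := (sqintegrable P).
Local Notation ip := (ip P).
Local Notation sqint := (sqint P).

Lemma cintegrable_ip f g : L2 f -> L2 g -> cintegrable P (fun t => f t * (g t)^*).
Proof. by move=> fi gi; apply: cintegrableM => //; exact: sqintegrable_conj. Qed.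

Lemma ipDl f g h : L2 f -> L2 g -> L2 h -> ip (fun t => f t + g t) h = ip f h + ip g h.
Proof.
move=> fi gi hi; rewrite /ip -cintD; try exact: cintegrable_ip.
by apply: eq_cint => t; rewrite mulrDl.
Qed.

Lemma ipZl c f h : L2 f -> L2 h -> ip (fun t => c * f t) h = c * ip f h.
Proof.
move=> fi hi; rewrite /ip -cintZ; last exact: cintegrable_ip.
by apply: eq_cint => t; rewrite mulrA.
Qed.

Lemma ipBl f g h : L2 f -> L2 g -> L2 h -> ip (fun t => f t - g t) h = ip f h - ip g h.
Proof.
move=> fi gi hi; rewrite -mulN1r -ipZl// -ipDl//; last exact: sqintegrableZ.
by congr ip; apply/funext => t; rewrite mulN1r.
Qed.

Lemma ip_suml I (r : seq I) (F : I -> T -> R[i]) h : (forall i, L2 (F i)) -> L2 h ->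
  ip (fun t => \sum_(i <- r) F i t) h = \sum_(i <- r) ip (F i) h.
Proof.
move=> Fi hi; rewrite /ip -(cint_sum r (fun i => cintegrable_ip (Fi i) hi)).2.
by apply: eq_cint => t; rewrite mulr_suml.
Qed.

Lemma cint_conj f : cintegrable P f -> cint P (fun t => (f t)^*) = (cint P f)^*.
Proof.
move=> [f1 f2]; rewrite /cint /= -[X in _ -i* X]mul1r -mulNr -RintegralZl//.
by congr (_ +i* _); apply: eq_Rintegral => t _; case: (f t) => //= a b; rewrite mulN1r.
Qed.

Lemma ipC f g : L2 f -> L2 g -> ip g f = (ip f g)^*.
Proof.
move=> fi gi; rewrite -cint_conj; last exact: cintegrable_ip.
by apply: eq_cint => t; rewrite rmorphM /= conjcK mulrC.
Qed.

Lemma pythagoras f g : L2 f -> L2 g -> ip f g = 0 ->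
  sqint (fun t => f t + g t) = (sqint f + sqint g)%E.
Proof.
move=> fi gi /(congr1 (@complex.Re _)) /= fg0.
rewrite !sqintE//; last exact: sqintegrableD.
rewrite -EFinD; congr EFin.
under eq_Rintegral do rewrite sqnormD.
have [fgi _] := cintegrable_ip fi gi.
move: fi gi => /sqintegrableP[_ fi] /sqintegrableP[_ gi].
rewrite RintegralD//; [|exact: (integrableD _ fi gi)|]; last first.
  exact: (integrableZl _ 2 fgi).
by rewrite RintegralD// RintegralZl// fg0 mulr0 addr0.
Qed.

Lemma sqintZ c f : L2 f -> sqint (fun t => c * f t) = ((sqnorm c)%:E * sqint f)%E.
Proof.
move=> fi; rewrite !sqintE//; last exact: sqintegrableZ.
rewrite -EFinM; congr EFin; under eq_Rintegral do rewrite sqnormM.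
by rewrite RintegralZl//; case/sqintegrableP: fi.
Qed.

End InnerProduct.

Lemma summable_increments_cvg (R : realType) (u v : nat -> R) :
  (forall n, 0 <= v n) -> (\sum_(0 <= n <oo) (v n)%:E < +oo)%E ->
  (forall n, `|u n.+1 - u n| <= v n) -> cvgn u.
Proof.
move=> v0 voo uv.
suff : cvgn (series (telescope u)).
  move=> cu; rewrite (_ : u = fun n => u 0%N + series (telescope u) n).
    by apply: is_cvgD => //; exact: is_cvg_cst.
  by apply/funext => n; exact: eq_sum_telescope.
apply: normed_cvg; apply: nondecreasing_is_cvgn.
  by apply/nondecreasing_seqP => n; rewrite /= seriesSr lerDl.
exists (fine (\sum_(0 <= n <oo) (v n)%:E)%E) => _ [n _ <-].
rewrite -lee_fin fineK; last first.
  by rewrite ge0_fin_numE//; apply: nneseries_ge0 => k _ _; rewrite lee_fin.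
apply: le_trans (nneseries_lim_ge n _); last by move=> k _ _; rewrite lee_fin.
rewrite sumEFin lee_fin.
suff : \sum_(0 <= i < n) `|u i.+1 - u i| <= \sum_(0 <= i < n) v i by [].
by apply: ler_sum => i _; exact: uv.
Qed.

Section Completeness.
Context d (T : measurableType d) (R : realType) (P : probability T R).
Local Notation L2 := (sqintegrable P).

(** This dominates the increments of the real and imaginary parts, by the
    inequality of arithmetic and geometric means, while its integral is
    summable when the squares of the increments have integral at most
    [(4 ^+ n)^-1]. *)
Let w (g : nat -> T -> R[i]) n t : R := 2 ^+ n * sqnorm (g n.+1 t - g n t) + (2 ^+ n)^-1.

Let w_ge0 g n t : 0 <= w g n t.
Proof. by rewrite addr_ge0 ?mulr_ge0 ?sqnorm_ge0 ?invr_ge0 ?exprn_ge0. Qed.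

(** Completeness of L2 for rapidly Cauchy sequences.  The sum of the [w g n] is
    integrable, hence finite almost everywhere, and the sequence converges
    pointwise where it is; Fatou's lemma bounds the distance to the limit. *)
Lemma sqint_complete (g : nat -> T -> R[i]) : (forall n, L2 (g n)) ->
  (forall m n, (n <= m)%N -> sqint P (fun t => (g m t - g n t)%R) <= ((4 ^+ n)^-1)%:E)%E ->
  exists2 h, L2 h & forall n, (sqint P (fun t => (h t - g n t)%R) <= ((4 ^+ n)^-1)%:E)%E.
Proof.
move=> gi gC.
have mg n : cmeasurable (g n) by case: (gi n).
have mgB m n : cmeasurable (fun t => g m t - g n t) by case: (sqintegrableB (gi m) (gi n)).
have mw n : measurable_fun setT (w g n).
  by apply: measurable_funD => //; apply: measurable_funM => //; exact: measurable_sqnorm.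
pose H t := (\sum_(0 <= n <oo) (w g n t)%:E)%E.
have H0 t : (0 <= H t)%E by apply: nneseries_ge0 => n _ _; rewrite lee_fin w_ge0.
have mH : measurable_fun setT H.
  by apply: ge0_emeasurable_sum => //= n *; [rewrite lee_fin w_ge0|exact/measurable_EFinP].
have iw n : (\int[P]_t (w g n t)%:E <= (2 / 2 ^+ n)%:E)%E.
  under eq_integral do rewrite /w EFinD EFinM.
  rewrite ge0_integralD//; last first.
  - by apply: emeasurable_funM => //; exact/measurable_EFinP/measurable_sqnorm.
  - by move=> t _; rewrite -EFinM lee_fin mulr_ge0 ?sqnorm_ge0.
  rewrite ge0_integralZl_EFin//; last 2 first.
  - by move=> t _; rewrite lee_fin sqnorm_ge0.
  - exact/measurable_EFinP/measurable_sqnorm.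
  rewrite integral_cst//= probability_setT mule1.
  have := gC n.+1 n (leqnSn n); rewrite /sqint.
  under eq_integral do rewrite sqmodE.
  move=> /(lee_wpmul2l _) => /(_ (2 ^+ n)%:E).
  rewrite lee_fin exprn_ge0// => /(_ isT) /(leeD2r ((2 ^+ n)^-1)%:E) /le_trans; apply.
  rewrite -EFinM -EFinD lee_fin (_ : 4 = 2 * 2) ?exprMn ?invfM; last by rewrite -natrM.
  by rewrite mulrA mulfV ?expf_neq0// mul1r mulr_natl mulr2n.
have HP : {ae P, forall t, (H t < +oo)%E}.
  have : P.-integrable setT H.
    apply/integrableP; split=> //; under eq_integral do rewrite gee0_abs//.
    rewrite integral_nneseries//; last 2 first.
    - by move=> n; exact/measurable_EFinP.
    - by move=> n t _; rewrite lee_fin w_ge0.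
    apply: (@le_lt_trans _ _ (\sum_(0 <= n <oo) (4 / (2 ^ n.+1)%:R)%:E)%E).
      apply: lee_nneseries => n *.
        by apply: integral_ge0 => t _; rewrite lee_fin w_ge0.
      rewrite (le_trans (iw n))// lee_fin natrX exprS invfM mulrA.
      by rewrite (_ : 4 = 2 * 2) ?mulfK// -natrM.
    by apply: le_lt_trans (@epsilon_trick0 R 4 xpredT _) _ => //; exact: ltry.
  move=> /(integrable_ae measurableT); apply: filterS => t /(_ Logic.I).
  by rewrite ge0_fin_numE.
have gcvg t : (H t < +oo)%E ->
    cvgn (fun n => complex.Re (g n t)) /\ cvgn (fun n => complex.Im (g n t)).
  (* With a = 2 ^ n |x|, this is a <= a ^ 2 + 1 divided by 2 ^ n. *)
  move=> Ht; have le2 (n : nat) (x y z : R) : `|z| <= `|x| -> x ^+ 2 <= y ->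
      `|z| <= 2 ^+ n * y + (2 ^+ n)^-1.
    move=> zx xy; apply: le_trans zx _.
    have p0 : (0 : R) < 2 ^+ n by rewrite exprn_gt0.
    apply: (@le_trans _ _ (2 ^+ n * x ^+ 2 + (2 ^+ n)^-1)); last first.
      by rewrite lerD2r ler_pM2l.
    rewrite -(@ler_pM2l _ (2 ^+ n))// mulrDr mulfV ?gt_eqF// mulrA -expr2.
    rewrite -[x ^+ 2]real_normK ?num_real// -exprMn -[_ * `|x|]/(2 ^+ n * `|x|).
    by move: (2 ^+ n * `|x|) => y'; have := sqr_ge0 (y' - 1); nra.
  have ReB z z' : complex.Re z - complex.Re z' = complex.Re (z - z').
    by case: z => ? ?; case: z'.
  have ImB z z' : complex.Im z - complex.Im z' = complex.Im (z - z').
    by case: z => ? ?; case: z'.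
  split; apply: (@summable_increments_cvg R _ (w g ^~ t)) => //.
  - move=> n; rewrite ReB; apply: (le2 n (complex.Re (g n.+1 t - g n t))) => //.
    by rewrite /sqnorm lerDl sqr_ge0.
  - move=> n; rewrite ImB; apply: (le2 n (complex.Im (g n.+1 t - g n t))) => //.
    by rewrite /sqnorm lerDr sqr_ge0.
(* Upper limits are measurable everywhere and agree with the limits where
   those exist. *)
pose hr t : R := fine (limn_esup (fun n => (complex.Re (g n t))%:E)).
pose hi t : R := fine (limn_esup (fun n => (complex.Im (g n t))%:E)).
pose h t := hr t +i* hi t.
have mh : cmeasurable h.
  split; apply: (measurableT_comp (fine_measurable measurableT));
    apply: measurable_fun_limn_esup => n; apply/measurable_EFinP; by case: (mg n).
have hcvg t : (H t < +oo)%E ->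
    (fun n => complex.Re (g n t)) @ \oo --> complex.Re (h t) /\
    (fun n => complex.Im (g n t)) @ \oo --> complex.Im (h t).
  have limE (u : nat -> R) : cvgn u ->
      u @ \oo --> fine (limn_esup (fun n => (u n)%:E)).
    move=> cu; have uE : (fun n => (u n)%:E) @ \oo --> (limn u)%:E.
      by apply: cvg_EFin => //; exact: nearW.
    by have [_ ->] := cvg_limn_einf_sup uE.
  by move=> /gcvg[/limE ? /limE ?].
have hC n : (sqint P (fun t => (h t - g n t)%R) <= ((4 ^+ n)^-1)%:E)%E.
  pose F m t := sqmod (g (m + n)%N t - g n t).
  have mF m : measurable_fun setT (F m) by exact/measurable_sqmod.
  apply: (@le_trans _ _ (\int[P]_t limn_einf (F^~ t))%E).
    rewrite le_eqVlt; apply/orP; left; apply/eqP; apply: ge0_ae_eq_integral => //.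
    - by apply: measurable_sqmod; exact: cmeasurableB.
    - rewrite /limn_einf; apply: measurableT_comp => //.
      by apply: measurable_fun_limn_esup => m; exact: measurableT_comp.
    - by move=> t _; exact: sqmod_ge0.
    - move=> t _; rewrite limn_einf_lim; apply: lime_ge; first exact: is_cvg_einfs.
      by apply: nearW => m; apply: le_ereal_inf_tmp => _ [k _ <-]; exact: sqmod_ge0.
    apply: filterS HP => t /hcvg[cr ci] _.
    apply/esym; apply: (cvg_limn_einf_sup _).1.
    rewrite /F; under eq_fun do rewrite sqmodE; rewrite sqmodE.
    apply: cvg_EFin; first exact: nearW.
    have {}cr : complex.Re (g (m + n)%N t) @[m --> \oo] --> complex.Re (h t).
      by rewrite (cvg_shiftn n (fun m => complex.Re (g m t))).
    have {}ci : complex.Im (g (m + n)%N t) @[m --> \oo] --> complex.Im (h t).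
      by rewrite (cvg_shiftn n (fun m => complex.Im (g m t))).
    have sqB z z' : sqnorm (z - z') =
        (complex.Re z - complex.Re z') ^+ 2 + (complex.Im z - complex.Im z') ^+ 2.
      by case: z => ? ?; case: z' => ? ?.
    rewrite /comp /=; under eq_fun do rewrite sqB; rewrite sqB.
    by rewrite !expr2; under eq_fun do rewrite !expr2; apply: cvgD; apply: cvgM;
      (apply: cvgB => //; exact: cvg_cst).
  apply: (le_trans (fatou P measurableT mF (fun m t _ => sqmod_ge0 _))).
  rewrite limn_einf_lim; apply: lime_le; first exact: is_cvg_einfs.
  apply: nearW => m; apply: (@le_trans _ _ (\int[P]_t F m t)%E).
    by apply: ereal_inf_lbound; exists m => //=.
  by apply: gC; exact: leq_addl.
exists h => //.
have hg0 : L2 (fun t => h t - g 0%N t).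
  split; last by apply: le_lt_trans (hC 0%N) _; rewrite ltry.
  exact: cmeasurableB.
rewrite (_ : h = fun t => (h t - g 0%N t) + g 0%N t); first exact: sqintegrableD.
by apply/funext => t; rewrite subrK.
Qed.

End Completeness.

(** * Orthonormal systems and the Riesz-Fischer theorem *)
Section SquareSummable.
Variables (R : realType) (K : choiceType) (c : K -> R[i]).
Implicit Types S : {fset K}.

Lemma fset_sum_subset (V : nmodType) (F : K -> V) S0 S : (S0 `<=` S)%fset ->
  \sum_(k <- S) F k = \sum_(k <- S0) F k + \sum_(k <- (S `\` S0)%fset) F k.
Proof.
move=> sub; rewrite -big_cat; apply: perm_big; apply: uniq_perm.
- exact: fset_uniq.
- rewrite cat_uniq !fset_uniq andbT /=; apply/hasPn => k /=.
  by rewrite in_fsetD => /andP[].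
- move=> k; rewrite mem_cat in_fsetD; case: (boolP (k \in S0)) => //= kS0.
  by rewrite (fsubsetP sub).
Qed.

Lemma fset_sum_le_l2norm2 S : (\sum_(k <- S) sqmod (c k) <= l2norm2 c)%E.
Proof.
apply: esum_ge; exists [set` S]; first by split => //; exact: finite_fset.
by rewrite -fsbig_seq// fset_uniq.
Qed.

Lemma l2norm2_le (C : \bar R) :
  (forall S, (\sum_(k <- S) sqmod (c k) <= C)%E) -> (l2norm2 c <= C)%E.
Proof.
move=> SC; apply: ge_ereal_sup => _ [A [Afin _] <-].
by rewrite fsbig_finite.
Qed.

Lemma l2norm2_ge0 : (0 <= l2norm2 c)%E.
Proof. by apply: esum_ge0 => k _; exact: sqmod_ge0. Qed.

(** A finite set nearly attains the supremum that defines [l2norm2 c], which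
    leaves little outside of it. *)
Lemma l2_tail : l2 c -> forall eps : R, 0 < eps ->
  exists S0, forall S, (S0 `<=` S)%fset -> (\sum_(k <- (S `\` S0)%fset) sqmod (c k) <= eps%:E)%E.
Proof.
move=> cl2 eps eps0.
have fin : l2norm2 c \is a fin_num by rewrite ge0_fin_numE// l2norm2_ge0.
have [_ [A [Afin _] <-]] := ub_ereal_sup_adherent eps0 fin.
rewrite -/(l2norm2 c) fsbig_finite// => Ac.
exists (fset_set A) => S sub.
have Sfin (S' : {fset K}) : (\sum_(k <- S') sqmod (c k))%E \is a fin_num.
  rewrite ge0_fin_numE; last by apply: sume_ge0 => k _; exact: sqmod_ge0.
  exact: le_lt_trans (fset_sum_le_l2norm2 _) cl2.
have := fset_sum_le_l2norm2 S; rewrite (fset_sum_subset _ sub).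
move: Ac; rewrite lteBlDr// => Ac /le_lt_trans/(_ Ac).
by rewrite lteD2lE// => /ltW.
Qed.

End SquareSummable.

Section Orthonormal.
Context d (T : measurableType d) (R : realType) (P : probability T R).
Variables (K : choiceType) (e : K -> T -> R[i]).
Local Notation L2 := (sqintegrable P).
Local Notation ip := (ip P).
Local Notation sqint := (sqint P).
Implicit Types (S : {fset K}) (c : K -> R[i]).

Definition orthonormal_system :=
  (forall k, L2 (e k)) /\ forall k l, ip (e k) (e l) = (k == l)%:R.

Definition partial_sum (s : seq K) c t := \sum_(k <- s) c k * e k t.

(** Unconditional convergence in mean square, along the directed set of finite
    sets of indices, as the Gelfand series is summed. *)
Definition is_fourier_sum c h := L2 h /\ forall eps : R, 0 < eps ->
  exists S0, forall S, (S0 `<=` S)%fset ->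
    (sqint (fun t => (h t - partial_sum S c t)%R) <= eps%:E)%E.

Hypothesis eON : orthonormal_system.

Lemma sqintegrable_partial_sum s c : L2 (partial_sum s c).
Proof. by apply: sqintegrable_sum => k; apply: sqintegrableZ; case: eON. Qed.

Lemma ip_partial_sum s c l : uniq s ->
  ip (partial_sum s c) (e l) = if l \in s then c l else 0.
Proof.
have [eL2 eE] := eON => us.
rewrite ip_suml//; last by move=> k; exact: sqintegrableZ.
have eq1 k : k \in s -> ip (fun t => c k * e k t) (e l) = if k == l then c k else 0.
  by move=> _; rewrite ipZl// eE; case: eqP; rewrite (mulr1, mulr0).
rewrite big_seq (eq_bigr _ eq1) -big_seq.
case: ifPn => ls.
  by rewrite (bigD1_seq l ls us) /= eqxx big1 ?addr0// => k /negbTE ->.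
rewrite big_seq big1// => k ks; case: eqP => // kl.
by move: ls; rewrite -kl ks.
Qed.

Lemma sqint_partial_sum s c : uniq s ->
  sqint (partial_sum s c) = (\sum_(k <- s) sqmod (c k))%E.
Proof.
have [eL2 eE] := eON; elim: s => [_|k s IH /= /andP[ks us]].
  rewrite big_nil /sqint (eq_integral (cst 0%E)) ?integral0// => t _.
  by rewrite /partial_sum big_nil sqmodE sqnorm0.
rewrite big_cons -IH// -[LHS]/(sqint _).
rewrite (_ : partial_sum _ _ = fun t => c k * e k t + partial_sum s c t); last first.
  by apply/funext => t; rewrite /partial_sum big_cons.
rewrite pythagoras//; [|exact: sqintegrableZ|exact: sqintegrable_partial_sum|]; last first.
  rewrite ipZl//; last exact: sqintegrable_partial_sum.
  rewrite (ipC (sqintegrable_partial_sum s c) (eL2 k)) ip_partial_sum// (negbTE ks).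
  by rewrite conjc0 mulr0.
congr (_ + _)%E; rewrite sqintZ// sqmodE.
suff -> : sqint (e k) = 1%E by rewrite mule1.
rewrite sqintE//; congr EFin.
have /(congr1 (@complex.Re _)) := eE k k; rewrite eqxx /= => <-.
by apply: eq_Rintegral => t _; rewrite mulcconj.
Qed.

Lemma partial_sumB c S0 S : (S0 `<=` S)%fset ->
  (fun t => partial_sum S c t - partial_sum S0 c t) = partial_sum (S `\` S0)%fset c.
Proof.
move=> sub; apply/funext => t; rewrite /partial_sum (fset_sum_subset _ sub).
by rewrite addrC addKr.
Qed.

(** The residual is orthogonal to the partial sum, so Pythagoras applies. *)
Lemma sqint_residual c h S : L2 h -> (forall k, k \in S -> ip h (e k) = c k) ->
  sqint h = (sqint (fun t => (h t - partial_sum S c t)%R) + \sum_(k <- S) sqmod (c k))%E.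
Proof.
have [eL2 eE] := eON => hi hc.
have pi := sqintegrable_partial_sum S c.
have ri := sqintegrableB hi pi.
rewrite -sqint_partial_sum ?fset_uniq// -pythagoras//.
  by congr sqint; apply/funext => t; rewrite subrK.
rewrite (ipC pi ri) ip_suml//; last by move=> k; exact: sqintegrableZ.
rewrite big_seq big1 ?conjc0// => k kS.
rewrite ipZl// (ipC ri (eL2 k)) ipBl// ip_partial_sum ?fset_uniq// kS hc//.
by rewrite subrr conjc0 mulr0.
Qed.

Lemma bessel h : L2 h -> (l2norm2 (fun k => ip h (e k)) <= sqint h)%E.
Proof.
move=> hi; apply: l2norm2_le => S.
rewrite (@sqint_residual (fun k => ip h (e k)) h S)//.
by rewrite leeDr// sqint_ge0.
Qed.

(** The coefficients of [h] and of a partial sum containing [k] differ by a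
    coefficient of the residual, which Bessel's inequality makes small. *)
Lemma fourier_sum_coef c h k : is_fourier_sum c h -> ip h (e k) = c k.
Proof.
move=> [hi hc]; apply/eqP; rewrite -subr_eq0; apply/eqP/sqnorm_eq0.
apply/eqP; rewrite eq_le sqnorm_ge0 andbT; apply/ler_addgt0Pl => eps eps0.
rewrite addr0 -lee_fin -sqmodE.
have [S0 hS0] := hc _ eps0; have {hS0} := hS0 (k |` S0)%fset (fsubsetUr _ _).
set S := (k |` S0)%fset => /(le_trans _); apply.
have pi := sqintegrable_partial_sum S c.
have ri := sqintegrableB hi pi.
apply: le_trans (bessel ri); apply: le_trans (fset_sum_le_l2norm2 _ [fset k]%fset).
rewrite big_seq_fset1 ipBl//; last by case: eON.
by rewrite ip_partial_sum ?fset_uniq// fset1U1.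
Qed.

(** Bessel's inequality in one direction; in the other, the residual in
    Pythagoras' theorem tends to zero. *)
Lemma parseval c h : is_fourier_sum c h -> sqint h = l2norm2 c.
Proof.
move=> hc; apply/eqP; rewrite eq_le; apply/andP; split; last first.
  apply: le_trans (bessel hc.1); rewrite le_eqVlt; apply/orP; left.
  by apply/eqP; congr l2norm2; apply/funext => k; rewrite (fourier_sum_coef _ hc).
apply/lee_addgt0Pr => eps eps0; have [S0 /(_ S0 (fsubset_refl _)) hS0] := hc.2 _ eps0.
rewrite (@sqint_residual c h S0)//; [|exact: hc.1|by move=> k _; exact: fourier_sum_coef].
by rewrite addeC leeD// fset_sum_le_l2norm2.
Qed.

Lemma sqint_sum_le f g : L2 f -> L2 g ->
  (sqint (fun t => (f t + g t)%R) <= 2%:E * sqint f + 2%:E * sqint g)%E.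
Proof.
move=> fi gi; rewrite !sqintE//; last exact: sqintegrableD.
have /sqintegrableP[_ fgi] := sqintegrableD fi gi.
move: fi gi => /sqintegrableP[mf fi] /sqintegrableP[mg gi].
rewrite -!EFinM -EFinD lee_fin -!RintegralZl// -RintegralD//;
  [|exact: (integrableZl _ 2 fi)|exact: (integrableZl _ 2 gi)].
apply: le_Rintegral => //; last by move=> t _; exact: sqnormD_le.
exact: (integrableD _ (integrableZl _ 2 fi) (integrableZl _ 2 gi)).
Qed.

(** Along increasing finite sets [B n] whose tails have size at most
    [(4 ^+ n)^-1], the partial sums form a rapidly Cauchy sequence.  Its limit
    is the sum along all finite sets, since larger sets stay close to [B n]. *)
Lemma riesz_fischer c : l2 c -> exists h, is_fourier_sum c h.
Proof.
move=> cl2.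
have pos4 n : (0 : R) < (4 ^+ n)^-1 by rewrite invr_gt0 exprn_gt0.
have [A hA] := choice (fun n => l2_tail cl2 (pos4 n)).
pose B := fix B n := if n is n'.+1 then (B n' `|` A n)%fset else A 0%N.
have AB n : (A n `<=` B n)%fset by case: n => [|n] /=; [exact: fsubset_refl|exact: fsubsetUr].
have Bmono n m : (n <= m)%N -> (B n `<=` B m)%fset.
  elim: m => [|m IH]; first by rewrite leqn0 => /eqP ->; exact: fsubset_refl.
  rewrite leq_eqVlt => /predU1P[->|/IH nm]; first exact: fsubset_refl.
  exact: fsubset_trans nm (fsubsetUl _ _).
have BC n S : (B n `<=` S)%fset ->
    (sqint (fun t => (partial_sum S c t - partial_sum (B n) c t)%R) <= ((4 ^+ n)^-1)%:E)%E.
  move=> BS; rewrite partial_sumB// sqint_partial_sum ?fset_uniq//.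
  apply: le_trans (hA n S (fsubset_trans (AB n) BS)).
  have sub : (S `\` B n `<=` S `\` A n)%fset by apply: fsetDS.
  rewrite (fset_sum_subset _ sub) leeDl//.
  by apply: sume_ge0 => k _; exact: sqmod_ge0.
have [h hi hC] := sqint_complete (fun n => sqintegrable_partial_sum (B n) c)
  (fun m n nm => BC n (B m) (Bmono n m nm)).
exists h; split=> // eps eps0.
have [n nE] : exists n, 4 * (4 ^+ n)^-1 <= eps :> R.
  have eps4 : 0 < eps / 4 by rewrite divr_gt0.
  have [n _ /(_ n (leqnn n)) /=] := near_infty_natSinv_expn_lt (PosNum eps4).
  rewrite div1r ltr_pdivlMr// mulrC => /ltW /(le_trans _) H; exists n; apply: H.
  by rewrite ler_pM2l// lef_pV2 ?posrE ?exprn_gt0// lerXn2r ?nnegrE// ler_nat.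
exists (B n) => S BS.
have pS := sqintegrable_partial_sum S c; have pB := sqintegrable_partial_sum (B n) c.
have -> : (fun t => h t - partial_sum S c t) =
    fun t => (h t - partial_sum (B n) c t) + -1 * (partial_sum S c t - partial_sum (B n) c t).
  by apply/funext => t; rewrite mulN1r opprB addrA subrK.
apply: (le_trans (sqint_sum_le _ _)); [exact: sqintegrableB|exact/sqintegrableZ/sqintegrableB|].
rewrite sqintZ; last exact: sqintegrableB.
rewrite {1}/sqnorm /= sqrrN expr1n oppr0 expr0n addr0 mul1e.
apply: (@le_trans _ _ (4 * (4 ^+ n)^-1)%:E); last by rewrite lee_fin.
rewrite (_ : 4 * (4 ^+ n)^-1 = 2 * (4 ^+ n)^-1 + 2 * (4 ^+ n)^-1); last by rewrite -mulrDl -natrD.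
rewrite [X in (_ <= X)%E]EFinD !EFinM; apply: leeD; apply: lee_wpmul2l => //.
exact: BC.
Qed.

End Orthonormal.

(** * Exponentials on the torus *)
Section Expi.
Variable R : realType.
Implicit Types x y : R.

Lemma expiD x y : expi (x + y) = expi x * expi y.
Proof. by rewrite /expi cosD sinD; congr (_ +i* _); rewrite addrC. Qed.

Lemma expi0 : expi (0 : R) = 1.
Proof. by rewrite /expi cos0 sin0. Qed.

Lemma expiN x : expi (- x) = (expi x)^*.
Proof. by rewrite /expi cosN sinN. Qed.

Lemma sqnorm_expi x : sqnorm (expi x) = 1.
Proof. exact: cos2Dsin2. Qed.

Lemma expi_period x (k : int) : expi (x + (2 * pi) *~ k) = expi x.
Proof.
have expi2pi : expi (2 * pi : R) = 1.
  by rewrite /expi mulr_natl cos2pi sin2pi.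
have nat2pi n : expi ((2 * pi : R) *+ n) = 1.
  by elim: n => [|n IH]; rewrite ?expi0// mulrS expiD IH mulr1.
rewrite expiD; case: k => n.
  by rewrite -pmulrn nat2pi mulr1.
by rewrite NegzE mulrNz -pmulrn expiN nat2pi conjc1 mulr1.
Qed.

(** Reduce to an angle [y] of the fundamental interval; there, the cosine
    equals 1 only where the sine of [y / 2] vanishes, that is, at 0. *)
Lemma expi_eq1 x : expi x = 1 -> exists k : int, x = (2 * pi) *~ k.
Proof.
move=> [cx sx].
have p0 : (0 : R) < 2 * pi by exact: twopi_gt0.
pose k := Num.floor (x / (2 * pi)); exists k.
have /andP[] := floor_itv (x / (2 * pi)); rewrite -/k => k1 k2.
pose y := x - (2 * pi) *~ k.
have y0 : 0 <= y by rewrite subr_ge0 -mulrzr mulrC -ler_pdivlMr.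
have y2 : y < 2 * pi.
  rewrite ltrBlDr -mulrzr -{1}(mulr1 (2 * pi)) -mulrDr mulrC -ltr_pdivrMr//.
  by rewrite addrC; move: k2; rewrite intrD.
have cy : cos y = 1.
  by have := expi_period y k; rewrite subrK => -[<- _]; exact: cx.
apply/eqP; rewrite -subr_eq0 -/y eq_le y0 andbT leNgt; apply/negP => y_gt0.
have sy : 0 < sin (y / 2).
  by apply: sin_gt0_pi; rewrite divr_gt0//= ltr_pdivrMr// mulrC.
have : cos ((y / 2) *+ 2) = 1 by rewrite -mulr_natr divfK// pnatr_eq0.
rewrite cos_mulr2n cos2sin2 => c2; have := exprn_gt0 2 sy; lra.
Qed.

End Expi.

Section TorusMeasurable.
Variables (R : realType) (n : nat).
Implicit Types (k : 'rV[R]_n) (t : torus R n).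

Lemma dotDl k k' t : dot (k + k') t = dot k t + dot k' t.
Proof. by rewrite /dot -big_split; apply: eq_bigr => i _; rewrite mxE mulrDl. Qed.

Lemma dotNl k t : dot (- k) t = - dot k t.
Proof. by rewrite /dot -sumrN; apply: eq_bigr => i _; rewrite mxE mulNr. Qed.

Lemma dot0l t : dot 0 t = 0.
Proof. by rewrite /dot big1// => i _; rewrite mxE mul0r. Qed.

Lemma measurable_dot k : measurable_fun setT (dot k).
Proof.
rewrite /dot; elim: (index_enum _) => [|i s IH].
  by under eq_fun do rewrite big_nil; exact: measurable_cst.
under eq_fun do rewrite big_cons; apply: measurable_funD => //.
apply: measurable_funM; first exact: measurable_cst.
exact: measurable_tnth.
Qed.

Lemma cmeasurable_expi (f : torus R n -> R) : measurable_fun setT f ->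
  cmeasurable (fun t => expi (f t)).
Proof.
move=> mf; split.
  apply: (@measurableT_comp _ _ _ _ _ _ (@cos R)) => //.
  by apply: continuous_measurable_fun; exact: continuous_cos.
apply: (@measurableT_comp _ _ _ _ _ _ (@sin R)) => //.
by apply: continuous_measurable_fun; exact: continuous_sin.
Qed.

Lemma measurable_phase (c : R) k : measurable_fun setT (fun t => c + dot k t).
Proof. by apply: measurable_funD; [exact: measurable_cst|exact: measurable_dot]. Qed.

(** The minus sign is that of the Gelfand series, so that coefficients with
    respect to these functions are values at the translated vertices. *)
Definition wave (k : 'rV[int]_n) (t : torus R n) : R[i] := expi (- dot (zvec R k) t).

Lemma cmeasurable_wave (k : 'rV[int]_n) : cmeasurable (wave k).
Proof.
by apply: cmeasurable_expi; apply: measurableT_comp => //; exact: measurable_dot.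
Qed.

Lemma waveD (k k' : 'rV[int]_n) t : wave (k + k') t = wave k t * wave k' t.
Proof. by rewrite /wave zvecD dotDl opprD expiD. Qed.

Lemma waveN (k : 'rV[int]_n) t : wave (- k) t = (wave k t)^*.
Proof. by rewrite /wave zvecN dotNl expiN. Qed.

Lemma wave0 t : wave 0 t = 1.
Proof. by rewrite /wave /zvec map_mx0 dot0l oppr0 expi0. Qed.

Lemma sqnorm_wave (k : 'rV[int]_n) t : sqnorm (wave k t) = 1.
Proof. exact: sqnorm_expi. Qed.

Lemma sqintegrable_wave (P : probability (torus R n) R) (k : 'rV[int]_n) : sqintegrable P (wave k).
Proof.
apply: (@sqintegrable_bounded _ _ _ _ _ 1); first exact: cmeasurable_wave.
by move=> t; rewrite sqnorm_wave.
Qed.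

End TorusMeasurable.

Section TorusNull.
Variable R : realType.

(** The law of the torus is a product of uniform laws.  This allows a null set
    of values of one coordinate to be discarded. *)
Lemma torus_prob_coord n (i : 'I_n) (N : set R) : measurable N ->
  torus_prob R n [set t | N (tnth t i)] = uniform_prob (@twopi_gt0 R) N.
Proof.
move=> mN; elim: n i => [[]//|n IH] i.
have mNi m (j : 'I_m) : measurable [set t : torus R m | N (tnth t j)].
  have := @measurable_tnth _ (measurableTypeR R) m j measurableT N mN.
  by rewrite setTI.
rewrite /= /distribution /pushforward /=.
have [->|[j ->]] : i = ord0 \/ exists j, i = lift ord0 j.
  case: (unliftP ord0 i) => [j ->|->]; [by right; exists j|by left].
  rewrite (_ : _ @^-1` _ = N `*` setT); last first.
    by apply/seteqP; split=> -[x t] /=; rewrite tnth0; [split|case].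
  rewrite product_measure1E// -[RHS]mule1; congr (_ * _)%E.
  exact: probability_setT.
rewrite (_ : _ @^-1` _ = setT `*` [set t | N (tnth t j)]); last first.
  by apply/seteqP; split=> -[x t] /=; rewrite tnthS; [split|case].
rewrite product_measure1E//; last exact: mNi.
by rewrite -[RHS]mul1e; congr (_ * _)%E; [exact: probability_setT|exact: IH].
Qed.

Lemma torus_prob_null n (i : 'I_n) (N : set R) : measurable N ->
  lebesgue_measure (N `&` `[0, 2 * pi]) = 0 -> {ae torus_prob R n, forall t, ~ N (tnth t i)}.
Proof.
move=> mN N0; exists [set t | N (tnth t i)]; split.
- have := @measurable_tnth _ (measurableTypeR R) n i measurableT N mN.
  by rewrite setTI.
- rewrite torus_prob_coord// /uniform_prob integral_uniform_pdf.
  apply: null_set_integral => //; first exact: measurableI.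
  by apply/measurable_EFinP/measurable_funTS; exact: measurable_uniform_pdf.
- by move=> t /=; apply: contrapT.
Qed.

End TorusNull.

(** * Orthonormality of the exponentials *)
Section UniformMean.
Variable R : realType.
Local Notation U := (uniform_prob (@twopi_gt0 R)).

Lemma bounded_integrable d (T : measurableType d) (P : probability T R) (f : T -> R) (C : R) :
  measurable_fun setT f -> (forall t, `|f t| <= C) -> P.-integrable setT (EFin \o f).
Proof.
move=> mf fC; apply: measurable_bounded_integrable => //.
  by apply: (le_lt_trans (probability_le1 P measurableT)); exact: ltry.
exists C; split; first exact: num_real.
by move=> x Cx t _; exact: le_trans (fC t) (ltW Cx).
Qed.

(** The mean is the increment of the primitive [F] over a period. *)
Lemma uniform_mean0 (f F : R -> R) : continuous f -> (forall x : R, is_derive x 1 F (f x)) ->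
  (forall x, `|f x| <= 1) -> F (2 * pi) = F 0 -> (\int[U]_x f x)%R = 0.
Proof.
move=> cf dF f1 Fper.
have p0 : (0 : R) < 2 * pi by exact: twopi_gt0.
have mf : measurable_fun setT f by exact: continuous_measurable_fun.
have fi : U.-integrable setT (EFin \o f) by apply: (@bounded_integrable _ _ _ _ 1).
(* Shifting by 1 makes the integrand nonnegative, as the formula for integrals
   against the uniform density requires. *)
pose g x := 1 + f x.
pose G x := x + F x.
have dG x : is_derive (x : R) 1 G (g x) by rewrite /G /g; apply: is_deriveD.
have cG : continuous G.
  move=> x; apply: differentiable_continuous; apply/derivable1_diffP.
  by have := dG x; case.
have g0 x : 0 <= g x.
  by have := f1 x; rewrite ler_norml /g => /andP[]; lra.
have mg : measurable_fun setT g by apply: measurable_funD.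
have mgE : measurable_fun setT (EFin \o g) by exact/measurable_EFinP.
have gE0 x : (0 <= (EFin \o g) x)%E by rewrite lee_fin.
have : (\int[U]_x (EFin \o g) x = 1)%E.
  rewrite (integral_uniform _ mgE gE0) /=.
  rewrite (@continuous_FTC2 _ g G 0 (2 * pi))//.
  - rewrite /G Fper add0r -EFinB -EFinM subr0 addrK mulVf ?gt_eqF//.
  - apply: continuous_subspaceT => x; apply: cvgD; [exact: cvg_cst|exact: cf].
  - split.
    + by move=> x _; have := dG x; case.
    + by apply: cvg_at_right_filter; exact: cG.
    + by apply: cvg_at_left_filter; exact: cG.
  - by move=> x _; rewrite derive1E; have := dG x; case.
rewrite /g; under eq_integral do rewrite /= EFinD.
rewrite integralD//; last exact: finite_measure_integrable_cst.
rewrite integral_cst//= probability_setT mul1e.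
rewrite /Rintegral -(fineK (integrable_fin_num measurableT fi)) -EFinD => -[].
by move=> h; apply: (@addrI _ (1 : R)); rewrite addr0.
Qed.

Lemma uniform_cos (k : int) : k != 0 -> (\int[U]_x cos (k%:~R * x))%R = 0.
Proof.
move=> k0; have k0' : (k%:~R : R) != 0 by rewrite intr_eq0.
apply: (@uniform_mean0 _ (fun x => k%:~R^-1 * sin (k%:~R * x))).
- move=> x; apply: continuous_comp; last exact: continuous_cos.
  by apply: cvgM; [exact: cvg_cst|exact: cvg_id].
- move=> x; apply: is_derive_eq.
  by rewrite /GRing.scale /=; field.
- by move=> x; exact: cos_max.
- have := expi_period (0 : R) k; rewrite add0r => -[_]; rewrite sin0 -mulrzr mulrC => ->.
  by rewrite !mulr0 sin0 mulr0.
Qed.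

Lemma uniform_sin (k : int) : (\int[U]_x sin (k%:~R * x))%R = 0.
Proof.
have [->|k0] := eqVneq k 0.
  by rewrite /Rintegral; under eq_integral do rewrite mul0r sin0; rewrite integral0.
have k0' : (k%:~R : R) != 0 by rewrite intr_eq0.
apply: (@uniform_mean0 _ (fun x => - k%:~R^-1 * cos (k%:~R * x))).
- move=> x; apply: continuous_comp; last exact: continuous_sin.
  by apply: cvgM; [exact: cvg_cst|exact: cvg_id].
- move=> x; apply: is_derive_eq.
  by rewrite /GRing.scale /=; field.
- by move=> x; exact: sin_max.
- have := expi_period (0 : R) k; rewrite add0r => -[+ _]; rewrite cos0 -mulrzr mulrC => ->.
  by rewrite mulr0 cos0.
Qed.

End UniformMean.

Section ProductMean.
Variable R : realType.

Lemma Rintegral_prob_cst d (T : measurableType d) (P : probability T R) (f : T -> R) (c : R) :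
  (forall t, f t = c) -> (\int[P]_t f t)%R = c.
Proof.
move=> fc; rewrite /Rintegral; under eq_integral do rewrite fc.
by rewrite integral_cst//= probability_setT mule1.
Qed.

Lemma Rintegral_prod d1 d2 (T1 : measurableType d1) (T2 : measurableType d2)
    (P1 : probability T1 R) (P2 : probability T2 R) (u : T1 -> R) (v : T2 -> R) :
  measurable_fun setT u -> measurable_fun setT v ->
  (forall x, `|u x| <= 1) -> (forall x, `|v x| <= 1) ->
  (\int[(P1 \x P2)%E]_z (u z.1 * v z.2))%R = (\int[P1]_x u x)%R * (\int[P2]_x v x)%R.
Proof.
move=> mu mv u1 v1.
have ui : P1.-integrable setT (EFin \o u) by apply: (@bounded_integrable _ _ _ _ _ 1).
have vi : P2.-integrable setT (EFin \o v) by apply: (@bounded_integrable _ _ _ _ _ 1).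
have muv : measurable_fun setT (fun z : T1 * T2 => u z.1 * v z.2).
  by apply: measurable_funM; [exact: measurableT_comp mu measurable_fst|exact: measurableT_comp mv measurable_snd].
have uvi : (P1 \x P2)%E.-integrable setT (EFin \o (fun z : T1 * T2 => u z.1 * v z.2)).
  apply: (@bounded_integrable _ _ _ _ _ 1) => // z.
  by rewrite normrM -[leRHS]mulr1 ler_pM.
rewrite {1}/Rintegral -(integral12_prod_meas1 uvi) /fubini_F /=.
have vE : (\int[P2]_y (v y)%:E)%E = (\int[P2]_y v y)%:E.
  by rewrite /Rintegral fineK//; exact: integrable_fin_num.
under eq_integral => x _.
  under eq_integral do rewrite EFinM.
  rewrite (integralZl measurableT vi) vE -EFinM mulrC EFinM; over.
by rewrite (integralZl measurableT ui) fineM ?integrable_fin_num//= mulrC.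
Qed.

Lemma dot_torus_cons n (k : 'rV[R]_n.+1) (z : measurableTypeR R * torus R n) :
  dot k (torus_cons z) = k 0 0 * z.1 + dot (\row_j k 0 (lift ord0 j)) z.2.
Proof.
rewrite /dot big_ord_recl tnth0; congr (_ + _).
by apply: eq_bigr => j _; rewrite tnthS mxE.
Qed.

(** On each coordinate a nontrivial exponential has mean zero, and means of
    products of functions of independent coordinates multiply; the addition
    formulas split off one coordinate at a time. *)
Lemma torus_mean n (k : 'rV[int]_n) :
  (\int[torus_prob R n]_t cos (dot (zvec R k) t))%R = (k == 0)%:R /\
  (\int[torus_prob R n]_t sin (dot (zvec R k) t))%R = 0.
Proof.
have mcos : measurable_fun setT (@cos R) by apply: continuous_measurable_fun; exact: continuous_cos.
have msin : measurable_fun setT (@sin R) by apply: continuous_measurable_fun; exact: continuous_sin.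
elim: n k => [|n IH] k.
  have -> : k == 0 by apply/eqP/rowP => -[].
  have dot0 (t : torus R 0) : dot (zvec R k) t = 0 by rewrite /dot big_ord0.
  by split; apply: Rintegral_prob_cst => t; rewrite dot0 (cos0, sin0).
pose k' : 'rV[int]_n := \row_j k 0 (lift ord0 j).
have kE : (k == 0) = (k 0 0 == 0) && (k' == 0).
  apply/eqP/andP => [k0|[/eqP k0 /eqP k'0]].
    by split; apply/eqP; [rewrite k0 mxE|apply/rowP => j; rewrite !mxE k0 mxE].
  apply/rowP => i; rewrite mxE; case: (unliftP ord0 i) => [j ->|->//].
  by have := congr1 (fun A : 'rV[int]_n => A 0 j) k'0; rewrite !mxE.
have [IHc IHs] := IH k'.
have dotE (z : measurableTypeR R * torus R n) :
    dot (zvec R k) (torus_cons z) = (k 0 0)%:~R * z.1 + dot (zvec R k') z.2.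
  rewrite dot_torus_cons mxE; congr (_ + dot _ _).
  by apply/rowP => j; rewrite !mxE.
pose U := uniform_prob (@twopi_gt0 R); pose P' := torus_prob R n.
have mx : measurable_fun setT (fun x : R => (k 0 0)%:~R * x).
  by apply: measurable_funM => //; exact: measurable_cst.
have mk (f : R -> R) : measurable_fun setT f ->
    measurable_fun setT (fun x : R => f ((k 0 0)%:~R * x)).
  by move=> mf; exact: measurableT_comp mf mx.
have mk' (f : R -> R) : measurable_fun setT f ->
    measurable_fun setT (fun t : torus R n => f (dot (zvec R k') t)).
  by move=> mf; exact: (measurableT_comp mf (measurable_dot _)).
have distE (f : R -> R) : measurable_fun setT f -> (forall x, `|f x| <= 1) ->
    (\int[torus_prob R n.+1]_t f (dot (zvec R k) t))%R =
    (\int[(U \x P')%E]_z f ((k 0 0)%:~R * z.1 + dot (zvec R k') z.2))%R.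
  move=> mf f1; rewrite /Rintegral; congr fine.
  have mfd : measurable_fun setT (fun t : torus R n.+1 => f (dot (zvec R k) t)).
    exact: (measurableT_comp mf (measurable_dot _)).
  rewrite [LHS]integral_distribution; first last.
  - apply: (@bounded_integrable _ _ _ _ (fun z => f (dot (zvec R k) (torus_cons z))) 1) => //.
    exact: measurableT_comp mfd (@measurable_torus_cons R n).
  - exact/measurable_EFinP.
  by apply: eq_integral => z _ /=; rewrite dotE.
have prodE (f g : R -> R) : measurable_fun setT f -> measurable_fun setT g ->
    (forall x, `|f x| <= 1) -> (forall x, `|g x| <= 1) ->
    (U \x P')%E.-integrable setT (EFin \o (fun z : measurableTypeR R * torus R n => f ((k 0 0)%:~R * z.1) * g (dot (zvec R k') z.2))) /\
    (\int[(U \x P')%E]_z (f ((k 0 0)%:~R * z.1) * g (dot (zvec R k') z.2)))%R =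
    (\int[U]_x f ((k 0 0)%:~R * x))%R * (\int[P']_t g (dot (zvec R k') t))%R.
  move=> mf mg f1 g1; split.
    apply: (@bounded_integrable _ _ _ _ _ 1) => [|z]; last by rewrite normrM -[leRHS]mulr1 ler_pM.
    apply: measurable_funM.
      exact: measurableT_comp (mk _ mf) measurable_fst.
    exact: measurableT_comp (mk' _ mg) measurable_snd.
  by rewrite (Rintegral_prod U P' (mk _ mf) (mk' _ mg)).
rewrite !distE//; [|exact: sin_max|exact: cos_max].
under eq_Rintegral do rewrite cosD.
under [X in _ /\ X = _]eq_Rintegral do rewrite sinD.
have [i1 e1] := prodE _ _ mcos mcos (@cos_max R) (@cos_max R).
have [i2 e2] := prodE _ _ msin msin (@sin_max R) (@sin_max R).
have [i3 e3] := prodE _ _ msin mcos (@sin_max R) (@cos_max R).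
have [i4 e4] := prodE _ _ mcos msin (@cos_max R) (@sin_max R).
rewrite RintegralB// RintegralD// e1 e2 e3 e4 IHc IHs uniform_sin.
rewrite !mulr0 mul0r subr0 addr0; split=> //.
rewrite kE; have [k0|k0] := eqVneq (k 0 0) 0; last by rewrite uniform_cos// mul0r.
rewrite -[RHS]mul1r; congr (_ * _); rewrite k0.
by apply: Rintegral_prob_cst => x; rewrite mul0r cos0.
Qed.

Lemma wave_orthonormal n : orthonormal_system (torus_prob R n) (@wave R n).
Proof.
split=> [k|k l]; first exact: sqintegrable_wave.
rewrite -subr_eq0 -oppr_eq0 opprB /ip /cint.
have E t : wave k t * (wave l t)^*%C = expi (dot (zvec R (l - k)) t).
  by rewrite -waveN -waveD /wave -dotNl -zvecN opprD opprK addrC.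
under [X in X +i* _]eq_Rintegral do rewrite E /=.
under [X in _ +i* X]eq_Rintegral do rewrite E /=.
by have [-> ->] := torus_mean (l - k); case: (_ == _).
Qed.

End ProductMean.

(** * Completeness of the exponentials *)
Section Annihilation.
Context d (T : measurableType d) (R : realType) (P : probability T R).
Variable g : T -> R.
Hypothesis gi : P.-integrable setT (EFin \o g).

Let mg : measurable_fun setT g.
Proof. by apply/measurable_EFinP; exact: measurable_int gi. Qed.

(** Orthogonality to [g]; the aim of this part is that [g] vanishes almost
    everywhere once it annihilates enough test functions. *)
Definition annihilated (p : T -> R) := (\int[P]_t (g t * p t)%:E = 0)%E.

Lemma integrable_mul_bounded (p : T -> R) : measurable_fun setT p ->
  (forall t, `|p t| <= 1) -> P.-integrable setT (fun t => (g t * p t)%:E).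
Proof.
move=> mp p1; apply: le_integrable gi => //.
  by apply/measurable_EFinP; exact: measurable_funM.
by move=> t _; rewrite !abse_EFin lee_fin normrM -[leRHS]mulr1 ler_wpM2l.
Qed.

Lemma annihilated_limit (p_ : nat -> T -> R) (p : T -> R) :
  (forall n, measurable_fun setT (p_ n)) -> measurable_fun setT p ->
  (forall n t, `|p_ n t| <= 1) ->
  {ae P, forall t, p_ n t @[n --> \oo] --> p t} ->
  (forall n, annihilated (p_ n)) -> annihilated p.
Proof.
move=> mp_ mp p1 pp an.
have [] := @dominated_convergence _ _ _ P setT measurableT
  (fun n t => (g t * p_ n t)%:E) (fun t => (g t * p t)%:E) (fun t => `|g t|%:E).
- by move=> n; apply/measurable_EFinP; exact: measurable_funM.
- by apply/measurable_EFinP; exact: measurable_funM.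
- apply: filterS pp => t pt _; apply: cvg_EFin; first exact: nearW.
  by apply: cvgM; [exact: cvg_cst|exact: pt].
- exact: integrable_norm.
- apply: aeW => t n _.
  by rewrite abse_EFin lee_fin normrM -[leRHS]mulr1 ler_wpM2l.
move=> _ _; under eq_fun do rewrite an.
by rewrite /annihilated => /cvg_lim <- //; rewrite lim_cst.
Qed.

Variable A : set (T -> R).
Hypothesis A_meas : forall p, A p -> measurable_fun setT p.
Hypothesis A01 : forall p, A p -> forall t, 0 <= p t <= 1.
Hypothesis A1 : A (fun=> 1).
Hypothesis AM : forall p q, A p -> A q -> A (fun t => p t * q t).
Hypothesis Ag : forall p, A p -> annihilated p.

(** Almost everywhere limits of uniformly bounded sequences are what dominated
    convergence allows, and they are stable under products, hence the class is
    closed under intersection. *)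
Definition approximable (D : set T) := measurable D /\
  exists p_ : nat -> T -> R, (forall n, A (p_ n)) /\
    {ae P, forall t, p_ n t @[n --> \oo] --> (\1_D t : R)}.

Let A_norm p : A p -> forall t, `|p t| <= 1.
Proof. by move=> /A01 p01 t; have /andP[p0 p1] := p01 t; rewrite ger0_norm. Qed.

Lemma approximable_setI : setI_closed approximable.
Proof.
move=> D E [mD [p [Ap pD]]] [mE [q [Aq qE]]]; split; first exact: measurableI.
exists (fun n t => p n t * q n t); split; first by move=> n; exact: AM.
apply: filterS2 pD qE => t pt qt.
by rewrite indicI; apply: cvgM.
Qed.

Lemma approximable_annihilated D : approximable D -> annihilated (\1_D).
Proof.
move=> [mD [p [Ap pD]]]; apply: (annihilated_limit (p_ := p)) => //.
- by move=> n; exact: A_meas.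
- by move=> n; exact: A_norm.
- by move=> n; exact: Ag.
Qed.

Let H := [set D | measurable D /\ annihilated (\1_D)].

Let indic_norm (D : set T) t : `|\1_D t : R| <= 1.
Proof. by rewrite indicE; case: (_ \in _); rewrite ?normr1 ?normr0. Qed.

Let lambdaH : lambda_system setT H.
Proof.
split=> //.
- by split=> //; rewrite indicT; exact: Ag.
- move=> D E ED [mD aD] [mE aE]; split; first exact: measurableD.
  rewrite /annihilated (eq_integral (fun t => (g t * \1_D t)%:E - (g t * \1_E t)%:E)%E).
    rewrite integralB//; last 2 first.
      by apply: integrable_mul_bounded => //; exact: indic_norm.
      by apply: integrable_mul_bounded => //; exact: indic_norm.
    by move: aD aE; rewrite /annihilated => -> ->; rewrite sube0.
  move=> t _; rewrite -EFinB -mulrBr; congr (_ * _)%:E.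
  rewrite !indicE in_setD; case: (boolP (t \in E)) => [tE|_].
    by rewrite (mem_set (ED _ (set_mem tE))) subrr.
  by rewrite andbT subr0.
- move=> F ndF HF; have mF n : measurable (F n) by case: (HF n).
  have mU : measurable (\bigcup_n F n) by exact: bigcupT_measurable.
  split=> //; apply: (annihilated_limit (p_ := fun n => \1_(F n))) => //.
  apply: aeW => t; rewrite [X in _ --> X]indicE; case: (boolP (t \in _)).
    rewrite inE => -[m _ Fmt]; apply: cvg_near_cst; exists m => // n /= mn.
    by rewrite indicE mem_set//; move: t Fmt; exact/subsetPset/ndF.
  rewrite notin_setE => nF; apply: cvg_near_cst; apply: nearW => n.
  by rewrite indicE memNset// => Ft; apply: nF; exists n.
  by move=> n; case: (HF n).
Qed.

(** Sets whose indicator is a limit of functions of [A] form a pi-system on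
    which the integral of [g] vanishes; the pi-lambda theorem extends this to
    the sigma-algebra that they generate. *)
Lemma annihilated_ae0 : (@measurable _ T) `<=` <<s approximable >> ->
  {ae P, forall t, g t = 0}.
Proof.
move=> gen.
have HT : @measurable _ T `<=` H.
  apply: subset_trans gen _; apply: lambda_system_subset => //.
  - exact: approximable_setI.
  - by move=> D aD; split; [case: aD|exact: approximable_annihilated].
have : ae_eq P setT (EFin \o g) (cst 0%E).
  apply: integral_ae_eq => // E _ mE.
  rewrite integral0 integral_mkcond.
  have [_ <-] := HT _ mE; apply: eq_integral => t _.
  rewrite /patch indicE; case: ifPn => _; first by rewrite mulr1.
  by rewrite mulr0.
by apply: filterS => t /(_ Logic.I)[].
Qed.

End Annihilation.

Section Smoothstep.
Variable R : realType.
Implicit Types y z : R.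

(** The cubic Hermite interpolation of a step: it fixes 0, 1/2 and 1 and is
    symmetric about 1/2.  Its iterates converge to the step function on the unit
    interval and, being polynomials, preserve trigonometric polynomials. *)
Definition smoothstep y : R := y ^+ 2 * (3 - 2 * y).

Lemma smoothstep01 y : 0 <= y <= 1 -> 0 <= smoothstep y <= 1.
Proof.
move=> /andP[y0 y1]; rewrite /smoothstep mulr_ge0 ?sqr_ge0//=; last lra.
rewrite -subr_ge0 [leRHS](_ : _ = (1 - y) ^+ 2 * (1 + 2 * y)); last by ring.
by rewrite mulr_ge0 ?sqr_ge0//; lra.
Qed.

Lemma iter_smoothstep01 n y : 0 <= y <= 1 -> 0 <= iter n smoothstep y <= 1.
Proof. by move=> y01; elim: n => //= n /smoothstep01. Qed.

Lemma iter_smoothstep_sym n y : iter n smoothstep (1 - y) = 1 - iter n smoothstep y.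
Proof. by elim: n => //= n ->; rewrite /smoothstep; ring. Qed.

(** On the interval from 0 to [y], the factor [smoothstep z / z] is at most its
    value [r < 1] at [y], so the convergence is geometric. *)
Lemma iter_smoothstep_cvg0 y : 0 <= y < 1 / 2 -> iter n smoothstep y @[n --> \oo] --> (0 : R).
Proof.
move=> /andP[y0 y2]; pose r := 3 * y - 2 * y ^+ 2.
have r0 : 0 <= r by rewrite /r; nra.
have r1 : r < 1 by rewrite /r; nra.
have itn n : 0 <= iter n smoothstep y /\ iter n smoothstep y <= y /\
    iter n smoothstep y <= r ^+ n * y.
  elim: n => [|n [z0 [zy zr]]]; first by rewrite /= expr0 mul1r.
  rewrite /=; move: (iter n smoothstep y) z0 zy zr => z z0 zy zr.
  have /andP[q0 _] : 0 <= smoothstep z <= 1 by apply: smoothstep01; lra.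
  have qr : smoothstep z <= r * z.
    have -> : smoothstep z = (3 * z - 2 * z ^+ 2) * z by rewrite /smoothstep; ring.
    rewrite ler_wpM2r// /r -subr_ge0.
    rewrite [leRHS](_ : _ = (y - z) * (3 - 2 * (y + z))); last by ring.
    by rewrite mulr_ge0//; lra.
  split=> //; split.
    by rewrite (le_trans qr)// (le_trans _ zy)// ler_piMl// ltW.
  by rewrite (le_trans qr)// exprS -mulrA ler_wpM2l.
apply: (@squeeze_cvgr _ _ _ _ (fun=> 0) (fun n => r ^+ n * y)).
- by apply: nearW => n; have [-> [_ ->]] := itn n.
- exact: cvg_cst.
- rewrite -[X in _ --> X](mul0r y); apply: cvgM; last exact: cvg_cst.
  by apply: cvg_expr; rewrite ger0_norm.
Qed.

Lemma iter_smoothstep_cvg1 y : 1 / 2 < y <= 1 -> iter n smoothstep y @[n --> \oo] --> (1 : R).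
Proof.
move=> /andP[y2 y1].
have -> : (fun n => iter n smoothstep y) = (fun n => 1 - iter n smoothstep (1 - y)).
  by apply/funext => n; rewrite iter_smoothstep_sym opprB addrC subrK.
rewrite -[X in _ --> X]subr0; apply: cvgB; first exact: cvg_cst.
by apply: iter_smoothstep_cvg0; lra.
Qed.

End Smoothstep.

Section TrigPolynomials.
Variables (R : realType) (n : nat).
Local Notation T := (torus R n).
Implicit Types p q : T -> R[i].

Definition trig_poly p := exists s : seq (R[i] * 'rV[int]_n),
  p = fun t => \sum_(x <- s) x.1 * wave x.2 t.

Lemma trig_polyD p q : trig_poly p -> trig_poly q -> trig_poly (fun t => p t + q t).
Proof. by move=> [s ->] [s' ->]; exists (s ++ s'); apply/funext => t; rewrite big_cat. Qed.

Lemma trig_polyM p q : trig_poly p -> trig_poly q -> trig_poly (fun t => p t * q t).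
Proof.
move=> [s ->] [s' ->].
exists [seq (x.1 * y.1, x.2 + y.2) | x <- s, y <- s']; apply/funext => t.
rewrite big_allpairs_dep mulr_suml; apply: eq_bigr => x _; rewrite mulr_sumr.
by apply: eq_bigr => y _ /=; rewrite waveD mulrACA.
Qed.

Lemma trig_poly_wave c k : trig_poly (fun t => c * wave k t).
Proof. by exists [:: (c, k)]; apply/funext => t; rewrite big_seq1. Qed.

Lemma trig_poly_cst c : trig_poly (fun=> c).
Proof.
have -> : (fun=> c) = (fun t : T => c * wave 0 t) by apply/funext => t; rewrite wave0 mulr1.
exact: trig_poly_wave.
Qed.

(** Euler's formula. *)
Lemma trig_poly_cos (i : 'I_n) (a : R) : trig_poly (fun t => (cos (tnth t i - a))%:C).
Proof.
have dotE (t : T) : dot (zvec R (delta_mx 0 i)) t = tnth t i.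
  rewrite /dot (bigD1 i)//= big1 ?addr0; first by rewrite !mxE !eqxx mul1r.
  by move=> j ji; rewrite !mxE (negbTE ji) andbF mul0r.
have -> : (fun t : T => (cos (tnth t i - a))%:C) =
    fun t => (expi (- a) / 2%:R) * wave (- delta_mx 0 i) t + (expi a / 2%:R) * wave (delta_mx 0 i) t.
  apply/funext => t; rewrite /wave zvecN dotNl opprK dotE.
  rewrite -!(mulrAC _ (expi _)) -!expiD -mulrDl.
  have -> : a - tnth t i = - (- a + tnth t i) by rewrite opprD opprK.
  rewrite expiN [- a + _]addrC addcJ /= mulrAC divff ?mul1r//.
apply: trig_polyD; exact: trig_poly_wave.
Qed.

(** Values in the unit interval are kept by products and by the smoothstep
    polynomial, and give the uniform bound for dominated convergence. *)
Definition unit_trig_poly : set (T -> R) :=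
  [set p | trig_poly (fun t => (p t)%:C) /\ forall t, 0 <= p t <= 1].

Lemma unit_trig_poly1 : unit_trig_poly (fun=> 1).
Proof. by split=> [|t]; [exact: trig_poly_cst|rewrite ler01 lexx]. Qed.

Lemma unit_trig_polyM (p q : T -> R) : unit_trig_poly p -> unit_trig_poly q ->
  unit_trig_poly (fun t => p t * q t).
Proof.
move=> [tp p01] [tq q01]; split; last first.
  move=> t; have /andP[p0 p1] := p01 t; have /andP[q0 q1] := q01 t.
  by rewrite mulr_ge0//= mulr_ile1.
rewrite (_ : (fun t => _) = (fun t => (p t)%:C * (q t)%:C)); first exact: trig_polyM.
by apply/funext => t; rewrite rmorphM.
Qed.

Lemma unit_trig_poly_smoothstep m (p : T -> R) : unit_trig_poly p ->
  unit_trig_poly (fun t => iter m (@smoothstep R) (p t)).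
Proof.
move=> [tp p01]; split; last by move=> t; exact: iter_smoothstep01.
elim: m => //= m; pose q t := iter m (@smoothstep R) (p t); move=> tq.
rewrite (_ : (fun t => _) = (fun t => ((q t)%:C * (q t)%:C) * (3%:C + (- 2)%:C * (q t)%:C))).
  apply: trig_polyM; first exact: trig_polyM.
  by apply: trig_polyD; [exact: trig_poly_cst|apply: trig_polyM => //; exact: trig_poly_cst].
apply/funext => t; rewrite /smoothstep -!rmorphM -rmorphD -rmorphM; congr (_ %:C).
by rewrite /q /=; ring.
Qed.

Lemma cmeasurable_trig_poly p : trig_poly p -> cmeasurable p.
Proof.
move=> [s ->]; apply: cmeasurable_sum => x.
by apply: cmeasurableM; [exact: cmeasurable_cst|exact: cmeasurable_wave].
Qed.

Local Notation appr := (approximable (torus_prob R n) unit_trig_poly).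

(** On the fundamental interval, cos (x - c/2) > cos (c/2) means x < c when c
    lies in that interval, and iterating the smoothstep polynomial sharpens
    values above and below 1/2 to 1 and 0.  Other values of c give indicators
    that are constant almost everywhere. *)
Lemma approximable_ray (i : 'I_n) (c : R) : appr [set t | tnth t i < c].
Proof.
have mray (c' : R) : measurable [set t : T | tnth t i < c'].
  rewrite (_ : [set _ | _] = setT `&` (fun t : T => tnth t i) @^-1` `]-oo, c'[%classic).
    by apply: measurable_tnth => //; exact: measurable_itv.
  by rewrite setTI; apply/seteqP; split=> t /=; rewrite in_itv.
have inside : {ae torus_prob R n, forall t, 0 < tnth t i < 2 * pi}.
  have : {ae torus_prob R n, forall t, ~ (~` `]0, 2 * pi[%classic) (tnth t i)}.
    apply: torus_prob_null; first by apply: measurableC; exact: measurable_itv.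
    apply: countable_lebesgue_measure0; apply: finite_set_countable.
    apply: (@sub_finite_set _ _ [set 0; 2 * pi]); last exact: finite_set2.
    move=> x [/=]; rewrite !in_itv /= => /negP; rewrite negb_and -!leNgt.
    by move=> h /andP[x0 x2]; case/orP: h => h; [left|right]; apply/le_anti/andP.
  by apply: ae_imp => t /contrapT; rewrite /= in_itv.
split=> //.
have [c0|c0] := leP c 0.
  exists (fun _ _ => 0); split.
    by move=> m; split=> [|t]; [exact: trig_poly_cst|rewrite ler01 lexx].
  apply: ae_imp inside => t /andP[t0 _]; rewrite indicE memNset; first exact: cvg_cst.
  by rewrite /= ltNge (le_trans c0 (ltW t0)).
have [c2|c2] := leP (2 * pi) c.
  exists (fun _ _ => 1); split; first by move=> m; exact: unit_trig_poly1.
  apply: ae_imp inside => t /andP[_ t2]; rewrite indicE mem_set; first exact: cvg_cst.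
  exact: lt_le_trans t2 c2.
(* A difference of cosines is at most 2 in absolute value, so a quarter of it
   added to 1/2 stays in the unit interval. *)
pose u (t : T) : R := 1 / 2 + (cos (tnth t i - c / 2) - cos (c / 2)) / 4.
exists (fun m t => iter m (@smoothstep R) (u t)); split.
  move=> m; apply: unit_trig_poly_smoothstep; split.
    rewrite (_ : (fun t => _) = fun t => (1 / 4)%:C * (cos (tnth t i - c / 2))%:C +
        (1 / 2 - cos (c / 2) / 4)%:C).
      apply: trig_polyD; last exact: trig_poly_cst.
      by apply: trig_polyM; [exact: trig_poly_cst|exact: trig_poly_cos].
    by apply/funext => t; rewrite -rmorphM -rmorphD; congr (_ %:C); rewrite /u; field.
  move=> t; rewrite /u.
  have := cos_le1 (tnth t i - c / 2); have := cos_geN1 (tnth t i - c / 2).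
  have := cos_le1 (c / 2); have := cos_geN1 (c / 2); lra.
have : {ae torus_prob R n, forall t, ~ [set c] (tnth t i)}.
  apply: torus_prob_null; first exact: measurable_set1.
  apply: countable_lebesgue_measure0; apply: finite_set_countable.
  by apply: sub_finite_set (finite_set1 c); exact: subIsetl.
apply: ae_imp2 inside => t /andP[t0 t2] /= tc.
(* The first sine is positive and the second has the sign of c minus the
   coordinate, so u t is compared with 1/2 as c with the coordinate. *)
have uE : u t = 1 / 2 + sin (tnth t i / 2) * sin ((c - tnth t i) / 2) / 2.
  rewrite /u; set a := tnth t i / 2; set b := (c - tnth t i) / 2.
  have -> : tnth t i - c / 2 = a - b by rewrite /a /b; field.
  have -> : c / 2 = a + b by rewrite /a /b; field.
  by rewrite cosB cosD; field.
have s1 : 0 < sin (tnth t i / 2) by apply: sin_gt0_pi; lra.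
have s1' := sin_le1 (tnth t i / 2).
have sl := sin_le1 ((c - tnth t i) / 2).
rewrite indicE; case: (ltrgtP (tnth t i) c) => [ltc|gtc|eqc]; last by case: tc.
- rewrite mem_set//; apply: iter_smoothstep_cvg1; rewrite uE.
  have : 0 < sin ((c - tnth t i) / 2) by apply: sin_gt0_pi; lra.
  by move=> s2; apply/andP; split; nra.
- rewrite memNset/=; last by rewrite ltNge ltW.
  apply: iter_smoothstep_cvg0; rewrite uE.
  have : 0 < sin (- ((c - tnth t i) / 2)) by apply: sin_gt0_pi; lra.
  have := sin_geN1 ((c - tnth t i) / 2).
  by rewrite sinN => s2' s2; apply/andP; split; nra.
Qed.

Lemma approximable_generate : (@measurable _ T) `<=` <<s appr >>.
Proof.
have SA : sigma_algebra setT <<s appr >> by exact: smallest_sigma_algebra.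
have [S0 SC SU] := SA.
apply: smallest_sub => //.
elim/big_ind : _ => [|X Y XS YS|i _]; first exact: sub0set.
  by rewrite subUset.
move=> _ [X mX <-]; rewrite setTI; move: X mX.
rewrite (RGenInftyO.measurableE R); apply: smallest_sub.
  split=> [|X SX|F SF].
  - by rewrite /= preimage_set0.
  - by rewrite /= setTD preimage_setC -setTD; exact: SC.
  - by rewrite /= preimage_bigcup; exact: SU.
move=> X [c ->] /=; apply: sub_sigma_algebra.
rewrite (_ : _ @^-1` _ = [set t | tnth t i < c]); first exact: approximable_ray.
by apply/seteqP; split=> t /=; rewrite in_itv.
Qed.

End TrigPolynomials.

Section WaveComplete.
Variables (R : realType) (n : nat).
Local Notation T := (torus R n).
Local Notation P := (torus_prob R n).

(** A real test function separates the real and imaginary parts of the inner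
    product, so the two parts of [h] can be treated as real functions. *)
Lemma annihilated_unit_trig_poly (h : T -> R[i]) : sqintegrable P h ->
  (forall k, ip P h (@wave R n k) = 0) -> forall p, unit_trig_poly p ->
  annihilated P (fun t => complex.Re (h t)) p /\
  annihilated P (fun t => complex.Im (h t)) p.
Proof.
move=> hi h0 p [tp p01].
have pi : sqintegrable P (fun t => (p t)%:C).
  apply: (@sqintegrable_bounded _ _ _ _ _ 1); first exact: cmeasurable_trig_poly.
  move=> t; rewrite /sqnorm /= expr0n addr0.
  by have /andP[p0 p1] := p01 t; rewrite expr_le1.
have hp0 : ip P h (fun t => (p t)%:C) = 0.
  rewrite (ipC pi hi); move: tp => [s sE]; rewrite sE ip_suml//; last first.
    by move=> x; apply: sqintegrableZ; exact: sqintegrable_wave.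
  rewrite big1 ?conjc0// => x _; rewrite ipZl//; last exact: sqintegrable_wave.
  by rewrite (ipC hi (sqintegrable_wave _ _)) h0 conjc0 mulr0.
have [i1 i2] := cintegrable_ip hi pi.
have ReE t : complex.Re (h t * ((p t)%:C)^*%C) = complex.Re (h t) * p t.
  by case: (h t) => a b /=; rewrite oppr0 mulr0 subr0.
have ImE t : complex.Im (h t * ((p t)%:C)^*%C) = complex.Im (h t) * p t.
  by case: (h t) => a b /=; rewrite oppr0 mulr0 add0r.
have [r0 im0] : complex.Re (ip P h (fun t => (p t)%:C)) = 0 /\
   complex.Im (ip P h (fun t => (p t)%:C)) = 0 by rewrite hp0.
split; rewrite /annihilated.
  rewrite (eq_integral (fun t => (complex.Re (h t * ((p t)%:C)^*%C))%:E)); last first.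
    by move=> t _; rewrite ReE.
  by rewrite -(fineK (integrable_fin_num measurableT i1)); congr EFin.
rewrite (eq_integral (fun t => (complex.Im (h t * ((p t)%:C)^*%C))%:E)); last first.
  by move=> t _; rewrite ImE.
by rewrite -(fineK (integrable_fin_num measurableT i2)); congr EFin.
Qed.

(** The exponentials form a complete system: rays in the coordinates generate
    the sigma-algebra, and their indicators are limits of trigonometric
    polynomials with values in the unit interval. *)
Lemma wave_complete (h : T -> R[i]) : sqintegrable P h ->
  (forall k, ip P h (@wave R n k) = 0) -> {ae P, forall t, h t = 0}.
Proof.
move=> hi h0; have [ri ii] := sqintegrable_cintegrable hi.
have A_meas p : @unit_trig_poly R n p -> measurable_fun setT p.
  by move=> [/cmeasurable_trig_poly[]].
have A01 p : @unit_trig_poly R n p -> forall t, 0 <= p t <= 1 by case.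
have A1 := @unit_trig_poly1 R n.
have gen := @approximable_generate R n.
have ae_re := @annihilated_ae0 _ _ _ P _ ri _ A_meas A01 A1 (@unit_trig_polyM R n)
  (fun p tp => (annihilated_unit_trig_poly hi h0 tp).1) gen.
have ae_im := @annihilated_ae0 _ _ _ P _ ii _ A_meas A01 A1 (@unit_trig_polyM R n)
  (fun p tp => (annihilated_unit_trig_poly hi h0 tp).2) gen.
by apply: ae_imp2 ae_re ae_im => t; case: (h t) => a b /= -> ->.
Qed.

Lemma wave_coef_inj (g h : T -> R[i]) : sqintegrable P g -> sqintegrable P h ->
  (forall k, ip P g (@wave R n k) = ip P h (@wave R n k)) ->
  {ae P, forall t, g t = h t}.
Proof.
move=> gi hi gh; have : {ae P, forall t, g t - h t = 0}.
  apply: wave_complete; first exact: sqintegrableB.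
  by move=> k; rewrite ipBl ?gh ?subrr//; exact: sqintegrable_wave.
by apply: ae_imp => t /eqP; rewrite subr_eq0 => /eqP.
Qed.

End WaveComplete.

(** * Lattice coordinates of vertices *)

Lemma fsbig_fintype (V : Type) (idx : V) (op : Monoid.com_law idx) (I : finType)
    (A : pred I) (F : I -> V) :
  \big[op/idx]_(i \in [set i | A i]) F i = \big[op/idx]_(i | A i) F i.
Proof.
rewrite (@bigfs _ _ op _ (index_enum I) A F (index_enum_uniq _))// => i _.
by rewrite mem_index_enum.
Qed.

Section VertexCoordinates.
Variables (R : realType) (d : nat) (Gam : lattice R d) (G : periodic_graph Gam).
Variable B : lattice_basis Gam.
Let Gs := fundamental_graph G B.
Implicit Types (w : pvert G) (v : fvert G B) (k : 'rV[int]_d).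

Lemma vshift_fred w : vshift B (val (fred B w)) (ipart B (ppos w)) = w.
Proof.
rewrite /= /vshift -vtrD; try exact: basis_lattice.
by rewrite -mulmxDl -zvecD addNr zvec0 mul0mx vtr0.
Qed.

Lemma fred_vshift v k : fred B (vshift B (val v) k) = v.
Proof. by rewrite fred_vtr ?fred_val//; exact: basis_lattice. Qed.

Lemma ipart_val v : ipart B (ppos (val v)) = 0.
Proof.
have cv := asboolW (valP v).
have vE : ppos (val v) = ppos (val v) + zvec R 0 *m B by rewrite zvec0 mul0mx addr0.
by have [<- _] := fpart_unique (basis_unit B) cv vE.
Qed.

Lemma ipart_vshift v k : ipart B (ppos (vshift B (val v) k)) = k.
Proof.
rewrite ppos_vtr; last exact: basis_lattice.
by have [-> _] := part_transl (ppos (val v)) k (basis_unit B); rewrite ipart_val add0r.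
Qed.

Lemma vshift_bij : set_bij [set: fvert G B * 'rV[int]_d] [set: pvert G]
  (fun x => vshift B (val x.1) x.2).
Proof.
split=> //.
  move=> [v k] [v' k'] _ _ /= E.
  have := congr1 (fred B) E; have := congr1 (fun w => ipart B (ppos w)) E.
  by rewrite /= !fred_vshift !ipart_vshift => -> ->.
by move=> w _; exists (fred B w, ipart B (ppos w)) => //; exact: vshift_fred.
Qed.

Lemma l2norm2_vshift (f : pvert G -> R[i]) :
  l2norm2 f = (\sum_(v : fvert G B) l2norm2 (fun k => f (vshift B (val v) k)))%E.
Proof.
rewrite /l2norm2 (@reindex_esum R _ _ _ _ _ (fun w => sqmod (f w)) vshift_bij).
have -> : [set: fvert G B * 'rV[int]_d] = [set: fvert G B] `*`` (fun=> setT).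
  by apply/seteqP; split.
rewrite -(@esum_esum R _ _ setT (fun=> setT) (fun v k => sqmod (f (vshift B (val v) k)))); last first.
  by move=> v k _ _; exact: sqmod_ge0.
rewrite esum_fset; last first.
- by move=> v _; apply: esum_ge0 => k _; exact: sqmod_ge0.
- exact: fvert_finite.
by rewrite (_ : setT = [set v | xpredT v]) ?fsbig_fintype//; apply/seteqP.
Qed.

Lemma l2_vshift (f : pvert G -> R[i]) v : l2 f -> l2 (fun k => f (vshift B (val v) k)).
Proof.
rewrite /l2 /= l2norm2_vshift (bigD1 v)//=; apply: le_lt_trans.
by rewrite leeDl// sume_ge0// => u _; exact: l2norm2_ge0.
Qed.

(** Injectivity holds because the lattice acts freely on vertices, and
    surjectivity because an edge can be translated so as to start at any
    prescribed vertex of the orbit of its source. *)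
Lemma dart_star_bij v k : set_bij
  [set e | src (pgraph G) e = vshift B (val v) k] [set E | src Gs E == v]
  (fun e => \pi_(fdart G) e).
Proof.
split.
- by move=> e /= eE; rewrite fsrc_pi eE fred_vshift.
- move=> e e'; rewrite !inE /= => eE e'E /eqmodP/asboolP[a Ga aE].
  move: e'E; rewrite aE src_dtr// eE -[RHS]vtr0 => /vtr_inj -> //.
    by rewrite dtr0.
  exact: lattice0.
- move=> E /= /eqP Ev; pose w := src (pgraph G) (repr E).
  have wv : fred B w = v by [].
  pose a := zvec R (k - ipart B (ppos w)) *m B.
  have Ga : Gam a by exact: basis_lattice.
  exists (dtr (repr E) a); last by rewrite pi_dtr// reprK.
  rewrite /= src_dtr// -/w -{1}(vshift_fred w) wv /vshift -vtrD//; last exact: basis_lattice.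
  by rewrite -mulmxDl -zvecD addrC subrK.
Qed.

(** The operator in the coordinates of [vshift_bij]: following an edge adds its
    index to the lattice coordinate. *)
Lemma schroedinger_vshift (alpha : pdart G -> R) (Q : pvert G -> R)
    (f : pvert G -> R[i]) v k :
  magnetic_potential alpha -> periodic_potential Q ->
  schroedinger (pgraph G) alpha Q f (vshift B (val v) k) =
  (degree Gs v)%:R * f (vshift B (val v) k) -
  \sum_(E | src Gs E == v) expi (magnetic_form alpha E) *
    f (vshift B (val (tgt Gs E)) (k + index_form B E)) +
  (Q (val v))%:C * f (vshift B (val v) k).
Proof.
move=> am Qp; rewrite /schroedinger Qp; last exact: basis_lattice.
congr (_ + _); rewrite /magnetic_laplacian; set w := vshift B (val v) k.
pose F E := f w - expi (magnetic_form alpha E) *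
    f (vshift B (val (tgt Gs E)) (k + index_form B E)).
transitivity (\sum_(e \in [set e | src (pgraph G) e = w]) F (\pi_(fdart G) e)).
  apply: eq_fsbigr => e; rewrite inE /= => ew.
  rewrite /F magnetic_form_pi// index_form_pi ew ipart_vshift [k + _]addrC subrK.
  by rewrite -[tgt Gs _]/(ftgt B _) ftgt_pi vshift_fred.
rewrite -(@reindex_fsbig _ _ _ _ _ _ _ _ F (dart_star_bij v k)).
rewrite fsbig_fintype.
rewrite sumrB sumr_const; congr (_ - _).
by rewrite mulr_natl /degree cardsE.
Qed.

End VertexCoordinates.

(** * Fiber operators and the Gelfand transformation *)
Section FiberSpace.
Variables (R : realType) (n : nat) (V A : finType) (G : mgraph V A).
Local Notation P := (torus_prob R n).
Implicit Types (g : torus R n -> V -> R[i]).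

Lemma fiber_spaceP g : fiber_space g <-> forall v, sqintegrable P (fun t => g t v).
Proof.
split=> gF v; first by have [gr gi goo] := gF v; split.
by have [[gr gi] goo] := gF v; split.
Qed.

Lemma ae_eq_fiberP g h : ae_eq_fiber g h <-> forall v, {ae P, forall t, g t v = h t v}.
Proof.
split=> [gh v|gh]; first by apply: ae_imp gh => t ->.
have := ae_forall gh; apply: ae_imp => t ght.
by apply/funext => v.
Qed.

Lemma ae_eq_fiber_trans g h h' : ae_eq_fiber g h -> ae_eq_fiber h h' -> ae_eq_fiber g h'.
Proof. by apply: ae_imp2 => t -> ->. Qed.

Lemma sqintegrable_phase (h : torus R n -> R[i]) (c : R) (k : 'rV[R]_n) :
  sqintegrable P h -> sqintegrable P (fun t => expi (c + dot k t) * h t).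
Proof.
apply: (@sqintegrable_mull _ _ _ _ _ _ 1).
  by apply: cmeasurable_expi; exact: measurable_phase.
by move=> t; rewrite sqnorm_expi.
Qed.

Lemma sqint_phase (h : torus R n -> R[i]) (c : R) (k : 'rV[R]_n) :
  sqint P (fun t => expi (c + dot k t) * h t) = sqint P h.
Proof. by apply: eq_integral => t _; rewrite !sqmodE sqnormM sqnorm_expi mul1r. Qed.

Lemma fiber_space_schroedinger (m : A -> 'rV[R]_n) (phi : A -> R) (Q : V -> R) g :
  fiber_space g -> fiber_space (direct_integral (fiber_schroedinger G m phi Q) g).
Proof.
move=> /fiber_spaceP gF; apply/fiber_spaceP => v.
rewrite /direct_integral /fiber_schroedinger /fiber_laplacian.
apply: sqintegrableD; last exact: sqintegrableZ.
apply: sqintegrableB; first exact: sqintegrableZ.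
under eq_fun do rewrite big_mkcond.
apply: sqintegrable_sum => e; case: (_ == v); first exact: sqintegrable_phase.
apply: (@sqintegrable_bounded _ _ _ _ _ 0); first exact: cmeasurable_cst.
by move=> t; rewrite sqnorm0.
Qed.

(** The gauge factor at the source of an edge times the old phase is the new
    phase times the gauge factor at the target; multiples of 2 pi in the
    magnetic part disappear in the exponential. *)
Lemma fiber_laplacian_gauge (m m' : A -> 'rV[R]_n) (phi phi' : A -> R)
    (w : V -> 'rV[R]_n) (theta : V -> R) (t : torus R n) (f : V -> R[i]) v :
  (forall e, m e - m' e = w (tgt G e) - w (src G e)) ->
  (forall e, exists k : int,
    phi e - phi' e = theta (tgt G e) - theta (src G e) + (2 * pi) *~ k) ->
  expi (theta v + dot (w v) t) * fiber_laplacian G m phi t f v =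
  fiber_laplacian G m' phi' t (fun u => expi (theta u + dot (w u) t) * f u) v.
Proof.
move=> mE phiE; rewrite /fiber_laplacian mulrBr mulrCA; congr (_ - _).
rewrite mulr_sumr; apply: eq_bigr => e /eqP <-.
rewrite !mulrA -!expiD; congr (_ * _); have [k kE] := phiE e.
rewrite -[RHS](expi_period _ k); congr expi.
have -> : m e = m' e + (w (tgt G e) - w (src G e)) by rewrite -mE addrC subrK.
rewrite -[phi e](subrK (phi' e)) kE !dotDl dotNl.
by ring.
Qed.

End FiberSpace.

Section Gelfand.
Variables (R : realType) (d : nat) (Gam : lattice R d) (G : periodic_graph Gam).
Variable B : lattice_basis Gam.
Local Notation P := (torus_prob R d).
Let Gs := fundamental_graph G B.
Implicit Types (f : pvert G -> R[i]) (g : torus R d -> fvert G B -> R[i]).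

Lemma is_gelfandP f g : is_gelfand f g <->
  forall v, is_fourier_sum P (@wave R d) (fun k => f (vshift B (val v) k)) (fun t => g t v).
Proof.
have sumE (S : {fset 'rV[int]_d}) t (v : fvert G B) : gelfand_sum S f t v =
    partial_sum (@wave R d) S (fun k => f (vshift B (val v) k)) t.
  by apply: eq_bigr => k _; rewrite mulrC.
split=> [[/fiber_spaceP gF gS] v|gS].
  split=> // eps eps0; have [S0 hS0] := gS v eps eps0; exists S0 => S /hS0.
  by under eq_integral do rewrite sumE.
split; first by apply/fiber_spaceP => v; case: (gS v).
move=> v eps eps0; have [S0 hS0] := (gS v).2 eps eps0; exists S0 => S /hS0.
by under [in X in _ -> X]eq_integral do rewrite sumE.
Qed.

Lemma gelfandP f : l2 f -> is_gelfand f (gelfand f : torus R d -> fvert G B -> R[i]).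
Proof.
move=> fl2; rewrite /gelfand.
have [h hh] := choice (fun v : fvert G B => riesz_fischer (wave_orthonormal R d) (l2_vshift v fl2)).
by apply: (@xgetPex _ (fun _ _ => 0) (is_gelfand f)); exists (fun t v => h v t); exact/is_gelfandP.
Qed.

Lemma gelfand_fiber_space f : l2 f -> fiber_space (gelfand f : torus R d -> fvert G B -> R[i]).
Proof. by move=> /gelfandP[]. Qed.

Lemma gelfand_coef f (v : fvert G B) k : l2 f ->
  ip P (fun t => gelfand f t v) (@wave R d k) = f (vshift B (val v) k).
Proof.
move=> /gelfandP /is_gelfandP /(_ v).
exact: (fourier_sum_coef (wave_orthonormal R d)).
Qed.

(** This is how a Gelfand transform is recognized: linearity, surjectivity and
    the intertwining relation reduce to a computation of coefficients. *)
Lemma gelfand_unique f g : l2 f -> fiber_space g ->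
  (forall v k, ip P (fun t => g t v) (@wave R d k) = f (vshift B (val v) k)) ->
  ae_eq_fiber (gelfand f) g.
Proof.
move=> fl2 /fiber_spaceP gF gE; apply/ae_eq_fiberP => v; apply: wave_coef_inj => //.
  by have /fiber_spaceP := gelfand_fiber_space fl2.
by move=> k; rewrite gelfand_coef// gE.
Qed.

Lemma gelfand_norm f : l2 f ->
  fiber_norm2 (gelfand f : torus R d -> fvert G B -> R[i]) = l2norm2 f.
Proof.
move=> /gelfandP /is_gelfandP fg; rewrite (l2norm2_vshift B); apply: eq_bigr => v _.
exact: (parseval (wave_orthonormal R d) (fg v)).
Qed.

(** Bessel's inequality on each fiber.  It yields square summability of a
    function on the vertices, such as a linear combination or the image of
    [schroedinger], from an explicit candidate for its Gelfand transform. *)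
Lemma l2_of_coef f g : fiber_space g ->
  (forall v k, ip P (fun t => g t v) (@wave R d k) = f (vshift B (val v) k)) -> l2 f.
Proof.
move=> /fiber_spaceP gF gE; rewrite /l2 /= (l2norm2_vshift B).
apply: lte_sum_pinfty => v _.
apply: le_lt_trans (gF v).2; apply: le_trans (bessel (wave_orthonormal R d) (gF v)).
rewrite le_eqVlt; apply/orP; left; apply/eqP; congr l2norm2.
by apply/funext => k; rewrite gE.
Qed.

Lemma gelfand_surjective g : fiber_space g -> exists2 f, l2 f & ae_eq_fiber (gelfand f) g.
Proof.
move=> gF.
pose f w := ip P (fun t => g t (fred B w)) (@wave R d (ipart B (ppos w))).
have gE v k : ip P (fun t => g t v) (@wave R d k) = f (vshift B (val v) k).
  by rewrite /f fred_vshift ipart_vshift.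
have fl2 := l2_of_coef gF gE.
by exists f => //; exact: gelfand_unique.
Qed.

Lemma l2_lin (a : R[i]) f f' : l2 f -> l2 f' -> l2 (fun w => a * f w + f' w).
Proof.
move=> fl2 f'l2.
have /fiber_spaceP gF := gelfand_fiber_space fl2.
have /fiber_spaceP g'F := gelfand_fiber_space f'l2.
apply: (@l2_of_coef _ (fun t v => a * gelfand f t v + gelfand f' t v)).
  by apply/fiber_spaceP => v; apply: sqintegrableD => //; exact: sqintegrableZ.
move=> v k; rewrite ipDl//; [|exact: sqintegrableZ|exact: sqintegrable_wave].
by rewrite ipZl ?gelfand_coef//; exact: sqintegrable_wave.
Qed.

Lemma gelfand_linear (a : R[i]) f f' : l2 f -> l2 f' ->
  ae_eq_fiber (gelfand (fun w => a * f w + f' w))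
    (fun t (v : fvert G B) => a * gelfand f t v + gelfand f' t v).
Proof.
move=> fl2 f'l2.
have /fiber_spaceP gF := gelfand_fiber_space fl2.
have /fiber_spaceP g'F := gelfand_fiber_space f'l2.
apply: gelfand_unique; first exact: l2_lin.
  by apply/fiber_spaceP => v; apply: sqintegrableD => //; exact: sqintegrableZ.
move=> v k; rewrite ipDl//; [|exact: sqintegrableZ|exact: sqintegrable_wave].
by rewrite ipZl ?gelfand_coef//; exact: sqintegrable_wave.
Qed.

Section Schroedinger.
Variables (alpha : pdart G -> R) (Q : pvert G -> R).
Hypotheses (am : magnetic_potential alpha) (Qp : periodic_potential Q).

(** The pure Gelfand transformation leads to the fiber operator of the index
    form and of the magnetic form themselves. *)
Definition gelfand_fiber : torus R d -> (fvert G B -> R[i]) -> fvert G B -> R[i] :=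
  fiber_schroedinger Gs (@zvec R d \o index_form B) (magnetic_form alpha) (fun v => Q (val v)).

Lemma ip_phase (h : torus R d -> R[i]) (c : R) (k l : 'rV[int]_d) : sqintegrable P h ->
  ip P (fun t => expi (c + dot (zvec R l) t) * h t) (wave k) = expi c * ip P h (wave (k + l)).
Proof.
move=> hi; rewrite -ipZl//; last exact: sqintegrable_wave.
suff E t : expi (c + dot (zvec R l) t) * h t * (wave k t)^*%C =
    expi c * (h t * (wave (k + l) t)^*%C) by apply: eq_cint => t; rewrite [LHS]E mulrA.
rewrite -!waveN expiD.
have -> : expi (dot (zvec R l) t) = wave (- l) t by rewrite /wave zvecN dotNl opprK.
by rewrite opprD waveD -!mulrA; congr (_ * _); rewrite mulrCA [wave (- l) t * _]mulrC.
Qed.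

(** Coefficient by coefficient: multiplication by the exponential of an
    integral vector shifts coefficients, as following an edge shifts lattice
    coordinates by its index. *)
Lemma gelfand_fiber_coef f v k : l2 f ->
  ip P (fun t => gelfand_fiber t (gelfand f t) v) (wave k) =
  schroedinger (pgraph G) alpha Q f (vshift B (val v) k).
Proof.
move=> fl2; have /fiber_spaceP gF := gelfand_fiber_space fl2.
rewrite (schroedinger_vshift _ _ _ am Qp).
have wi := sqintegrable_wave P k.
pose F E := fun t => if src Gs E == v then expi (magnetic_form alpha E +
  dot (zvec R (index_form B E)) t) * gelfand f t (tgt Gs E) else 0.
have Fi E : sqintegrable P (F E).
  rewrite /F; case: (_ == v); first exact: sqintegrable_phase.
  apply: (@sqintegrable_bounded _ _ _ _ _ 0); first exact: cmeasurable_cst.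
  by move=> t; rewrite sqnorm0.
rewrite /gelfand_fiber /fiber_schroedinger /fiber_laplacian.
under [X in ip _ X]eq_fun do rewrite big_mkcond.
rewrite ipDl//; last 2 first.
- by apply: sqintegrableB; [exact: sqintegrableZ|exact: sqintegrable_sum].
- exact: sqintegrableZ.
rewrite ipBl//; [|exact: sqintegrableZ|exact: sqintegrable_sum].
rewrite !ipZl// !gelfand_coef// ip_suml// [in RHS]big_mkcond /=.
congr (_ - _ + _); apply: eq_bigr => E _; rewrite /F.
case: (_ == v); first by rewrite ip_phase// gelfand_coef.
rewrite /ip -[RHS](@cint0 _ _ _ P); apply: eq_cint => t; exact: mul0r.
Qed.

Lemma l2_schroedinger f : l2 f -> l2 (schroedinger (pgraph G) alpha Q f).
Proof.
move=> fl2; apply: (@l2_of_coef _ (direct_integral gelfand_fiber (gelfand f))).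
  exact/fiber_space_schroedinger/gelfand_fiber_space.
by move=> v k; exact: gelfand_fiber_coef.
Qed.

Lemma gelfand_schroedinger f : l2 f ->
  ae_eq_fiber (gelfand (schroedinger (pgraph G) alpha Q f))
    (direct_integral gelfand_fiber (gelfand f)).
Proof.
move=> fl2; apply: gelfand_unique; first exact: l2_schroedinger.
  exact/fiber_space_schroedinger/gelfand_fiber_space.
by move=> v k; exact: gelfand_fiber_coef.
Qed.

End Schroedinger.
End Gelfand.

(** * The gauge transformation *)

Lemma flux_class_gauge (R : realType) (V A : finType) (G : mgraph V A) (M : lmodType R)
    (K : set M) (x b b' : A -> M) :
  connected_graph G -> is_subgroup K -> is_form G x ->
  flux_class G K x b -> flux_class G K x b' ->
  exists h : V -> M, forall e, K (b e - b' e - (h (tgt G e) - h (src G e))).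
Proof.
move=> conG KK xF /(flux_classP conG _ KK xF)[_ [h bh]].
move=> /(flux_classP conG _ KK xF)[_ [h' bh']].
have subACA (y z y' z' : M) : y - z - (y' - z') = (y - y') - (z - z').
  by rewrite opprD addrACA -opprD.
exists (fun v => h v - h' v) => e; have := KK.2 _ _ (bh e) (bh' e).
by rewrite [X in K X -> _]subACA [b e - x e - _]subACA subrr subr0 [h _ - _ - _]subACA.
Qed.

Section Gauge.
Variables (R : realType) (d : nat) (Gam : lattice R d) (G : periodic_graph Gam).
Variable B : lattice_basis Gam.
Let Gs := fundamental_graph G B.
Local Notation P := (torus_prob R d).
Variable v0 : fvert G B.

Lemma path_to_walk v : walk Gs v0 (path_to v0 v) v.
Proof. by have := @xgetPex _ [::] [set p | walk Gs v0 p v] (fundamental_connected v0 v). Qed.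

Lemma path_sum_primitive (M : zmodType) (K : set M) (b : fdart G -> M)
    (h : fvert G B -> M) u v p : is_subgroup K ->
  (forall e, K (b e - (h (tgt Gs e) - h (src Gs e)))) -> walk Gs u p v ->
  K (path_sum b p - (h v - h u)).
Proof.
move=> KK Kb uv; rewrite -(walk_telescope h uv) /path_sum -sumrB.
exact: subgroup_sum.
Qed.

(** The index form has the fluxes of the coordinate form, so its difference
    with [m] has a primitive; in particular the sums along walks that define
    the gauge transformation depend on the endpoint only. *)
Lemma gauge_potential_primitive m : same_flux Gs (coordinate_form B) m ->
  exists h : fvert G B -> 'rV[R]_d,
    (forall E, zvec R (index_form B E) - m E = h (tgt Gs E) - h (src Gs E)) /\
    forall v p, walk Gs v0 p v ->
      path_sum (fun e => zvec R (index_form B e) - m e) p = h v - h v0.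
Proof.
move=> mF; have tF := @index_same_flux _ _ _ G B; rewrite !same_fluxE in mF tF.
have [h hE] := flux_class_gauge (@fundamental_connected _ _ _ G B) (@is_subgroup0 _)
  (@coordinate_form_is_form _ _ _ G B) tF mF.
exists h; split=> [E|v p vp].
  by have /eqP := hE E; rewrite subr_eq0 => /eqP.
have /eqP := @path_sum_primitive _ _ (fun e => zvec R (index_form B e) - m e) h _ _ _
  (@is_subgroup0 _) hE vp.
by rewrite subr_eq0 => /eqP.
Qed.

Lemma gauge_phase_primitive (alpha : pdart G -> R) phi : magnetic_potential alpha ->
  same_flux_mod2pi Gs (magnetic_form alpha) phi ->
  exists h : fvert G B -> R,
    (forall E, exists k : int,
      magnetic_form alpha E - phi E = h (tgt Gs E) - h (src Gs E) + (2 * pi) *~ k) /\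
    forall v p, walk Gs v0 p v -> exists k : int,
      path_sum (fun e => magnetic_form alpha e - phi e) p = h v - h v0 + (2 * pi) *~ k.
Proof.
move=> am; rewrite same_flux_mod2piE => phiF.
have KK := @is_subgroup_mulz R^o (2 * pi).
have aF := magnetic_form_is_form B am.
have aC : flux_class (M := R^o) Gs (range (fun k : int => (2 * pi : R^o) *~ k))
    (magnetic_form alpha) (magnetic_form alpha).
  by split=> // c _; rewrite subrr; exact: KK.1.
have [h hE] := flux_class_gauge (@fundamental_connected _ _ _ G B) KK aF aC phiF.
exists h; split=> [E|v p vp].
  by have [k _ kE] := hE E; exists k; rewrite kE [RHS]addrC subrK.
have [k _ kE] := @path_sum_primitive _ _ (fun e => magnetic_form alpha e - phi e) h _ _ _ KK hE vp.
by exists k; rewrite kE [RHS]addrC subrK.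
Qed.

Variables (alpha : pdart G -> R) (Q : pvert G -> R).
Variables (m : fdart G -> 'rV[R]_d) (phi : fdart G -> R).
Hypotheses (am : magnetic_potential alpha) (Qp : periodic_potential Q).
Hypothesis mF : same_flux Gs (coordinate_form B) m.
Hypothesis phiF : same_flux_mod2pi Gs (magnetic_form alpha) phi.

Lemma gauge_potential_walk v p : walk Gs v0 p v ->
  gauge_potential v0 m v = path_sum (fun e => zvec R (index_form B e) - m e) p.
Proof.
have [h [_ hp]] := gauge_potential_primitive mF.
by move=> vp; rewrite /gauge_potential (hp _ _ vp) (hp _ _ (path_to_walk v)).
Qed.

Lemma gauge_phase_walk v p : walk Gs v0 p v -> exists k : int,
  gauge_phase v0 alpha phi v =
  path_sum (fun e => magnetic_form alpha e - phi e) p + (2 * pi) *~ k.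
Proof.
have [h [_ hp]] := gauge_phase_primitive am phiF.
move=> /hp[k kE]; have [l lE] := hp _ _ (path_to_walk v).
by exists (l - k); rewrite /gauge_phase lE kE mulrzBr; ring.
Qed.

Lemma gauge_potential_edge E : zvec R (index_form B E) - m E =
  gauge_potential v0 m (tgt Gs E) - gauge_potential v0 m (src Gs E).
Proof.
have [h [-> hp]] := gauge_potential_primitive mF.
rewrite /gauge_potential !(hp _ _ (path_to_walk _)).
by rewrite opprB addrA subrK.
Qed.

Lemma gauge_phase_edge E : exists k : int, magnetic_form alpha E - phi E =
  gauge_phase v0 alpha phi (tgt Gs E) - gauge_phase v0 alpha phi (src Gs E) + (2 * pi) *~ k.
Proof.
have [h [hE hp]] := gauge_phase_primitive am phiF.
have [k ->] := hE E.
have [kt tE] := hp _ _ (path_to_walk (tgt Gs E)).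
have [ks sE] := hp _ _ (path_to_walk (src Gs E)).
by exists (k - kt + ks); rewrite /gauge_phase tE sE !mulrzDr mulrNz; ring.
Qed.

Local Notation gauge := (gauge_transform v0 alpha m phi).
Local Notation U := (fun f => gauge (gelfand f)).

Lemma gauge_fiber_space g : fiber_space g -> fiber_space (gauge g).
Proof.
by move=> /fiber_spaceP gF; apply/fiber_spaceP => v; exact: sqintegrable_phase.
Qed.

Lemma gauge_norm g : fiber_norm2 (gauge g) = fiber_norm2 g.
Proof. by apply: eq_bigr => v _; exact: sqint_phase. Qed.

Lemma gauge_ae_eq g h : ae_eq_fiber g h -> ae_eq_fiber (gauge g) (gauge h).
Proof.
by apply: ae_imp => t gh; apply/funext => v; rewrite /gauge_transform gh.
Qed.

Lemma gauge_gelfand_unitary : unitary_to_fiber_space U.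
Proof.
split=> [f fl2|a f f' fl2 f'l2|f fl2|g gF].
- exact/gauge_fiber_space/gelfand_fiber_space.
- apply: ae_eq_fiber_trans (gauge_ae_eq (gelfand_linear B a fl2 f'l2)) _.
  apply: ae_all => t; apply/funext => v; rewrite /gauge_transform.
  by rewrite mulrDr mulrCA.
- by rewrite gauge_norm gelfand_norm.
pose g' t v := expi (- gauge_phase v0 alpha phi v + dot (- gauge_potential v0 m v) t) * g t v.
have g'F : fiber_space g'.
  by move: gF => /fiber_spaceP gF; apply/fiber_spaceP => v; exact: sqintegrable_phase.
have [f fl2 fg'] := gelfand_surjective g'F; exists f => //.
apply: ae_eq_fiber_trans (gauge_ae_eq fg') _; apply: ae_all => t; apply/funext => v.
rewrite /gauge_transform /g' mulrA -expiD dotNl.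
by rewrite addrACA !subrr addr0 expi0 mul1r.
Qed.

Lemma gauge_gelfand_schroedinger f : l2 f ->
  ae_eq_fiber (U (schroedinger (pgraph G) alpha Q f))
    (direct_integral (fiber_schroedinger Gs m phi (fun v => Q (val v))) (U f)).
Proof.
move=> fl2; apply: ae_eq_fiber_trans (gauge_ae_eq (gelfand_schroedinger B am Qp fl2)) _.
apply: ae_all => t; apply/funext => v.
rewrite /gauge_transform /direct_integral /gelfand_fiber /fiber_schroedinger mulrDr.
rewrite (fiber_laplacian_gauge t _ v gauge_potential_edge gauge_phase_edge).
by rewrite mulrCA.
Qed.

End Gauge.

Section UnitaryEquivalence.
Variables (R : realType) (n : nat) (V A : finType) (G : mgraph V A).

(** Conjugation by the diagonal matrix of gauge factors at the point [t]. *)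
Lemma fiber_laplacian_unitarily_equivalent (m m' : A -> 'rV[R]_n) (phi phi' : A -> R)
    (w : V -> 'rV[R]_n) (theta : V -> R) (t : torus R n) :
  (forall e, m e - m' e = w (tgt G e) - w (src G e)) ->
  (forall e, exists k : int,
    phi e - phi' e = theta (tgt G e) - theta (src G e) + (2 * pi) *~ k) ->
  unitarily_equivalent (fiber_laplacian G m phi t) (fiber_laplacian G m' phi' t).
Proof.
move=> mE phiE; pose x v := theta v + dot (w v) t.
exists (fun f v => expi (x v) * f v); split; last first.
  by move=> f; apply/funext => v; exact: fiber_laplacian_gauge.
split=> [a f f'|f f'|f].
- by apply/funext => v; rewrite mulrDr mulrCA.
- apply: eq_bigr => v _.
  have E (z z' z'' : R[i]) : z * z' * (z * z'')^*%C = (z * z^*%C) * (z' * z''^*%C).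
    by rewrite rmorphM mulrACA.
  by rewrite [LHS]E mulcconj sqnorm_expi mul1r.
- exists (fun v => expi (- x v) * f v); apply/funext => v.
  by rewrite mulrA -expiD subrr expi0 mul1r.
Qed.

End UnitaryEquivalence.

(** * Trivial exponentials of minimal forms *)
Section Counting.
Variables (R : realType) (n : nat).

Lemma expi_pi_neq1 : expi (pi : R) <> 1.
Proof. by rewrite /expi cospi sinpi => -[/eqP]; rewrite -subr_eq0 -opprD oppr_eq0 (eqr_nat R 2 0). Qed.

Lemma integral_wave_trivial (k : 'rV[int]_n) :
  (forall t : torus R n, expi (dot (zvec R k) t) = 1) -> k = 0.
Proof.
move=> k1; apply/rowP => i; rewrite mxE; apply: contrapT => /eqP ki.
have ki' : ((k 0 i)%:~R : R) != 0 by rewrite intr_eq0.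
(* At this point the exponential is expi pi = -1. *)
pose t : torus R n := [tuple if j == i then pi / (k 0 i)%:~R else 0 | j < n].
have := k1 t; rewrite /dot (bigD1 i)//= big1 ?addr0.
  by rewrite tnth_mktuple eqxx mxE mulrC divfK//; exact: expi_pi_neq1.
by move=> j /negbTE ji; rewrite tnth_mktuple ji mulr0.
Qed.

Lemma dot_at0 (x : 'rV[R]_n) : dot x ([tuple 0 | j < n] : torus R n) = 0.
Proof. by rewrite /dot big1// => i _; rewrite tnth_mktuple mulr0. Qed.

End Counting.

Section Supports.
Variables (R : realType) (d : nat) (Gam : lattice R d) (G : periodic_graph Gam).
Variable B : lattice_basis Gam.
Let Gs := fundamental_graph G B.
Variables (m : fdart G -> 'rV[R]_d) (phi : fdart G -> R) (alpha : pdart G -> R).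
Hypothesis am : magnetic_potential alpha.
Hypothesis mmin : minimal_form (same_flux Gs (coordinate_form B)) m.
Hypothesis phimin : minimal_form (same_flux_mod2pi Gs (magnetic_form alpha)) phi.

Lemma minimal_phase_trivial e : expi (phi e) = 1 -> phi e = 0.
Proof.
move=> /expi_eq1[k kE]; move: phimin; rewrite same_flux_mod2piE => pmin.
apply: (minimal_value_eq0 (@fundamental_connected _ _ _ G B) _ _ pmin).
- exact: is_subgroup_mulz.
- exact: magnetic_form_is_form.
- by exists k.
Qed.

Lemma minimal_phase_trivialE e : (expi (phi e) != 1) = (phi e != 0).
Proof.
apply/idP/idP; apply: contra_neq; last exact: minimal_phase_trivial.
by move=> ->; rewrite expi0.
Qed.

(** Evaluation at the origin isolates the magnetic phase; without it, only an
    integral frequency is left, by [minimal_integral]. *)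
Lemma minimal_wave_trivial e :
  (forall t : torus R d, expi (phi e + dot (m e) t) = 1) <-> phi e = 0 /\ m e = 0.
Proof.
split=> [e1|[-> ->] t]; last by rewrite dot0l addr0 expi0.
have phi0 : phi e = 0.
  by apply: minimal_phase_trivial; have := e1 [tuple 0 | j < d]; rewrite dot_at0 addr0.
split=> //; have [n _ nE] : range (@zvec R d) (m e) by apply: (minimal_integral mmin); exists e.
rewrite -nE (_ : n = 0) ?zvec0//; apply: integral_wave_trivial => t.
by have := e1 t; rewrite phi0 add0r -nE.
Qed.

Lemma minimal_coordinate_wave_trivial e :
  (forall t : torus R d, expi (dot (m e) t) = 1) <-> m e = 0.
Proof.
split=> [e1|-> t]; last by rewrite dot0l expi0.
have [n _ nE] : range (@zvec R d) (m e) by apply: (minimal_integral mmin); exists e.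
rewrite -nE (_ : n = 0) ?zvec0//; apply: integral_wave_trivial => t.
by have := e1 t; rewrite -nE.
Qed.

End Supports.

Lemma half_cardK (A : finType) (S : {set A}) : 2 * half_card S = #|S|%:R.
Proof. by rewrite /half_card mulrC divfK. Qed.

Theorem theorem2p1 (R : realType) (d : nat) (Gam : lattice R d)
    (B : lattice_basis Gam) (G : periodic_graph Gam)
    (alpha : pdart G -> R) (Q : pvert G -> R)
    (m : fdart G -> 'rV[R]_d) (phi : fdart G -> R) :
  let Gs := fundamental_graph G B in
  magnetic_potential alpha ->
  periodic_potential Q ->
  minimal_form (same_flux Gs (coordinate_form B)) m ->
  minimal_form (same_flux_mod2pi Gs (magnetic_form alpha)) phi ->
  [/\
    (* (i) *)
    gen_subgroup (range m) = range (@zvec R d) /\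
    [set flux m c | c in cycle_space Gs] = range (@zvec R d),
    (* (ii) *)
    (forall v0 : fvert G B,
      let U := fun f => gauge_transform v0 alpha m phi (gelfand f) in
      [/\ forall (v : fvert G B) (p : seq (fdart G)), walk Gs v0 p v ->
            gauge_potential v0 m v =
              path_sum (fun e => zvec R (index_form B e) - m e) p /\
            exists k : int, gauge_phase v0 alpha phi v =
              path_sum (fun e => magnetic_form alpha e - phi e) p + (2 * pi) *~ k,
          forall f : pvert G -> R[i], l2 f ->
            is_gelfand f (gelfand f : torus R d -> fvert G B -> R[i]),
          unitary_to_fiber_space U
        & forall f : pvert G -> R[i], l2 f ->
            l2 (schroedinger (pgraph G) alpha Q f) /\
            ae_eq_fiber (U (schroedinger (pgraph G) alpha Q f))
              (direct_integral
                 (fiber_schroedinger Gs m phi (fun v => Q (val v))) (U f))]),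
    (* (iii) *)
    (forall (m' : fdart G -> 'rV[R]_d) (phi' : fdart G -> R),
      minimal_form (same_flux Gs (coordinate_form B)) m' ->
      minimal_form (same_flux_mod2pi Gs (magnetic_form alpha)) phi' ->
      forall t : torus R d,
        unitarily_equivalent (fiber_laplacian Gs m phi t)
                             (fiber_laplacian Gs m' phi' t)),
    (* (iv) *)
    [/\ #|[set e | `[< ~ forall t : torus R d, expi (dot (m e) t) = 1 >]]%SET|%:R
          = 2 * half_card (supp m),
        #|[set e | expi (phi e) != 1]%SET|%:R = 2 * half_card (supp phi)
      & #|[set e | `[< ~ forall t : torus R d,
                       expi (phi e + dot (m e) t) = 1 >]]%SET|%:R
          = 2 * half_card (supp m :|: supp phi)%SET]
    (* (v) *)
  & [/\ forall m' : fdart G -> 'rV[R]_d,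
          minimal_form (same_flux Gs (coordinate_form B)) m' ->
          half_card (supp m') = half_card (supp m),
        forall (Gam' : lattice R d) (G' : periodic_graph Gam')
               (B' : lattice_basis Gam') (m' : fdart G' -> 'rV[R]_d),
          same_periodic_graph G G' ->
          minimal_form (same_flux (fundamental_graph G' B') (coordinate_form B')) m' ->
          half_card (supp m') = half_card (supp m)
      & forall (B' : lattice_basis Gam) (m' : fdart G -> 'rV[R]_d),
          minimal_form (same_flux (fundamental_graph G B') (coordinate_form B')) m' ->
          half_card (supp m') = half_card (supp m)]].
Proof.
move=> Gs am Qp mmin phimin.
have mF := mmin.1; have phiF := phimin.1.
split.
- by split; [exact: minimal_generates mmin|exact: flux_minimal_range mF].
- move=> v0 U; split.
  + move=> v p vp; split; first exact: gauge_potential_walk.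
    exact: gauge_phase_walk.
  + by move=> f; exact: gelfandP.
  + exact: gauge_gelfand_unitary.
  + move=> f fl2; split; first exact: (l2_schroedinger B).
    exact: gauge_gelfand_schroedinger.
- move=> m' phi' [m'F _] [phi'F _] t.
  have conGs : connected_graph Gs := @fundamental_connected _ _ _ G B.
  move: mF m'F; rewrite !same_fluxE => mC m'C.
  have [w wE] := flux_class_gauge conGs (@is_subgroup0 _)
    (@coordinate_form_is_form _ _ _ G B) mC m'C.
  move: phiF phi'F; rewrite !same_flux_mod2piE => phiC phi'C.
  have [theta thetaE] := flux_class_gauge conGs (@is_subgroup_mulz R^o (2 * pi))
    (magnetic_form_is_form B am) phiC phi'C.
  apply: (@fiber_laplacian_unitarily_equivalent _ _ _ _ _ _ _ _ _ w theta) => e.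
    by have /eqP := wE e; rewrite subr_eq0 => /eqP.
  by have [k _ kE] := thetaE e; exists k; rewrite kE [RHS]addrC subrK.
- rewrite !half_cardK; split; congr (#|pred_of_set _|%:R); apply/setP => e; rewrite !inE.
  + apply/asboolP/idP => [ne|/eqP me]; first by apply/eqP => me; exact/ne/(minimal_coordinate_wave_trivial mmin).
    by move=> /(minimal_coordinate_wave_trivial mmin).
  + exact: (minimal_phase_trivialE am phimin).
  + apply/asboolP/orP => [ne|ne /(minimal_wave_trivial am mmin phimin)[p0 m0]].
      have [m0|] := eqVneq (m e) 0; last by left.
      by right; apply/eqP => p0; apply/ne/(minimal_wave_trivial am mmin phimin).
    by case: ne; rewrite ?p0 ?m0 eqxx.
- split.
  + by move=> m' m'min; rewrite /half_card
      (minimal_card_invariant (same_periodic_graph_refl G) mmin m'min).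
  + by move=> Gam' G' B' m' iso m'min; rewrite /half_card (minimal_card_invariant iso mmin m'min).
  + by move=> B' m' m'min; rewrite /half_card
      (minimal_card_invariant (same_periodic_graph_refl G) mmin m'min).
Qed.
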